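(* Let $M\ge 0$, $s>1/2$, $\nu\ge 0$, $Q\ge 0$, $\lambda>0$. Let $\widetilde{f}^{\mathbf I}$ be the estimator (Algorithm I) defined in the context, with maximal level $L^{\mathbf I}$. Suppose that the design is regular up to level $L=L^{\mathbf I}$, i.e. there is a constant $C\ge 0$ such that for all $\ell\le L^{\mathbf I}$ every eigenvalue of $\Omega_\ell$ is at most $C$. Then for sufficiently large thresholding constants $\kappa,\tau_{sig},\tau_{op}$, and for all sufficiently small $\varepsilon,\delta>0$, $$\sup_{f\in\mathcal W^s(M),\; g\in\mathcal K_\nu(Q)}\mathbb E\|\widetilde f^{\mathbf I}-f\|_{L^2(\mathbb R_+)}\;\le\; c\,\Big[\big(\delta|\log\delta|\big)^{\frac{2s}{2(s+\nu)+1}}\vee\big(\varepsilon\sqrt{|\log\varepsilon|}\big)^{\frac{2s}{2(s+\nu)+1}}\Big],$$ where $c$ is a constant depending only on $\lambda,\kappa,\tau_{sig},\tau_{op},s,M,\nu,Q$.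
   Context: Notation: $a\vee b=\max(a,b)$; $\|\cdot\|_{op}$ is the spectral norm of a matrix; ${}^tA$ is the transpose of $A$. Laguerre functions: $\phi_\ell(t)=e^{-t/2}\sum_{j=0}^{\ell}(-1)^j\binom{\ell}{j}\frac{t^j}{j!}$, $\ell\ge 0$; they form an orthonormal basis of $L^2(\mathbb R_+)$. For $h\in L^2(\mathbb R_+)$ put $\check h_\ell=\int_0^\infty h\phi_\ell$ and $h^\ell=(\check h_0,\dots,\check h_\ell)\in\mathbb R^{\ell+1}$. For $s>0$ the Laguerre–Sobolev space is $\mathcal W^s=\{f\in L^2(\mathbb R_+):\sum_{\ell\ge0}|(\ell+\tfrac12)^s\check f_\ell|^2<\infty\}$, with norm $\|f\|_{\mathcal W^s}=\big(\sum_{\ell\ge 0}|(\ell+\tfrac12)^s\check f_\ell|^2\big)^{1/2}$, and $\mathcal W^s(M)$ is its ball of radius $M$. Kernel: $g\in L^2(\mathbb R_+)$ with $\check g_0\ne 0$. Let $\dot g$ be the function with Laguerre coefficients $\check{\dot g}_0=\check g_0$, $\check{\dot g}_\ell=\check g_\ell-\check g_{\ell-1}$ for $\ell\ge 1$. For a sequence $a=(a_k)_{k\ge 0}$, $T_\ell(a)$ is the $(\ell+1)\times(\ell+1)$ lower triangular Toeplitz matrix with first column $(a_0,\dots,a_\ell)$; for a function, $T_\ell$ is applied to its Laguerre coefficients. Put $K^\ell=T_\ell(\dot g)$; this is the matrix, in the basis $\phi_0,\dots,\phi_\ell$, of the Galerkin projection of the operator $f\mapsto\big(t\mapsto\int_0^t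 g(t-\tau)f(\tau)\,d\tau\big)$. Class $\mathcal K_\nu(Q)$: the set of such $g$ with $\|(K^\ell)^{-1}\|_{op}\le Q(\ell\vee 1)^\nu$ for all $\ell\ge 0$. Design and noise: $0\le t_1\le\dots\le t_n\le T_n$ are observation points, $\sigma>0$ is fixed, $T_n\to\infty$ and $T_n/n\to 0$ as $n\to\infty$, and $n/T_n>\sigma$ for all $n\ge n_0$ for some integer $n_0$. Put $\varepsilon=\sigma\sqrt{T_n/n}$. Let $\Phi_\ell$ be the $n\times(\ell+1)$ matrix with entries $\phi_k(t_i)$, $1\le i\le n$, $0\le k\le\ell$, and $\Omega_\ell=\frac{n}{T_n}({}^t\Phi_\ell\Phi_\ell)^{-1}$. Observations: for each $\ell$, $$y^\ell=K^\ell f^\ell+\varepsilon\,\xi_\ell,\qquad K_\delta^\ell=K^\ell+\delta B^\ell,$$ where $\xi_\ell\sim\mathcal N(0,\Omega_\ell)$ (explicitly $\xi_\ell=\sqrt{n/T_n}\,({}^t\Phi_\ell\Phi_\ell)^{-1}\,{}^t\Phi_\ell\,\eta$ with $\eta\sim\mathcal N(0,I_n)$), $B^\ell=T_\ell(b)$ with $b=(b_k)_{k\ge0}$ i.i.d. standard Gaussian variables, and $b$ is independent of $\eta$. Here $\delta>0$ is the operator noise level. Results are asymptotic as $\varepsilon,\delta\to 0$. Algorithm I: with constants $\lambda,\kappa,\tau_{sig},\tau_{op}>0$ set $$L^{\mathbf I}=\lambda\big(\varepsilon\sqrt{|\log\varepsilon|}\vee\delta|\log\delta|\big)^{-1/(\nu+1)},\qquad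 O_{\ell,\delta}=\kappa\big((\ell\vee1)\log(\ell\vee2)\big)^{1/2}\delta\sqrt{|\log\delta|},$$ $$S_\ell^{\mathbf I}=(\ell\vee1)^\nu\big(\tau_{sig}\,\varepsilon\sqrt{|\log\varepsilon|}\vee\tau_{op}\,\delta|\log\delta|\big).$$ Let $\zeta_\ell$ be the last coordinate (the coefficient on $\phi_\ell$) of $(K_\delta^\ell)^{-1}y^\ell$ if $\|(K_\delta^\ell)^{-1}\|_{op}<O_{\ell,\delta}^{-1}$, and $\zeta_\ell=0$ otherwise. The estimator is $$\widetilde f^{\mathbf I}=\sum_{\ell\le L^{\mathbf I}}\zeta_\ell\,\mathbf 1_{\{|\zeta_\ell|>S_\ell^{\mathbf I}\}}\,\phi_\ell.$$ ''Sufficiently large'' thresholding constants means larger than some threshold depending only on $\lambda,s,M,\nu,Q$ and $C$. *)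

(* Defs.v *)
From HB Require Import structures.
From mathcomp Require Import all_boot all_order all_algebra.
From mathcomp Require Import all_classical all_reals all_analysis.

Set Implicit Arguments.
Unset Strict Implicit.
Unset Printing Implicit Defensive.
Import Order.TTheory GRing.Theory Num.Theory.
Import numFieldNormedType.Exports.

Local Open Scope classical_set_scope.
Local Open Scope ring_scope.

(* A function on R_+ is represented by a function on R whose values on ]-oo, 0[
   are irrelevant; [f \_ Rplus] is its extension by zero. *)

Definition Rplus (R : realType) : set R := [set` `[0, +oo[%R].
Arguments Rplus {R}.

Definition normL2 (R : realType) (f : R -> R) : \bar R :=
  Lnorm lebesgue_measure 2%:E (EFin \o (f \_ Rplus)).

Definition inL2 (R : realType) (f : R -> R) : Prop :=
  measurable_fun Rplus f /\ (normL2 f < +oo)%E.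

Definition laguerre (R : realType) (l : nat) (t : R) : R :=
  expR (- t / 2) *
  \sum_(0 <= j < l.+1) (-1) ^+ j * ('C(l, j))%:R * (t ^+ j / (j`!)%:R).

Definition lcoef (R : realType) (h : R -> R) (l : nat) : R :=
  \int[lebesgue_measure]_(t in Rplus) (h t * laguerre l t).

Definition lvec (R : realType) (h : R -> R) (l : nat) : 'cV[R]_l.+1 :=
  \col_(i < l.+1) lcoef h i.

Definition sobolev_norm (R : realType) (s : R) (f : R -> R) : \bar R :=
  ((\sum_(0 <= l <oo) (`|(l%:R + 1 / 2) `^ s * lcoef f l| ^+ 2)%:E) `^ (1 / 2)%R)%E.

Definition sobolev (R : realType) (s : R) : set (R -> R) :=
  [set f | inL2 f /\
    (\sum_(0 <= l <oo) (`|(l%:R + 1 / 2) `^ s * lcoef f l| ^+ 2)%:E < +oo)%E].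

Definition sobolev_ball (R : realType) (s M : R) : set (R -> R) :=
  [set f | sobolev s f /\ (sobolev_norm s f <= M%:E)%E].

(* The library's norm on ['M[R]_(m, n)] is the sup norm of the entries, hence the
   explicit Euclidean and spectral norms. *)

Definition euclid (R : realType) (m : nat) (x : 'cV[R]_m) : R :=
  Num.sqrt (\sum_(i < m) x i ord0 ^+ 2).

Definition opnorm (R : realType) (m p : nat) (A : 'M[R]_(m, p)) : R :=
  sup [set euclid (A *m x) | x in [set x : 'cV[R]_p | euclid x <= 1]].

Definition toeplitz (R : realType) (l : nat) (a : nat -> R) : 'M[R]_l.+1 :=
  \matrix_(i < l.+1, j < l.+1) if (j <= i)%N then a (i - j)%N else 0.

(* Laguerre coefficients of the function "g dot". *)
Definition dot_coef (R : realType) (g : R -> R) (l : nat) : R :=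
  if l is k.+1 then lcoef g k.+1 - lcoef g k else lcoef g 0.

Definition Kmat (R : realType) (g : R -> R) (l : nat) : 'M[R]_l.+1 :=
  toeplitz l (dot_coef g).

(* [invmx] is the inverse here, as [lcoef g 0 != 0] makes [Kmat g l]
   invertible. *)
Definition kernel_class (R : realType) (nu Q : R) : set (R -> R) :=
  [set g | [/\ inL2 g, lcoef g 0 != 0 &
    forall l : nat, opnorm (invmx (Kmat g l)) <= Q * (maxn l 1)%:R `^ nu]].

(* For each sample size [n], the time horizon is [T n] and the observation points
   are [t n i], [i < n]. *)

Definition noise_level (R : realType) (sigma : R) (T : nat -> R) (n : nat) : R :=
  sigma * Num.sqrt (T n / n%:R).

Record is_design (R : realType) (sigma : R) (T : nat -> R)
    (t : forall n : nat, 'I_n -> R) : Prop := IsDesign {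
  design_bounds : forall (n : nat) (i : 'I_n), 0 <= t n i <= T n ;
  design_sorted : forall (n : nat) (i j : 'I_n), (i <= j)%N -> t n i <= t n j ;
  design_horizon : T n @[n --> \oo] --> +oo ;
  design_rate : T n / n%:R @[n --> \oo] --> 0 ;
  design_sigma : exists n0 : nat, forall n : nat, (n0 <= n)%N ->
    sigma < n%:R / T n }.

Definition Phi (R : realType) (n : nat) (t : 'I_n -> R) (l : nat)
    : 'M[R]_(n, l.+1) :=
  \matrix_(i < n, k < l.+1) laguerre k (t i).

Definition gram (R : realType) (n : nat) (t : 'I_n -> R) (l : nat)
    : 'M[R]_l.+1 :=
  (Phi t l)^T *m Phi t l.

Definition Omega (R : realType) (n : nat) (T : R) (t : 'I_n -> R) (l : nat)
    : 'M[R]_l.+1 :=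
  (n%:R / T) *: invmx (gram t l).

(* That [gram t l] is invertible is part of the condition on [Omega], since
   [invmx] returns a singular matrix unchanged. *)
Definition regular_design (R : realType) (n : nat) (T : R) (t : 'I_n -> R)
    (L C : R) : Prop :=
  forall l : nat, l%:R <= L ->
    gram t l \in unitmx /\ (forall a : R, eigenvalue (Omega T t l) a -> a <= C).

(* In the next three definitions, [e] and [b] are realized values of the Gaussian
   noises eta and b. *)

Definition signal_noise (R : realType) (n : nat) (T : R) (t : 'I_n -> R)
    (e : 'cV[R]_n) (l : nat) : 'cV[R]_l.+1 :=
  Num.sqrt (n%:R / T) *: (invmx (gram t l) *m (Phi t l)^T *m e).

Definition obs_signal (R : realType) (f g : R -> R) (eps : R) (n : nat) (T : R)
    (t : 'I_n -> R) (e : 'cV[R]_n) (l : nat) : 'cV[R]_l.+1 :=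
  Kmat g l *m lvec f l + eps *: signal_noise T t e l.

Definition obs_operator (R : realType) (g : R -> R) (delta : R) (b : nat -> R)
    (l : nat) : 'M[R]_l.+1 :=
  Kmat g l + delta *: toeplitz l b.

Definition max_level (R : realType) (lambda nu eps delta : R) : R :=
  lambda * (Num.max (eps * Num.sqrt `|ln eps|) (delta * `|ln delta|))
             `^ (- (nu + 1)^-1).

Definition op_threshold (R : realType) (kappa delta : R) (l : nat) : R :=
  kappa * Num.sqrt ((maxn l 1)%:R * ln (maxn l 2)%:R)
        * (delta * Num.sqrt `|ln delta|).

Definition sig_threshold (R : realType) (nu tau_sig tau_op eps delta : R)
    (l : nat) : R :=
  (maxn l 1)%:R `^ nu *
  Num.max (tau_sig * (eps * Num.sqrt `|ln eps|)) (tau_op * (delta * `|ln delta|)).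

(* A singular [Kd] (an event of probability zero) counts as having an inverse of
   infinite norm. *)
Definition coef_estimator (R : realType) (kappa delta : R) (l : nat)
    (Kd : 'M[R]_l.+1) (y : 'cV[R]_l.+1) : R :=
  if (Kd \in unitmx) && (opnorm (invmx Kd) < (op_threshold kappa delta l)^-1)
  then (invmx Kd *m y) ord_max ord0
  else 0.

(* As [max_level] is nonnegative when [lambda] is, the sum ranges over the levels
   [l] with [l%:R <= max_level]. *)
Definition estimator (R : realType) (lambda nu kappa tau_sig tau_op eps delta : R)
    (Kd : forall l : nat, 'M[R]_l.+1) (y : forall l : nat, 'cV[R]_l.+1)
    (x : R) : R :=
  \sum_(0 <= l < (Num.truncn (max_level lambda nu eps delta)).+1)
    let z := coef_estimator kappa delta (Kd l) (y l) in
    if sig_threshold nu tau_sig tau_op eps delta l < `|z|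
    then z * laguerre l x else 0.

Definition mutually_independent (d : measure_display) (Om : measurableType d)
    (R : realType) (P : probability Om R) (I : choiceType)
    (X : I -> {RV P >-> R}) : Prop :=
  forall (J : seq I) (A : I -> set R), uniq J ->
    (forall i, measurable (A i)) ->
    P (\bigcap_(i in [set` J]) (X i @^-1` A i)) =
    (\prod_(i <- J) P (X i @^-1` A i))%E.

Definition sigma_generated (d : measure_display) (Om : measurableType d)
    (R : realType) (P : probability Om R) (I : Type)
    (X : I -> {RV P >-> R}) : set (set Om) :=
  <<s [set E | exists i (A : set R), measurable A /\ E = X i @^-1` A] >>.

Definition independent_families (d : measure_display) (Om : measurableType d)
    (R : realType) (P : probability Om R) (I J : Type)
    (X : I -> {RV P >-> R}) (Y : J -> {RV P >-> R}) : Prop :=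
  forall E F : set Om, sigma_generated X E -> sigma_generated Y F ->
    P (E `&` F) = (P E * P F)%E.

(* For a finite index type, this says that [X] is a vector with law N(0, I). *)
Definition iid_std_normal (d : measure_display) (Om : measurableType d)
    (R : realType) (P : probability Om R) (I : choiceType)
    (X : I -> {RV P >-> R}) : Prop :=
  mutually_independent X /\
  forall (i : I) (A : set R), measurable A ->
    distribution P (X i) A = normal_prob 0 1 A.

(* E || f~ - f ||, where the norm is extended-real valued. *)

Definition risk (R : realType) (lambda nu kappa tau_sig tau_op eps delta : R)
    (n : nat) (T : R) (t : 'I_n -> R)
    (d : measure_display) (Om : measurableType d) (P : probability Om R)
    (b : nat -> {RV P >-> R}) (eta : 'I_n -> {RV P >-> R})
    (f g : R -> R) : \bar R :=
  (\int[P]_w normL2 (fun x : R =>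
     (estimator lambda nu kappa tau_sig tau_op eps delta
       (obs_operator g delta (fun k => b k w))
       (obs_signal f g eps T t (\col_i eta i w)) x - f x)%R))%E.

(* Main.v *)
Require Import Defs.
From HB Require Import structures.
From mathcomp Require Import all_boot all_order all_algebra.
From mathcomp Require Import all_classical all_reals all_analysis.
From mathcomp Require Import measurable_realfun ring lra zify.

Set Implicit Arguments.
Unset Strict Implicit.
Unset Printing Implicit Defensive.
Import Order.TTheory GRing.Theory Num.Theory.
Import numFieldNormedType.Exports.

Local Open Scope classical_set_scope.
Local Open Scope ring_scope.

(** Fix [f], [g] and a level [l]; write [K = Kmat g l], [F = lvec f l], let [B] and
[xi] be the operator and the signal noise, [H = K^-1 B] and [X = K^-1 xi]. Since
[K + delta B = K (1 + delta H)], the error [w = (K + delta B)^-1 y - F] of the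
inversion solves [w + delta H w = eps X - delta H F].

The entries of [H] and of [X] are linear forms in the Gaussian noises. As [B] is a
Toeplitz matrix, an entry of [H] has for coefficients part of a row of [K^-1], so its
standard deviation is at most the spectral norm of [K^-1], at most [Q l^nu]
([mulmx_toeplitz_lincomb], [row_le_opnorm]). The bound [C] on the eigenvalues of
[Omega] makes the standard deviation of an entry of [X] at most [Q l^nu sqrt C]
([noise_form_le]). Allow [6 sqrt |ln delta|], resp. [6 sqrt |ln eps|], standard
deviations. Up to the maximal level [L], [l^(nu+1) delta |ln delta|] is at most
[lambda^(nu+1)], and so [l^(nu+1) delta sqrt |ln delta|] is small: [1 + delta H] is
invertible with an inverse of norm at most 2, for the sup norm and for the Euclidean
one. Hence the estimated operator passes the test on the norm of its inverse
([perturbed_opnorm]), and [w] is at most twice the right-hand side of its equation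
([perturbed_error]). There [H F] is at most the largest entry of [H] times the sum of
the absolute values of the coefficients of [f], which is bounded over the ball
because [s > 1/2] ([sobolev_abs_sum]). For large thresholding constants, [w] is then
at most half the threshold [S_l], and thresholding leaves a loss of at most
[min(|f_l|, 3/2 S_l)] on the coefficient [f_l] ([thresholded_close]). The sum of the
squares of these minima over [l] is a bias-variance trade-off which gives the rate
([tradeoff]).

An excess over these deviations has a probability of order [delta^18], resp.
[eps^18], up to a power of [l]. It is enough to bound the loss by an affine function
of the noises whose coefficients are powers of [l] and of [delta^-1]. This
is the same equation for [w] if the signal noise alone is in excess. If the operator
noise is, the test on the norm of the inverse bounds it by [delta^-1], and [w] is
written [(K + delta B)^-1 (eps xi - delta B F)], without the norm of [K], on which
there is no bound ([crude_error]). The expectations over the improbable events are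
bounded by means of exponential moments ([excess], [level_excess]); summed up to
[L], they are negligible compared with the rate.

Finally the squared loss is the sum of the squared errors on the coefficients up to
[L] and of the squares of the following coefficients ([normL2_lincomb_sub],
[tail_sq_le]). This is Parseval's identity, hence rests on the completeness of the
Laguerre functions ([laguerre_complete]): exponentials are in their closed span
because their coefficients form geometric sequences ([span_exp]), polynomials in an
exponential approximate the indicators of rays, and a Dynkin system argument reaches
all Borel sets. [risk_le] puts everything together. *)

(** * Geometry of square integrable functions *)

Section L2space.
Context d (T : measurableType d) (R : realType).
Variables (mu : {measure set T -> \bar R}) (D : set T) (mD : measurable D).
Implicit Types f g h : T -> R.

Definition sq_integrable f :=
  measurable_fun D f /\ mu.-integrable D (EFin \o (fun x => f x ^+ 2)).

Definition ip f g : R := \int[mu]_(x in D) (f x * g x).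

Lemma sq_integrable_prod f g : sq_integrable f -> sq_integrable g ->
  mu.-integrable D (EFin \o (fun x => f x * g x)).
Proof.
move=> [mf f2] [mg g2].
apply: (@le_integrable _ _ _ _ _ mD _
  (EFin \o (fun x => f x ^+ 2 + g x ^+ 2))).
- by apply/measurable_EFinP; exact: measurable_funM.
- move=> x _ /=; rewrite lee_fin [leRHS]ger0_norm; last by rewrite addr_ge0 ?sqr_ge0.
  by rewrite ler_norml; apply/andP; split; nra.
- by apply: eq_integrable (integrableD mD f2 g2) => //= x _; rewrite /= EFinD.
Qed.

Lemma sq_integrableD f g : sq_integrable f -> sq_integrable g ->
  sq_integrable (fun x => f x + g x).
Proof.
move=> Lf Lg; have [mf f2] := Lf; have [mg g2] := Lg.
split; first exact: measurable_funD.
have fg := integrableZl mD 2 (sq_integrable_prod Lf Lg).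
apply: eq_integrable (integrableD mD (integrableD mD f2 g2) fg) => //= x _.
by rewrite /= -EFinM -!EFinD; congr EFin; ring.
Qed.

Lemma sq_integrableZ (c : R) f : sq_integrable f -> sq_integrable (fun x => c * f x).
Proof.
move=> [mf f2]; split; first exact: measurable_funM.
apply: eq_integrable (integrableZl mD (c ^+ 2) f2) => //= x _.
by rewrite /= -EFinM exprMn.
Qed.

Lemma sq_integrableB f g : sq_integrable f -> sq_integrable g ->
  sq_integrable (fun x => f x - g x).
Proof.
move=> Lf /(sq_integrableZ (-1)) /(sq_integrableD Lf).
by under eq_fun do rewrite mulN1r.
Qed.

Lemma sq_integrable0 : sq_integrable (fun _ => 0).
Proof.
split=> //; have := @integrable0 _ _ _ mu D.
by apply: eq_integrable => //= x _; rewrite /= expr0n.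
Qed.

Lemma sq_integrable_sum (I : Type) (r : seq I) (F : I -> T -> R) :
  (forall i, sq_integrable (F i)) -> sq_integrable (fun x => \sum_(i <- r) F i x).
Proof.
move=> LF; elim: r => [|i r IH].
  by under eq_fun do rewrite big_nil; exact: sq_integrable0.
by under eq_fun do rewrite big_cons; exact: sq_integrableD.
Qed.

Lemma ipC f g : ip f g = ip g f.
Proof. by apply: eq_Rintegral => x _; rewrite mulrC. Qed.

Lemma ipDl f g h : sq_integrable f -> sq_integrable g -> sq_integrable h ->
  ip (fun x => f x + g x) h = ip f h + ip g h.
Proof.
move=> Lf Lg Lh; rewrite /ip -RintegralD//; [|exact: sq_integrable_prod..].
by apply: eq_Rintegral => x _; rewrite mulrDl.
Qed.

Lemma ipZl (c : R) f g : sq_integrable f -> sq_integrable g ->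
  ip (fun x => c * f x) g = c * ip f g.
Proof.
move=> Lf Lg; rewrite /ip -RintegralZl//; last exact: sq_integrable_prod.
by apply: eq_Rintegral => x _; rewrite mulrA.
Qed.

Lemma ipZr (c : R) f g : sq_integrable f -> sq_integrable g ->
  ip f (fun x => c * g x) = c * ip f g.
Proof. by move=> Lf Lg; rewrite ipC ipZl// ipC. Qed.

Lemma ip0l f : ip (fun _ => 0) f = 0.
Proof.
rewrite /ip (@eq_Rintegral _ _ _ mu D (fun=> 0)); last by move=> x _; rewrite mul0r.
by rewrite Rintegral_cst// mul0r.
Qed.

Lemma ip_suml (I : Type) (r : seq I) (F : I -> T -> R) h :
  (forall i, sq_integrable (F i)) -> sq_integrable h ->
  ip (fun x => \sum_(i <- r) F i x) h = \sum_(i <- r) ip (F i) h.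
Proof.
move=> LF Lh; elim: r => [|i r IH].
  by rewrite big_nil; under [fun x => _]eq_fun do rewrite big_nil; exact: ip0l.
rewrite big_cons -IH -ipDl//; last exact: sq_integrable_sum.
by under [fun x => \sum_(j <- _) _]eq_fun do rewrite big_cons.
Qed.

Lemma ip_sqB f g : sq_integrable f -> sq_integrable g ->
  ip (fun x => f x - g x) (fun x => f x - g x) = ip f f - 2 * ip f g + ip g g.
Proof.
move=> Lf Lg.
have LNg : sq_integrable (fun x => - 1 * g x) by exact: sq_integrableZ.
have LfNg := sq_integrableD Lf LNg.
have -> : (fun x => f x - g x) = (fun x => f x + - 1 * g x).
  by apply/funext => x; rewrite mulN1r.
rewrite ipDl// ipC ipDl// ipZl// (ipC (fun x => -1 * g x) (fun x => _ + _)).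
rewrite ipDl// ipZl// (ipC f (fun x => -1 * g x)) ipZl// (ipC g (fun x => -1 * g x)) ipZl//.
by rewrite (ipC g f); ring.
Qed.

Lemma ip_ge0 f : 0 <= ip f f.
Proof. by apply: Rintegral_ge0 => x _; rewrite -expr2 sqr_ge0. Qed.

Lemma ip_sqD_le f g : sq_integrable f -> sq_integrable g ->
  ip (fun x => f x + g x) (fun x => f x + g x) <= 2 * ip f f + 2 * ip g g.
Proof.
move=> Lf Lg; have LN := sq_integrableZ (-1) Lg.
have := ip_ge0 (fun x => f x - g x); rewrite ip_sqB// => H.
have -> : (fun x => f x + g x) = (fun x => f x - -1 * g x).
  by apply/funext => x; rewrite mulN1r opprK.
by rewrite ip_sqB// !ipZr// ipZl//; lra.
Qed.

Section orthonormal.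
Variable e : nat -> T -> R.
Hypothesis Le : forall l, sq_integrable (e l).
Hypothesis orth : forall k l, ip (e k) (e l) = (k == l)%:R.

Definition lincomb (c : nat -> R) N x := \sum_(0 <= l < N) c l * e l x.

Lemma sq_integrable_lincomb c N : sq_integrable (lincomb c N).
Proof. by apply: sq_integrable_sum => i; exact: sq_integrableZ. Qed.

Lemma ip_lincombl c N f : sq_integrable f ->
  ip (lincomb c N) f = \sum_(0 <= l < N) c l * ip (e l) f.
Proof.
move=> Lf; rewrite /lincomb ip_suml//; last by move=> i; exact: sq_integrableZ.
by apply: eq_bigr => i _; rewrite ipZl.
Qed.

Lemma ip_lincomb_self c N :
  ip (lincomb c N) (lincomb c N) = \sum_(0 <= l < N) c l ^+ 2.
Proof.
rewrite ip_lincombl; last exact: sq_integrable_lincomb.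
rewrite !big_mkord; apply: eq_bigr => l _.
rewrite ipC ip_lincombl// big_mkord (bigD1 l)//= orth eqxx mulr1 big1.
  by rewrite addr0 expr2.
by move=> k kl; rewrite orth -(inj_eq val_inj)/= in kl *; rewrite (negbTE kl) mulr0.
Qed.

(** Pythagoras. With the coefficients of an estimator for [c], it splits the loss
    into the bias due to truncation and the errors on the coefficients; with
    arbitrary [c], it says that the coefficients [ip f (e l)] are the best ones. *)
Lemma ip_sub_lincomb f c N : sq_integrable f ->
  ip (fun x => f x - lincomb c N x) (fun x => f x - lincomb c N x) =
  ip f f - \sum_(0 <= l < N) ip f (e l) ^+ 2 +
  \sum_(0 <= l < N) (c l - ip f (e l)) ^+ 2.
Proof.
move=> Lf; rewrite ip_sqB//; last exact: sq_integrable_lincomb.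
have -> : ip f (lincomb c N) = \sum_(0 <= l < N) c l * ip f (e l).
  by rewrite ipC ip_lincombl//; apply: eq_bigr => l _; rewrite ipC.
rewrite ip_lincomb_self -!addrA; congr (_ + _).
rewrite mulr_sumr -!sumrN -!big_split/=; apply: eq_bigr => l _; ring.
Qed.

Lemma bessel f N : sq_integrable f -> \sum_(0 <= l < N) ip f (e l) ^+ 2 <= ip f f.
Proof.
move=> Lf.
have := ip_ge0 (fun x => f x - lincomb (fun l => ip f (e l)) N x).
rewrite ip_sub_lincomb// [X in _ + X]big1 ?addr0 ?subr_ge0// => i _.
by rewrite subrr expr0n.
Qed.

(** Closure is expressed by approximation in quadratic mean rather than by a
    topology: what is used of it is that [N] and [c] exist for each precision. *)
Definition in_closed_span f := sq_integrable f /\ forall r : R, 0 < r ->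
  exists N c, ip (fun x => f x - lincomb c N x) (fun x => f x - lincomb c N x) < r.

Lemma lincomb_widen c N N' : (N <= N')%N ->
  lincomb c N = lincomb (fun l => if (l < N)%N then c l else 0) N'.
Proof.
move=> NN; apply/funext => x; rewrite /lincomb [in RHS](@big_cat_nat _ _ _ N)//=.
rewrite [X in _ = _ + X]big_nat_cond [X in _ = _ + X]big1 ?addr0; last first.
  by move=> i /andP[/andP[Ni _] _]; rewrite ltnNge Ni mul0r.
by rewrite !big_mkord; apply: eq_bigr => i _; rewrite ltn_ord.
Qed.

Lemma closed_spanD f g : in_closed_span f -> in_closed_span g ->
  in_closed_span (fun x => f x + g x).
Proof.
move=> [Lf Hf] [Lg Hg]; split; first exact: sq_integrableD.
move=> r r0; have r40 : 0 < r / 4 by rewrite divr_gt0.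
have [N1 [c1 H1]] := Hf _ r40; have [N2 [c2 H2]] := Hg _ r40.
pose N := maxn N1 N2.
pose a l := if (l < N1)%N then c1 l else 0.
pose b l := if (l < N2)%N then c2 l else 0.
exists N, (fun l => a l + b l).
rewrite (lincomb_widen c1 (leq_maxl N1 N2)) -/N in H1.
rewrite (lincomb_widen c2 (leq_maxr N1 N2)) -/N in H2.
have -> : (fun x => f x + g x - lincomb (fun l => a l + b l) N x) =
  (fun x => (f x - lincomb a N x) + (g x - lincomb b N x)).
  apply/funext => x; rewrite addrACA -opprD; congr (_ - _).
  by rewrite /lincomb -big_split/=; apply: eq_bigr => i _; rewrite mulrDl.
apply: le_lt_trans (ip_sqD_le _ _) _; [by apply: sq_integrableB => //; exact: sq_integrable_lincomb..|].
by rewrite /a /b; lra.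
Qed.

Lemma closed_spanZ (k : R) f : in_closed_span f -> in_closed_span (fun x => k * f x).
Proof.
move=> [Lf Hf]; split; first exact: sq_integrableZ.
move=> r r0; have k0 : 0 < k ^+ 2 + 1 by rewrite ltr_wpDl ?sqr_ge0.
have [N [c H]] := Hf _ (divr_gt0 r0 k0).
exists N, (fun l => k * c l).
have -> : (fun x => k * f x - lincomb (fun l => k * c l) N x) =
  (fun x => k * (f x - lincomb c N x)).
  apply/funext => x; rewrite mulrBr; congr (_ - _).
  by rewrite /lincomb mulr_sumr; apply: eq_bigr => i _; rewrite mulrA.
have LB := sq_integrableB Lf (sq_integrable_lincomb c N).
rewrite ipZl//; last exact: sq_integrableZ.
rewrite ipC ipZl//; move: H; rewrite ltr_pdivlMr// => H.
have := ip_ge0 (fun x => f x - lincomb c N x); nra.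
Qed.

Lemma closed_span_sum (I : Type) (s : seq I) (F : I -> T -> R) :
  (forall i, in_closed_span (F i)) -> in_closed_span (fun x => \sum_(i <- s) F i x).
Proof.
move=> HF; elim: s => [|i s IH].
  under eq_fun do rewrite big_nil.
  split; first exact: sq_integrable0.
  move=> r r0; exists 0%N, (fun _ => 0); rewrite /lincomb.
  have -> : (fun x => 0 - \sum_(0 <= l < 0) 0 * e l x) = (fun _ => 0) :> (T -> R).
    by apply/funext => x; rewrite big_nil subr0.
  by rewrite ip0l.
by under eq_fun do rewrite big_cons; exact: closed_spanD.
Qed.

Lemma closed_span_closed f : sq_integrable f ->
  (forall r : R, 0 < r -> exists g, in_closed_span g /\
     ip (fun x => f x - g x) (fun x => f x - g x) < r) ->
  in_closed_span f.
Proof.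
move=> Lf H; split=> // r r0; have r40 : 0 < r / 4 by rewrite divr_gt0.
have [g [[Lg Hg] fg]] := H _ r40; have [N [c Hc]] := Hg _ r40.
exists N, c.
have -> : (fun x => f x - lincomb c N x) =
   (fun x => (f x - g x) + (g x - lincomb c N x)).
  by apply/funext => x; rewrite addrA subrK.
apply: le_lt_trans (ip_sqD_le _ _) _; [exact: sq_integrableB| |lra].
by apply: sq_integrableB => //; exact: sq_integrable_lincomb.
Qed.

(** Dominated convergence implies convergence in quadratic mean, as
    [(f - u n)^2 <= 4 h^2]. *)
Lemma closed_span_dominated f h (u : nat -> T -> R) : measurable_fun D f ->
  sq_integrable h ->
  (forall x, D x -> `|f x| <= h x) -> (forall n x, D x -> `|u n x| <= h x) ->
  {ae mu, forall x, D x -> u n x @[n --> \oo] --> f x} ->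
  (forall n, in_closed_span (u n)) -> in_closed_span f.
Proof.
move=> mf Lh fh uh uf Hu; have [mh h2] := Lh.
have Lf : sq_integrable f.
  split=> //; apply: (le_integrable mD _ _ h2).
    by apply/measurable_EFinP; exact: measurable_funX.
  move=> x Dx /=; rewrite lee_fin !normrX lerXn2r ?nnegrE//.
  by rewrite (le_trans (fh _ Dx))// ler_norm.
apply: closed_span_closed => // r r0.
pose F n x := ((f x - u n x) ^+ 2)%:E.
have mF n : measurable_fun D (F n).
  apply/measurable_EFinP; apply: measurable_funX; apply: measurable_funB => //.
  by case: (Hu n) => -[].
have i4 : mu.-integrable D (fun x => (4 * h x ^+ 2)%:E).
  by apply: eq_integrable (integrableZl mD 4 h2) => // x _; rewrite EFinM.
have A1 : {ae mu, forall x, D x -> F ^~ x @ \oo --> cst 0%E x}.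
  apply: filterS uf => x ufx Dx.
  have H : f x - u n x @[n --> \oo] --> (0 : R).
    by rewrite -[X in _ --> X](subrr (f x)); apply: cvgB; [exact: cvg_cst|exact: ufx].
  apply/cvg_EFin; first exact: nearW.
  have HM := cvgM H H; rewrite mulr0 in HM.
  under eq_fun do rewrite /F /= expr2.
  exact: HM.
have A2 : {ae mu, forall x n, D x -> (`|F n x| <= (4 * h x ^+ 2)%:E)%E}.
  apply: aeW => x n Dx /=; rewrite lee_fin ger0_norm ?sqr_ge0//.
  have := fh _ Dx; have := uh n _ Dx; rewrite !ler_norml => /andP[? ?] /andP[? ?]; nra.
have [_ _ cF] := dominated_convergence mD mF (measurable_cst 0%E) A1 i4 A2.
rewrite integral0 in cF.
have H0 : fine (\int[mu]_(x in D) F n x)%E @[n --> \oo] --> (0 : R) by exact: fine_cvg cF.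
have /cvgrPdist_lt/(_ r r0)[n _ Hn] := H0.
exists (u n); split; first exact: Hu.
have := Hn n (leqnn n); rewrite /= sub0r normrN; apply: le_lt_trans.
rewrite (le_trans _ (ler_norm _))// /ip /Rintegral.
Qed.

(** Half of Parseval's identity. Bessel's defect is the least squared distance
    from [f] to a combination of the first [N'] functions, hence it is at most the
    squared distance to any approximant, and it decreases with [N']. *)
Lemma parseval_defect f (r : R) : in_closed_span f -> 0 < r ->
  exists N, forall N', (N <= N')%N ->
    ip f f - \sum_(0 <= l < N') ip f (e l) ^+ 2 < r.
Proof.
move=> [Lf Hf] r0; have [N [c H]] := Hf _ r0; exists N => N' NN'.
rewrite (lincomb_widen c NN') ip_sub_lincomb// in H.
apply: le_lt_trans H; rewrite lerDl; apply: sumr_ge0 => i _; exact: sqr_ge0.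
Qed.

(** The other half: the partial sums of the expansion are the approximants. *)
Lemma closed_span_parseval f : sq_integrable f ->
  (forall r : R, 0 < r -> exists N, ip f f - \sum_(0 <= l < N) ip f (e l) ^+ 2 < r) ->
  in_closed_span f.
Proof.
move=> Lf H; split=> // r r0; have [N HN] := H _ r0.
exists N, (fun l => ip f (e l)); rewrite ip_sub_lincomb//.
rewrite [X in _ + X]big1 ?addr0// => i _; by rewrite subrr expr0n.
Qed.

End orthonormal.
End L2space.

(** * Moments of the exponential weight *)

Section gamma_integral.
Context {R : realType}.
Implicit Types (a t : R) (n : nat).

(** This is [a^-1] times the density of a sum of [n+1] independent exponential
    variables of rate [a]. With this normalisation the derivatives below telescope,
    so that a primitive is explicit and no integration by parts is needed. *)
Definition erlang a n t : R := expR (- a * t) * ((a * t) ^+ n / n`!%:R).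

Lemma is_derive_mull a t : is_derive t (1:R) (fun t => a * t) a.
Proof.
have H := @is_deriveZ _ _ _ id a t 1 1 (is_derive_id _ _).
by apply: is_derive_eq; rewrite /GRing.scale/= mulr1.
Qed.

Lemma is_derive_expNmul a t :
  is_derive t (1:R) (fun t => expR (- a * t)) (- a * expR (- a * t)).
Proof.
have H := @is_derive1_comp _ expR (fun t => - a * t) t _ _ (is_derive_expR _) (is_derive_mull _ _).
by apply: is_derive_eq; rewrite mulrC.
Qed.

Lemma is_derive_erlang0 a t :
  is_derive t (1:R) (erlang a 0) (- (a * erlang a 0 t)).
Proof.
rewrite [erlang a 0](_ : _ = fun t => expR (- a * t)).
  by apply: (is_derive_eq (is_derive_expNmul a t)); rewrite mulNr.
by apply/funext => x; rewrite /erlang expr0 fact0 divr1 mulr1.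
Qed.

Lemma is_derive_erlangS a n t :
  is_derive t (1:R) (erlang a n.+1) (a * erlang a n t - a * erlang a n.+1 t).
Proof.
have H1 := is_derive_expNmul a t.
have H2 := @is_deriveX _ _ (fun t => a * t) n.+1 t 1 _ (is_derive_mull a t).
have H3 := @is_deriveZ _ _ _ _ (n.+1`!%:R^-1) t 1 _ H2.
have := @is_deriveM _ _ _ _ t 1 _ _ H1 H3.
rewrite [_ * _](_ : _ = erlang a n.+1); last first.
  by rewrite exprfctE; apply/funext => x; rewrite /erlang [in RHS](mulrC ((a * x) ^+ _)).
have -> : ((n.+1)`!%:R^-1 \*: (fun t => a * t) ^+ n.+1) t = (n.+1)`!%:R^-1 * (a * t) ^+ n.+1.
  by rewrite exprfctE.
move=> H; apply: is_derive_eq; rewrite /erlang /GRing.scale/=.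
have n0 : n`!%:R != 0 :> R by rewrite pnatr_eq0 -lt0n fact_gt0.
have m0 : n.+1%:R != 0 :> R by rewrite pnatr_eq0.
rewrite factS natrM exprS; field; by rewrite n0 addrC natr1 m0.
Qed.

Lemma is_derive_erlang_sum a n t :
  is_derive t (1:R) (fun t => \sum_(k < n.+1) erlang a k t) (- (a * erlang a n t)).
Proof.
elim: n => [|n IH].
  have -> : (fun t => \sum_(k < 1) erlang a k t) = erlang a 0.
    by apply/funext => x; rewrite big_ord1.
  exact: is_derive_erlang0.
have -> : (fun t => \sum_(k < n.+2) erlang a k t) =
   (fun t => \sum_(k < n.+1) erlang a k t) + erlang a n.+1.
  by apply/funext => x; rewrite big_ord_recr.
have H := is_deriveD IH (is_derive_erlangS a n t).
by apply: is_derive_eq; ring.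
Qed.

Lemma erlang_cvgy a n : 0 < a -> erlang a n t @[t --> +oo] --> (0 : R).
Proof.
move=> a0; apply: (@squeeze_cvgr _ _ _ _ (fun=> 0) (fun t => (n.+1%:R / a) / t)).
- near=> t.
  have t0 : 0 < t by near: t; exact: nbhs_pinfty_gt.
  have at0 : 0 < a * t by exact: mulr_gt0.
  apply/andP; split.
    by rewrite /erlang mulr_ge0 ?expR_ge0// divr_ge0// exprn_ge0// ltW.
  rewrite /erlang.
  have := expR_ge1Dxn n (ltW at0); set x := a * t => H.
  have n0 : 0 < n`!%:R :> R by rewrite ltr0n fact_gt0.
  have m0 : 0 < n.+1%:R :> R by rewrite ltr0n.
  rewrite mulNr expRN [leLHS]mulrC ler_pdivrMr ?expR_gt0//.
  apply: le_trans (_ : n.+1%:R / x * (x ^+ n.+1 / n.+1`!%:R) <= _).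
    rewrite factS natrM exprS le_eqVlt; apply/orP; left; apply/eqP; field.
    by rewrite addrC natr1 !gt_eqF.
  rewrite -[n.+1%:R / a / t]mulrA -invfM ler_wpM2l ?divr_ge0 ?(ltW at0)//.
  by apply: le_trans H; rewrite lerDr.
- exact: cvg_cst.
- rewrite -[X in _ --> X](mulr0 (n.+1%:R / a)); apply: cvgM; first exact: cvg_cst.
  apply/gtr0_cvgV0; last exact: cvg_id.
  exact: nbhs_pinfty_gt.
Unshelve. all: by end_near. Qed.

Lemma continuous_erlang a n : continuous (erlang a n).
Proof.
move=> t; apply/differentiable_continuous/derivable1_diffP.
case: n => [|n]; [exact: (@ex_derive _ _ _ _ _ _ _ (is_derive_erlang0 a t))|].
exact: (@ex_derive _ _ _ _ _ _ _ (is_derive_erlangS a n t)).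
Qed.

Lemma integral_erlang a n : 0 < a ->
  (\int[lebesgue_measure]_(t in @Rplus R) (erlang a n t)%:E = (a^-1)%:E)%E.
Proof.
move=> a0.
pose F t := - a^-1 * \sum_(k < n.+1) erlang a k t.
have dF t : is_derive t (1:R) F (erlang a n t).
  have := @is_deriveZ _ _ _ _ (- a^-1) t 1 _ (is_derive_erlang_sum a n t).
  move=> H; apply: is_derive_eq; rewrite /GRing.scale/= mulNr mulrN opprK mulrA.
  by rewrite mulVf ?mul1r// gt_eqF.
rewrite /Rplus (@ge0_continuous_FTC2y _ _ F 0 0).
- rewrite /F big_ord_recl big1; last first.
    by move=> i _; rewrite /erlang !mulr0 expr0n/= mul0r mulr0.
  rewrite /erlang !mulr0 expR0 expr0 fact0 divr1 mulr1 addr0 mulr1.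
  by rewrite -EFinB sub0r opprK.
- by move=> x x0; rewrite /erlang mulr_ge0 ?expR_ge0// divr_ge0// exprn_ge0// mulr_ge0// ltW.
- by apply: continuous_subspaceT; exact: continuous_erlang.
- rewrite -[X in _ --> X](mulr0 (- a^-1)); apply: cvgM; first exact: cvg_cst.
  have : \sum_(k < n.+1) erlang a k t @[t --> +oo] --> \sum_(k < n.+1) (0:R).
    elim: n.+1 => [|m IH].
      by under eq_fun do rewrite big_ord0; rewrite big_ord0; exact: cvg_cst.
    under eq_fun do rewrite big_ord_recr.
    by rewrite big_ord_recr; apply: cvgD => //; exact: erlang_cvgy.
  by rewrite big1.
- by move=> x _; exact: (@ex_derive _ _ _ _ _ _ _ (dF x)).
- apply: cvg_at_right_filter; apply/differentiable_continuous/derivable1_diffP.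
  exact: (@ex_derive _ _ _ _ _ _ _ (dF 0)).
- by move=> x _; rewrite derive1E; exact: (@derive_val _ _ _ _ _ _ _ (dF x)).
Qed.

Definition monexp n a t : R := t ^+ n * expR (- a * t).

Lemma monexpE n a t : 0 < a -> monexp n a t = (n`!%:R / a ^+ n) * erlang a n t.
Proof.
move=> a0; rewrite /monexp /erlang exprMn.
have n0 : n`!%:R != 0 :> R by rewrite pnatr_eq0 -lt0n fact_gt0.
by field; rewrite n0 expf_neq0// gt_eqF.
Qed.

Lemma continuous_monexp n a : continuous (monexp n a).
Proof.
move=> t; apply: cvgM; first exact: exprn_continuous.
apply: (continuous_comp (f := fun t => - a * t) (g := expR)); last exact: continuous_expR.
exact: mulrl_continuous.
Qed.

Lemma integrable_monexp n a : 0 < a ->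
  (@lebesgue_measure R).-integrable Rplus (EFin \o monexp n a).
Proof.
move=> a0.
have ie : (@lebesgue_measure R).-integrable Rplus (EFin \o erlang a n).
  apply/integrableP; split.
    apply/measurable_EFinP/measurable_funTS.
    by apply: continuous_measurable_fun; exact: continuous_erlang.
  under eq_integral => t.
    rewrite inE /Rplus/= in_itv/= andbT => t0.
    rewrite ger0_norm; last first.
      by rewrite /erlang mulr_ge0 ?expR_ge0// divr_ge0// exprn_ge0// mulr_ge0// ltW.
    over.
  by rewrite integral_erlang// ltry.
have mP : @measurable _ (measurableTypeR R) Rplus by exact: measurable_itv.
have := integrableZl mP (n`!%:R / a ^+ n) ie; apply: eq_integrable => //= t _.
by rewrite /= monexpE.
Qed.

Lemma Rintegral_monexp n a : 0 < a ->
  \int[lebesgue_measure]_(t in Rplus) (monexp n a t) = n`!%:R / a ^+ n.+1 :> R.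
Proof.
move=> a0; rewrite /Rintegral.
have mP : measurable (@Rplus R) by exact: measurable_itv.
under eq_integral do rewrite monexpE// EFinM.
rewrite ge0_integralZl//=.
- by rewrite integral_erlang//= exprSr invfM mulrA.
- apply/measurable_EFinP/measurable_funTS.
  by apply: continuous_measurable_fun; exact: continuous_erlang.
- move=> t; rewrite /Rplus/= in_itv/= andbT => t0; rewrite lee_fin.
  by rewrite /erlang mulr_ge0 ?expR_ge0// divr_ge0// exprn_ge0// mulr_ge0// ltW.
- by rewrite lee_fin divr_ge0// exprn_ge0// ltW.
Qed.

End gamma_integral.

(** * Orthonormality of the Laguerre functions *)

Section binomial_sums.
Context {R : comNzRingType}.

(** Pascal's rule: it turns an [l+1]-st finite difference into an [l]-th one. *)
Lemma sum_binS (g : nat -> R) l :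
  \sum_(j < l.+2) 'C(l.+1, j)%:R * g j =
  \sum_(j < l.+1) 'C(l, j)%:R * (g j + g j.+1).
Proof.
under [RHS]eq_bigr do rewrite mulrDr.
rewrite big_split/= big_ord_recl/= bin0 mul1r.
under eq_bigr do rewrite /bump/= add1n binS natrD mulrDl.
rewrite big_split/= addrA; congr (_ + _).
rewrite big_ord_recr/= bin_small// mul0r addr0.
rewrite [RHS]big_ord_recl/= bin0 mul1r; congr (_ + _).
Qed.

(** Up to sign, the left-hand side is the [l]-th finite difference at [i] of the
    function [C(x, m)], and each difference lowers [m] by one. *)
Lemma alternating_bin_sum l i m :
  \sum_(j < l.+1) 'C(l, j)%:R * ((-1) ^+ j * 'C(i + j, m)%:R) =
  (-1) ^+ l * (if (l <= m)%N then 'C(i, m - l)%:R else 0) :> R.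
Proof.
elim: l i => [|l IH] i.
  by rewrite big_ord1/= bin0 expr0 !mul1r addn0 subn0.
rewrite (sum_binS (fun j => (-1) ^+ j * 'C(i + j, m)%:R)).
under eq_bigr => j _.
  rewrite mulrDr exprS addnS -addSn mulN1r mulNr mulrN.
  over.
rewrite big_split/= sumrN !IH -mulrBr.
case: (ltngtP l m) => [lm|lm|->].
- rewrite exprS -mulrA mulN1r -mulrN; congr (_ * _).
  by rewrite -(subnSK lm) binS natrD opprD addrA subrr sub0r.
- by rewrite subrr !mulr0.
- by rewrite subnn !bin0 subrr !mulr0.
Qed.

Lemma geometric_sum (x : R) n : (1 - x) * \sum_(0 <= l < n) x ^+ l = 1 - x ^+ n.
Proof.
elim: n => [|n IH]; first by rewrite big_nil mulr0 subrr.
by rewrite big_nat_recr//= mulrDr IH exprS; ring.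
Qed.

End binomial_sums.

Section laguerre.
Context {R : realType}.
Local Notation leb := (@lebesgue_measure R).
Local Notation rint f := (leb.-integrable Rplus (EFin \o f)).

Lemma measurable_Rplus : @measurable _ (measurableTypeR R) Rplus.
Proof. exact: measurable_itv. Qed.
Hint Resolve measurable_Rplus : core.

Lemma integral_lincomb_monexp (I : Type) (r : seq I) (c : I -> R) (p : I -> nat)
    (a : R) : 0 < a ->
  rint (fun t => \sum_(i <- r) c i * monexp (p i) a t) /\
  \int[leb]_(t in Rplus) (\sum_(i <- r) c i * monexp (p i) a t) =
  \sum_(i <- r) c i * ((p i)`!%:R / a ^+ (p i).+1).
Proof.
move=> a0; elim: r => [|i r [IH1 IH2]].
  split; first by apply: eq_integrable (integrable0 _ _) => // t _ /=; rewrite big_nil.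
  rewrite big_nil (@eq_Rintegral _ _ _ leb Rplus (fun=> 0)); last by move=> t _; rewrite big_nil.
  by rewrite Rintegral_cst// mul0r.
have ii := integrableZl measurable_Rplus (c i) (integrable_monexp (p i) a0).
split.
  apply: eq_integrable (integrableD measurable_Rplus ii IH1) => // t _ /=.
  by rewrite big_cons EFinD EFinM.
rewrite (@eq_Rintegral _ _ _ leb Rplus (fun t => c i * monexp (p i) a t +
    \sum_(j <- r) c j * monexp (p j) a t)); last by move=> t _; rewrite big_cons.
rewrite RintegralD// RintegralZl//; last exact: integrable_monexp.
by rewrite Rintegral_monexp// IH2 big_cons.
Qed.

Lemma laguerreE l t : laguerre l t =
  \sum_(j < l.+1) ((-1) ^+ j * 'C(l, j)%:R / j`!%:R) * monexp j (1 / 2) t :> R.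
Proof.
rewrite /laguerre big_mkord mulr_sumr; apply: eq_bigr => j _.
rewrite /monexp [- t / 2](_ : _ = - (1 / 2) * t); last by field.
by rewrite !mulrA; ring.
Qed.

Lemma monexpD i j (a b t : R) : monexp i a t * monexp j b t = monexp (i + j) (a + b) t.
Proof. by rewrite /monexp mulrACA -exprD -expRD -mulrDl opprD. Qed.

Lemma laguerre_exp l (c t : R) : expR (- c * t) * laguerre l t =
  \sum_(j < l.+1) ((-1) ^+ j * 'C(l, j)%:R / j`!%:R) * monexp j (c + 1 / 2) t.
Proof.
rewrite laguerreE mulr_sumr; apply: eq_bigr => j _.
rewrite mulrCA; congr (_ * _).
by rewrite -[expR _]mul1r -(expr0 t) -/(monexp 0 c t) monexpD.
Qed.

Lemma half2 : 1 / 2 + 1 / 2 = 1 :> R.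
Proof. by field. Qed.

Lemma laguerre_prod k l (t : R) : laguerre k t * laguerre l t =
  \sum_(ij : 'I_k.+1 * 'I_l.+1) (((-1) ^+ ij.1 * 'C(k, ij.1)%:R / ij.1`!%:R) *
    ((-1) ^+ ij.2 * 'C(l, ij.2)%:R / ij.2`!%:R)) * monexp (ij.1 + ij.2) 1 t.
Proof.
rewrite !laguerreE big_distrlr/= pair_big/=; apply: eq_bigr => -[i j] _ /=.
by rewrite mulrACA monexpD half2.
Qed.

Lemma sq_integrable_laguerre l : sq_integrable leb Rplus (@laguerre R l).
Proof.
split.
  apply: measurable_funTS.
  have -> : @laguerre R l = fun t => \sum_(j < l.+1)
      ((-1) ^+ j * 'C(l, j)%:R / j`!%:R) * monexp j (1 / 2) t.
    by apply/funext => t; rewrite laguerreE.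
  apply: measurable_sum => j; apply: measurable_funM => //.
  by apply: continuous_measurable_fun; exact: continuous_monexp.
have [+ _] := @integral_lincomb_monexp _ (index_enum ('I_l.+1 * 'I_l.+1)%type)
  (fun ij => ((-1) ^+ ij.1 * 'C(l, ij.1)%:R / ij.1`!%:R) *
    ((-1) ^+ ij.2 * 'C(l, ij.2)%:R / ij.2`!%:R)) (fun ij => ij.1 + ij.2)%N 1 ltr01.
apply: eq_integrable => // t _; rewrite /= expr2 laguerre_prod//.
Qed.

(** Take [k <= l] and expand both functions into monomials. For a fixed monomial
    of the first, of degree [i <= k], the sum over those of the second is an [l]-th
    finite difference of a polynomial of degree [i]: it vanishes unless [i = l]. *)
Lemma ip_laguerre k l : ip leb Rplus (laguerre k) (laguerre l) = (k == l)%:R :> R.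
Proof.
wlog kl : k l / (k <= l)%N.
  move=> H; have [/H//|/ltnW/H] := leqP k l.
  by rewrite ipC eq_sym.
rewrite /ip (@eq_Rintegral _ _ _ leb Rplus (fun t : R => \sum_(ij : 'I_k.+1 * 'I_l.+1)
    (((-1) ^+ ij.1 * 'C(k, ij.1)%:R / ij.1`!%:R) *
    ((-1) ^+ ij.2 * 'C(l, ij.2)%:R / ij.2`!%:R)) * monexp (ij.1 + ij.2) 1 t)); last first.
  by move=> t _; rewrite laguerre_prod.
have [_ ->] := @integral_lincomb_monexp _ (index_enum ('I_k.+1 * 'I_l.+1)%type)
  (fun ij => ((-1) ^+ ij.1 * 'C(k, ij.1)%:R / ij.1`!%:R) *
    ((-1) ^+ ij.2 * 'C(l, ij.2)%:R / ij.2`!%:R)) (fun ij => ij.1 + ij.2)%N 1 ltr01.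
rewrite -(pair_big xpredT xpredT (fun (i : 'I_k.+1) (j : 'I_l.+1) =>
    ((-1) ^+ i * 'C(k, i)%:R / i`!%:R) *
    ((-1) ^+ j * 'C(l, j)%:R / j`!%:R) * ((i + j)`!%:R / 1 ^+ (i + j).+1)))/=.
transitivity (\sum_(i < k.+1) ((-1) ^+ i * 'C(k, i)%:R) *
   ((-1) ^+ l * (if (l <= i)%N then 'C(i, i - l)%:R else 0)) : R).
  apply: eq_bigr => i _; rewrite -alternating_bin_sum mulr_sumr.
  apply: eq_bigr => j _.
  rewrite expr1n divr1.
  have -> : (i + j)`!%:R = 'C(i + j, i)%:R * (i`!%:R * j`!%:R) :> R.
    by rewrite -(bin_fact (leq_addr j i)) !natrM addKn.
  have i0 : i`!%:R != 0 :> R by rewrite pnatr_eq0 -lt0n fact_gt0.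
  have j0 : j`!%:R != 0 :> R by rewrite pnatr_eq0 -lt0n fact_gt0.
  by field; rewrite i0 j0.
rewrite big_ord_recr/= big1 ?add0r; last first.
  move=> i _; rewrite ifF ?mulr0//; apply/negbTE; rewrite -ltnNge.
  exact: leq_trans (ltn_ord i) kl.
have [->|kneql] := eqVneq k l.
  by rewrite binn leqnn subnn bin0 !mulr1 -exprMn mulrNN mulr1 expr1n.
by rewrite ifF ?mulr0//; apply/negbTE; rewrite -ltnNge ltn_neqAle kneql.
Qed.

(** Integrated against the exponential, the monomials of the Laguerre polynomial
    become the terms of a binomial expansion. *)
Lemma ip_exp_laguerre l (c : R) : 0 < c ->
  ip leb Rplus (fun t => expR (- c * t)) (laguerre l) =
  (c + 1 / 2)^-1 * (1 - (c + 1 / 2)^-1) ^+ l.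
Proof.
move=> c0; have b0 : 0 < c + 1 / 2 by rewrite addr_gt0// divr_gt0.
rewrite /ip (@eq_Rintegral _ _ _ leb Rplus (fun t => \sum_(j < l.+1)
  ((-1) ^+ j * 'C(l, j)%:R / j`!%:R) * monexp j (c + 1 / 2) t)); last first.
  by move=> t _; rewrite laguerre_exp.
have [_ ->] := @integral_lincomb_monexp _ (index_enum 'I_l.+1)
  (fun j => (-1) ^+ j * 'C(l, j)%:R / j`!%:R) (fun j => j) _ b0.
rewrite exprDn mulr_sumr; apply: eq_bigr => j _.
have j0 : j`!%:R != 0 :> R by rewrite pnatr_eq0 -lt0n fact_gt0.
have bj0 : (c + 1 / 2) ^+ j != 0 by rewrite expf_neq0 ?gt_eqF.
have b1 : c + 1 / 2 != 0 by rewrite gt_eqF.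
move: bj0 b1; set b := c + 1 / 2 => bj0 b1.
rewrite expr1n mul1r (exprNn b^-1) exprVn exprS -mulr_natl; field.
by rewrite j0 bj0 b1.
Qed.

Lemma sq_integrable_exp (c : R) : 0 < c ->
  sq_integrable leb Rplus (fun t => expR (- c * t)).
Proof.
move=> c0.
have E t : expR (- c * t) = monexp 0 c t by rewrite /monexp expr0 mul1r.
split.
  apply: measurable_funTS; under eq_fun do rewrite E.
  by apply: continuous_measurable_fun; exact: continuous_monexp.
have := integrable_monexp 0 (addr_gt0 c0 c0).
by apply: eq_integrable => // t _; rewrite /= !E expr2 monexpD.
Qed.

Lemma ip_exp_self (c : R) : 0 < c ->
  ip leb Rplus (fun t => expR (- c * t)) (fun t => expR (- c * t)) = (2 * c)^-1.
Proof.
move=> c0; have E t : expR (- c * t) = monexp 0 c t by rewrite /monexp expr0 mul1r.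
rewrite /ip (@eq_Rintegral _ _ _ leb Rplus (monexp 0 (c + c))); last first.
  by move=> t _; rewrite !E monexpD.
by rewrite Rintegral_monexp ?addr_gt0// fact0 expr1 mul1r mulr2n mulrDl mul1r.
Qed.

Local Notation span := (in_closed_span leb Rplus (@laguerre R)).

(** The coefficients of an exponential form a geometric sequence, so that
    Parseval's identity is an explicit geometric series. *)
Lemma span_exp (c : R) : 0 < c -> span (fun t => expR (- c * t)).
Proof.
move=> c0; apply: closed_span_parseval => //.
- exact: sq_integrable_laguerre.
- exact: ip_laguerre.
- exact: sq_integrable_exp.
move=> r r0; have b0 : 0 < c + 1 / 2 by rewrite addr_gt0// divr_gt0.
pose q := 1 - (c + 1 / 2)^-1.
have q1 : `|q ^+ 2| < 1.
  rewrite normrX expr_lt1// ltr_norml; apply/andP; split.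
    rewrite ltrBrDr -ltrBrDl opprK (_ : 1 + 1 = 2)//.
    by rewrite invf_plt ?posrE//; lra.
  by rewrite ltrBlDr ltrDl invr_gt0.
have rc : 0 < r * (2 * c) by rewrite !mulr_gt0.
have := cvg_expr q1 => /cvgrPdist_lt /(_ _ rc) [N _ HN].
exists N; rewrite ip_exp_self//.
have -> : \sum_(0 <= l < N) ip leb Rplus (fun t => expR (- c * t)) (laguerre l) ^+ 2 =
    (2 * c)^-1 * (1 - (q ^+ 2) ^+ N).
  under eq_bigr => l _ do rewrite ip_exp_laguerre// -/q exprMn exprAC.
  rewrite -mulr_sumr.
  have q2 : 1 - q ^+ 2 = (2 * c) / (c + 1 / 2) ^+ 2.
    by rewrite /q; field; rewrite -?natrD; lra.
  have q20 : 1 - q ^+ 2 != 0 by rewrite q2 gt_eqF// divr_gt0 ?exprn_gt0//; lra.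
  apply: (mulIf q20); rewrite mulrAC -mulrA [_ * (1 - q ^+ 2)]mulrC geometric_sum q2.
  by field; rewrite -?natrD; lra.
have := HN N (leqnn N); rewrite sub0r normrN ger0_norm; last by rewrite exprn_ge0// sqr_ge0.
move=> H; rewrite -[X in X - _]mulr1 -mulrBr opprB addrC subrK mulrC.
by rewrite ltr_pdivrMr//; lra.
Qed.

End laguerre.

(** * Completeness of the Laguerre functions *)

Section laguerre_complete.
Context {R : realType}.
Local Notation leb := (@lebesgue_measure R).
Local Notation span := (in_closed_span leb Rplus (@laguerre R)).
Local Notation mR := (measurableTypeR R).
Local Notation mP := (@measurable_Rplus R).

Lemma bernoulli_ineq (y : R) n : 0 <= y <= 1 -> 1 - n%:R * y <= (1 - y) ^+ n.
Proof.
move=> /andP[y0 y1]; elim: n => [|n IH]; first by rewrite mul0r subr0.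
rewrite exprS -natr1; have n0 : 0 <= n%:R * y * y by rewrite !mulr_ge0.
have := ler_wpM2l (_ : 0 <= 1 - y) IH; rewrite subr_ge0 => /(_ y1); lra.
Qed.

Lemma bernoulli_inv (y : R) n : 0 <= y <= 1 -> (1 - y) ^+ n * (1 + n%:R * y) <= 1.
Proof.
move=> /andP[y0 y1]; elim: n => [|n IH]; first by rewrite mul0r addr0 mulr1.
have p0 : 0 <= (1 - y) ^+ n by rewrite exprn_ge0 ?subr_ge0.
apply: le_trans IH; rewrite exprS -natr1 mulrAC mulrC ler_wpM2l//.
have n0 : 0 <= n%:R * y * y by rewrite !mulr_ge0.
have : 0 <= y * y by rewrite mulr_ge0.
lra.
Qed.

(** [(1 - x^n)^(2^n)] tends to the indicator of [x < 1/2] on the unit interval,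
    by Bernoulli's inequality: [2^n] copies of the event of probability [x^n] are
    negligible if [2 x < 1], and one of them almost surely occurs if [2 x > 1].
    These are polynomials, which is what makes step functions of an exponential
    accessible. *)
Lemma cvg_step_lt (x : R) : 0 <= x < 1 / 2 ->
  (1 - x ^+ n) ^+ (2 ^ n) @[n --> \oo] --> (1 : R).
Proof.
move=> /andP[x0 x1].
have xn n : 0 <= x ^+ n <= 1.
  by rewrite exprn_ge0//= exprn_ile1//; lra.
apply: (@squeeze_cvgr _ _ _ _ (fun n => 1 - (2 * x) ^+ n) (fun=> 1)).
- apply: nearW => n; apply/andP; split.
    by have := bernoulli_ineq (2 ^ n) (xn n); rewrite natrX -exprMn.
  by have /andP[? ?] := xn n; rewrite exprn_ile1//; lra.
- rewrite -[X in _ --> X]subr0; apply: cvgB; first exact: cvg_cst.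
  by apply: cvg_expr; rewrite ger0_norm; lra.
- exact: cvg_cst.
Qed.

Lemma cvg_step_gt (x : R) : 1 / 2 < x <= 1 ->
  (1 - x ^+ n) ^+ (2 ^ n) @[n --> \oo] --> (0 : R).
Proof.
move=> /andP[x0 x1].
have xn n : 0 <= x ^+ n <= 1.
  by rewrite exprn_ge0/= ?exprn_ile1//; lra.
apply: (@squeeze_cvgr _ _ _ _ (fun=> 0) (fun n => ((2 * x)^-1) ^+ n)).
- apply: nearW => n; have /andP[? ?] := xn n; apply/andP; split.
    by rewrite exprn_ge0//; lra.
  have := bernoulli_inv (2 ^ n) (xn n); rewrite natrX -exprMn.
  have : 0 <= (1 - x ^+ n) ^+ (2 ^ n) by rewrite exprn_ge0//; lra.
  have p0 : 0 < (2 * x) ^+ n by rewrite exprn_gt0//; lra.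
  by move=> y0 yle; rewrite exprVn -[leRHS]mul1r ler_pdivlMr//; lra.
- exact: cvg_cst.
- apply: cvg_expr; rewrite ger0_norm ?invr_ge0; last by lra.
  by rewrite invf_lt1; lra.
Qed.

Lemma spanD (f g : R -> R) : span f -> span g -> span (fun t => f t + g t).
Proof. by apply: closed_spanD => //; [exact: mP|exact: sq_integrable_laguerre]. Qed.

Lemma spanZ k (f : R -> R) : span f -> span (fun t => k * f t).
Proof. by apply: closed_spanZ => //; [exact: mP|exact: sq_integrable_laguerre]. Qed.

Lemma span_sum (I : Type) (s : seq I) (F : I -> R -> R) :
  (forall i, span (F i)) -> span (fun x => \sum_(i <- s) F i x).
Proof. by apply: closed_span_sum => //; [exact: mP|exact: sq_integrable_laguerre]. Qed.

Lemma span_dominated (f h : R -> R) (u : nat -> R -> R) : measurable_fun Rplus f ->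
  sq_integrable leb Rplus h ->
  (forall x, 0 <= x -> `|f x| <= h x) -> (forall n x, 0 <= x -> `|u n x| <= h x) ->
  {ae leb, forall x, 0 <= x -> u n x @[n --> \oo] --> f x} ->
  (forall n, span (u n)) -> span f.
Proof.
have P0 x : @Rplus R x <-> 0 <= x by rewrite /Rplus/= in_itv/= andbT.
move=> mf Lh fh uh uf; apply: (@closed_span_dominated _ mR R leb Rplus _ (@laguerre R) _ f h) => //.
- exact: mP.
- exact: sq_integrable_laguerre.
- by move=> x /P0; exact: fh.
- by move=> n x /P0; exact: uh.
- by move: uf; apply: (filterS (F := almost_everywhere leb)) => x H /P0.
Qed.

Lemma ae_neq (a : R) : {ae leb, forall x, x != a}.
Proof.
exists [set a]; split; [exact: measurable_set1|exact: lebesgue_measure_set1|].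
by move=> x /= /negP; rewrite negbK => /eqP.
Qed.

(** The weight makes the indicator of every measurable set square integrable,
    including unbounded ones, and dominates all of them. *)
Definition wt (A : set R) (t : R) : R := expR (- 1 * t) * \1_A t.

Lemma measurable_wt (A : set mR) : measurable A -> measurable_fun Rplus (wt A).
Proof.
move=> mA; apply: measurable_funM; last exact: measurable_indic.
by have [] := @sq_integrable_exp R 1 ltr01.
Qed.

Lemma le_wt A (t : R) : `|wt A t| <= expR (- 1 * t).
Proof.
rewrite /wt normrM ger0_norm ?expR_ge0// ler_piMr ?expR_ge0// indicE.
by case: (t \in A); rewrite ?normr1 ?normr0.
Qed.

(** With [c a = ln 2], the ray [t > a] is the event that [exp (- c t) < 1/2]. The
    polynomials in [exp (- c t)] tending to its indicator are, once multiplied by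
    [exp (- t)], combinations of exponentials. *)
Lemma span_wt_ray (a : R) : span (wt `]a, +oo[%classic).
Proof.
have [a0|a0] := ltP 0 a; last first.
  apply: (span_dominated (h := fun t => expR (- 1 * t)) (u := fun _ t => expR (- 1 * t))).
  - by apply: measurable_wt; exact: measurable_itv.
  - exact: sq_integrable_exp.
  - by move=> x _; exact: le_wt.
  - by move=> _ x _; rewrite ger0_norm ?expR_ge0.
  - move: (ae_neq 0); apply: (filterS (F := nbhs (almost_everywhere leb))) => x xn0 x0; rewrite /wt indicE mem_set/=; last first.
      by rewrite in_itv/= andbT (le_lt_trans a0)// lt_def xn0.
    by rewrite mulr1; exact: cvg_cst.
  - by move=> n; exact: span_exp.
pose c := ln 2 / a.
have c0 : 0 < c by rewrite divr_gt0// ln_gt0// ltr1n.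
have ca : expR (- c * a) = 1 / 2.
  by rewrite /c mulNr divfK ?gt_eqF// expRN lnK ?posrE// div1r.
pose u n (t : R) := expR (- 1 * t) * (1 - expR (- c * t) ^+ n) ^+ (2 ^ n).
have x01 (t : R) n : 0 <= t -> 0 <= expR (- c * t) ^+ n <= 1.
  move=> t0; rewrite exprn_ge0 ?expR_ge0//= exprn_ile1 ?expR_ge0//.
  by rewrite expR_le1 mulNr oppr_le0 mulr_ge0// ltW.
apply: (span_dominated (h := fun t => expR (- 1 * t)) (u := u)).
- by apply: measurable_wt; exact: measurable_itv.
- exact: sq_integrable_exp.
- by move=> x _; exact: le_wt.
- move=> n x x0; rewrite /u normrM ger0_norm ?expR_ge0// ler_piMr ?expR_ge0//.
  have /andP[? ?] := x01 x n x0.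
  rewrite normrX exprn_ile1//; rewrite ger0_norm; lra.
- move: (ae_neq a); apply: (filterS (F := almost_everywhere leb)) => x xa x0.
  rewrite /u /wt; apply: cvgM; first exact: cvg_cst.
  have [ax|ax] := ltP a x.
    rewrite indicE mem_set/=; last by rewrite in_itv/= andbT.
    apply: cvg_step_lt; rewrite expR_ge0/= -ca ltr_expR !mulNr ltrN2.
    by rewrite ltr_pM2l.
  rewrite indicE memNset/=; last by rewrite in_itv/= andbT ltNge ax.
  apply: cvg_step_gt; rewrite -ca ltr_expR !mulNr ltrN2 ltr_pM2l//.
  rewrite lt_def eq_sym xa ax/= expR_le1 oppr_le0 mulr_ge0//; exact: ltW.
- move=> n.
  have -> : u n = fun t => \sum_(i < (2 ^ n).+1)
      ((-1) ^+ i * 'C(2 ^ n, i)%:R) * expR (- (1 + c * n%:R * i%:R) * t).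
    apply/funext => t; rewrite /u exprDn mulr_sumr; apply: eq_bigr => i _.
    have E : expR (- (1 + c * n%:R * i%:R) * t) = (expR (- c * t) ^+ n) ^+ i * expR (- 1 * t).
      by rewrite -exprM -expRM_natl -expRD natrM; congr expR; ring.
    by rewrite E expr1n mul1r (exprNn (expR (- c * t) ^+ n)) -mulr_natl; ring.
  apply: span_sum => i; apply: spanZ; apply: span_exp.
  have ? : 0 <= c * n%:R * i%:R by do 2!apply: mulr_ge0 => //; exact: ltW.
  lra.
Qed.

(** The rays generate the Borel sets and are stable by intersection, and the sets
    with this property are a Dynkin system. *)
Lemma span_wt (A : set mR) : measurable A -> span (wt A).
Proof.
move=> mA; have := mA.
have E : @measurable _ mR = <<s @RGenOInfty.G R >> by exact: RGenOInfty.measurableE.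
rewrite E; move: A {mA}; apply: (dynkin_induction E).
- move=> A B [a ->] [b ->]; exists (Num.max a b).
  by apply/seteqP; split=> x /=; rewrite !in_itv/= !andbT gt_max; [move=> [-> ->]|move=> /andP].
- have -> : wt setT = fun t => expR (- 1 * t).
    by apply/funext => t; rewrite /wt indicT mulr1.
  exact: span_exp.
- by move=> _ [a ->]; exact: span_wt_ray.
- move=> A mA PA.
  have -> : wt (~` A) = fun t => expR (- 1 * t) + - 1 * wt A t.
    apply/funext => t; rewrite /wt indicE in_setC indicE.
    by case: (t \in A) => /=; ring.
  by apply: spanD; [exact: span_exp|exact: spanZ].
- move=> F mF tF PF.
  have PU n : span (wt (\big[setU/set0]_(k < n) F k)).
    elim: n => [|n IH].
      have -> : wt (\big[setU/set0]_(k < 0) F k) = fun t => 0 * expR (- 1 * t).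
        by apply/funext => t; rewrite big_ord0 /wt indic0 mulr0 mul0r.
      by apply: spanZ; exact: span_exp.
    have -> : wt (\big[setU/set0]_(k < n.+1) F k) =
        fun t => wt (\big[setU/set0]_(k < n) F k) t + wt (F n) t.
      apply/funext => t; rewrite big_ord_recr/= /wt -mulrDr; congr (_ * _).
      rewrite !indicE in_setU; have [tn|tn] := boolP (t \in F n); last by rewrite orbF addr0.
      rewrite orbT; have [tk|_] := boolP (t \in \big[setU/set0]_(k < n) F k); last by rewrite add0r.
      exfalso; move: tk tn; rewrite !inE -bigcup_mkord => -[k /= kn Fk] Fn.
      have := tF k n Logic.I Logic.I; have /[swap] /[apply] : F k `&` F n !=set0 by exists t.
      by move=> kE; rewrite kE ltnn in kn.
    exact: spanD.
  apply: (span_dominated (h := fun t => expR (- 1 * t))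
     (u := fun n => wt (\big[setU/set0]_(k < n) F k))) => //.
  + by apply: measurable_wt; exact: bigcup_measurable.
  + exact: sq_integrable_exp.
  + by move=> x _; exact: le_wt.
  + by move=> n x _; exact: le_wt.
  + apply: aeW => x _; rewrite /wt; apply: cvgM; first exact: cvg_cst.
    have [[k _ Fk]|nF] := pselect ((\bigcup_k F k) x).
      rewrite [in X in _ --> X]indicE mem_set; last by exists k.
      apply: cvg_near_cst; near=> n; rewrite indicE mem_set// -bigcup_mkord.
      by exists k => //=; near: n; exact: nbhs_infty_gt.
    rewrite [in X in _ --> X]indicE memNset//.
    apply: cvg_near_cst; apply: nearW => n; rewrite indicE memNset// -bigcup_mkord.
    by move=> [k _ Fk]; apply: nF; exists k.
Unshelve. all: by end_near. Qed.

Import HBNNSimple.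

Lemma span_nnsfun (s : {nnsfun mR >-> R}) : span (fun t => expR (- 1 * t) * s t).
Proof.
have -> : (fun t => expR (- 1 * t) * s t) =
   fun t => \sum_(y <- finmap.enum_fset (fset_set (range s))) y * wt (s @^-1` [set y]) t.
  apply/funext => t; rewrite (fimfunE s) fsbig_finite//= mulr_sumr.
  by apply: eq_bigr => y _; rewrite /wt mulrCA.
by apply: span_sum => y; apply: spanZ; apply: span_wt; exact: measurable_funPTI.
Qed.

(** [f exp t] is an increasing limit of simple functions [s], and [s exp (- t)] is
    dominated by [f]. *)
Lemma span_ge0 (f : R -> R) : sq_integrable leb Rplus f ->
  (forall t, 0 <= t -> 0 <= f t) -> span f.
Proof.
move=> Lf f0; have [mf _] := Lf.
have P0 x : @Rplus R x <-> 0 <= x by rewrite /Rplus/= in_itv/= andbT.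
pose F (t : mR) := (f t * expR t)%:E.
have mF : measurable_fun (Rplus : set mR) F.
  apply/measurable_EFinP; apply: measurable_funM => //.
  by apply: measurable_funTS; exact: measurable_expR.
have F0 x : @Rplus R x -> (0 <= F x)%E.
  by move=> /P0 x0; rewrite lee_fin mulr_ge0 ?expR_ge0// f0.
pose s := nnsfun_approx mP mF.
have sF n t : 0 <= t -> s n t <= f t * expR t.
  move=> t0; rewrite -lee_fin nnsfun_approxE; apply: le_approx => //; exact/P0.
have expK t : expR (- 1 * t) * (f t * expR t) = f t.
  by rewrite mulrCA -expRD mulN1r addNr expR0 mulr1.
apply: (span_dominated (h := f) (u := fun n t => expR (- 1 * t) * s n t)) => //.
- by move=> x x0; rewrite ger0_norm// f0.
- move=> n x x0; rewrite ger0_norm ?mulr_ge0 ?expR_ge0//.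
  by rewrite -[leRHS]expK ler_wpM2l ?expR_ge0// sF.
- apply: aeW => x x0; rewrite -[X in _ --> X]expK.
  apply: cvgM; first exact: cvg_cst.
  have := @cvg_nnsfun_approx _ _ _ _ mP _ mF F0 x (proj2 (P0 x) x0).
  by move/fine_cvg.
- by move=> n; exact: span_nnsfun.
Qed.

(** From nonnegative functions to all by the positive and negative parts. *)
Lemma laguerre_complete (f : R -> R) : sq_integrable leb Rplus f -> span f.
Proof.
move=> Lf; have [mf f2] := Lf.
have part (g : R -> R) : measurable_fun Rplus g -> (forall t, `|g t| <= `|f t|) ->
    sq_integrable leb Rplus g.
  move=> mg gf; split=> //; apply: (le_integrable mP _ _ f2).
    by apply/measurable_EFinP; exact: measurable_funX.
  by move=> x _ /=; rewrite lee_fin !normrX lerXn2r ?nnegrE.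
have -> : f = fun t => Num.max (f t) 0 + -1 * Num.max (- f t) 0.
  by apply/funext => t; rewrite /Num.max; case: ifPn; case: ifPn; lra.
apply: spanD; last apply: spanZ; apply: span_ge0.
- apply: part; first exact: measurable_maxr.
  by move=> t; rewrite /Num.max; case: ifPn; rewrite ?normr0.
- by move=> t _; rewrite le_max lexx orbT.
- apply: part; first by apply: measurable_maxr => //; exact: measurableT_comp.
  by move=> t; rewrite /Num.max; case: ifPn; rewrite ?normr0 ?normrN.
- by move=> t _; rewrite le_max lexx orbT.
Qed.

End laguerre_complete.

(** * Laguerre-Sobolev balls *)

Section sobolev_functions.
Context {R : realType}.
Local Notation leb := (@lebesgue_measure R).
Local Notation mP := (@measurable_Rplus R).
Implicit Types (f : R -> R) (s M : R).

Lemma Lnorm2_int f : normL2 f =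
  ((\int[leb]_(x in Rplus) (f x ^+ 2)%:E) `^ 2^-1)%E.
Proof.
rewrite /normL2 unlock; congr (_ `^ _)%E; rewrite [RHS]integral_mkcond.
apply: eq_integral => x _ /=.
rewrite powR_mulrn// real_normK ?num_real// restrict_EFin/=.
by rewrite /patch; case: ifPn => // _; rewrite expr0n.
Qed.

Lemma inL2_sq_integrable f : inL2 f -> sq_integrable leb Rplus f.
Proof.
move=> [mf]; rewrite Lnorm2_int => /lty_poweRy foo; split=> //.
apply/integrableP; split.
  by apply/measurable_EFinP; exact: measurable_funX.
under eq_integral do rewrite /= ger0_norm ?sqr_ge0//.
by apply: foo; rewrite invr_eq0 pnatr_eq0.
Qed.

Lemma normL2_sq_integrable f : sq_integrable leb Rplus f ->
  normL2 f = (Num.sqrt (ip leb Rplus f f))%:E.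
Proof.
move=> [mf f2]; rewrite Lnorm2_int /ip /Rintegral.
under [in RHS]eq_integral do rewrite -expr2.
rewrite -(fineK (integrable_fin_num mP f2)).
rewrite poweR_EFin powR12_sqrt// fine_ge0// integral_ge0// => x _.
by rewrite lee_fin sqr_ge0.
Qed.

(** By Parseval's identity this is the sum of the squares of the coefficients from
    the [N]-th on, the squared bias of an estimator which stops at level [N]. *)
Definition tail_sq f N : R :=
  ip leb Rplus f f - \sum_(0 <= l < N) lcoef f l ^+ 2.

Lemma tail_sq_ge0 f N : inL2 f -> 0 <= tail_sq f N.
Proof.
move=> /inL2_sq_integrable Lf; rewrite subr_ge0.
by apply: bessel => //; [exact: mP|exact: sq_integrable_laguerre|exact: ip_laguerre].
Qed.

Lemma normL2_lincomb_sub f (z : nat -> R) N : inL2 f ->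
  normL2 (fun x => \sum_(0 <= l < N) z l * laguerre l x - f x) =
  (Num.sqrt (tail_sq f N + \sum_(0 <= l < N) (z l - lcoef f l) ^+ 2))%:E.
Proof.
move=> /inL2_sq_integrable Lf.
have Ll := sq_integrable_lincomb mP (@sq_integrable_laguerre R) z N.
rewrite normL2_sq_integrable; last by apply: sq_integrableB => //; exact: mP.
rewrite -(ip_sub_lincomb mP (@sq_integrable_laguerre R) (@ip_laguerre R) z N Lf).
congr ((Num.sqrt _)%:E); apply: eq_Rintegral => x _.
by rewrite /lincomb -mulrNN !opprB.
Qed.

(** This is where the completeness of the Laguerre functions enters: without it
    part of [f] could be invisible to all the coefficients. *)
Lemma tail_sq_le f N (B : R) : inL2 f ->
  (forall N', (N <= N')%N -> \sum_(N <= l < N') lcoef f l ^+ 2 <= B) ->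
  tail_sq f N <= B.
Proof.
move=> /inL2_sq_integrable Lf H; apply/ler_addgt0Pr => e e0.
have [N0 HN] := parseval_defect mP (@sq_integrable_laguerre R) (@ip_laguerre R)
  (laguerre_complete Lf) e0.
have := HN _ (leq_maxr N N0); rewrite (@big_cat_nat _ _ _ N)//=; last exact: leq_maxl.
have := H _ (leq_maxl N N0); rewrite /tail_sq /lcoef /ip; lra.
Qed.

Lemma sobolev_sum_le s M f : 0 <= M -> sobolev_ball s M f ->
  forall N, \sum_(0 <= l < N) ((l%:R + 1 / 2) `^ s * lcoef f l) ^+ 2 <= M ^+ 2.
Proof.
move=> M0 [[_ _] +] N; rewrite /sobolev_norm.
under eq_eseriesr do rewrite real_normK ?num_real//.
set S := (X in (X `^ _)%E) => SM.
have S0 : (0 <= S)%E by apply: nneseries_ge0 => l _ _; rewrite lee_fin sqr_ge0.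
rewrite -lee_fin -sumEFin.
apply: le_trans (_ : S <= _)%E.
  by apply: nneseries_lim_ge => l _ _; rewrite lee_fin sqr_ge0.
rewrite -[S]poweRe1// -[1%R](@mulVf R 2)// -[2^-1]div1r poweRrM.
rewrite [leRHS](_ : _ = (M%:E `^ 2)%E); last by rewrite poweR_EFin powR_mulrn.
apply: gt0_ler_poweR => //; rewrite ?in_itv/= ?andbT ?poweR_ge0 ?leey ?lee_fin ?M0 ?andbT//.
Qed.

(** Comparison with the integral of [x^(- (1 + b))] over [y - 1, y], in the form of
    Bernoulli's inequality for [(1 - 1/y)^(- b)]. *)
Lemma powR_diff_ge (y b : R) : 1 < y -> 0 < b ->
  b * y `^ (- (1 + b)) <= (y - 1) `^ (- b) - y `^ (- b).
Proof.
move=> y1 b0; have y0 : 0 < y by lra.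
have h0 : 0 < 1 - y^-1 by rewrite subr_gt0 invf_lt1.
have -> : y - 1 = y * (1 - y^-1) by rewrite mulrBr mulr1 divff// gt_eqF.
rewrite powRM ?(ltW y0) ?(ltW h0)// opprD powRD; last by apply/implyP => _; rewrite gt_eqF.
rewrite powR_inv1 ?(ltW y0)//; have p0 := powR_ge0 y (- b).
have H : 1 + b * y^-1 <= (1 - y^-1) `^ (- b).
  rewrite /powR gt_eqF//; apply: le_trans (expR_ge1Dx _).
  rewrite lerD2l mulNr -mulrN ler_wpM2l ?(ltW b0)// lerNr.
  by apply: le_ln1Dx; rewrite ltrN2 invf_lt1.
have := ler_wpM2l p0 H; lra.
Qed.

(** Convergence of [\sum_l (l + 1/2)^(-a)] for [a > 1], by telescoping. *)
Lemma powR_sum_bounded (a : R) : 1 < a ->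
  exists2 Z : R, 0 <= Z & forall N, \sum_(0 <= l < N) (l%:R + 1 / 2) `^ (- a) <= Z.
Proof.
move=> a1; pose b := a - 1; have b0 : 0 < b by rewrite subr_gt0.
exists ((1 / 2) `^ (- a) + b^-1 * (1 / 2) `^ (- b)).
  by rewrite addr_ge0 ?powR_ge0// mulr_ge0 ?powR_ge0// invr_ge0 ltW.
move=> [|N]; first by rewrite big_nil addr_ge0 ?powR_ge0// mulr_ge0 ?powR_ge0// invr_ge0 ltW.
apply: le_trans (_ : _ <= (1 / 2) `^ (- a) +
   b^-1 * ((1 / 2) `^ (- b) - (N%:R + 1 / 2) `^ (- b))) _.
  elim: N => [|N IH]; first by rewrite big_nat1 add0r subrr mulr0 addr0.
  rewrite big_nat_recr//=; apply: le_trans (lerD IH (lexx _)) _.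
  set u := N%:R + 1 / 2.
  have uS : N.+1%:R + 1 / 2 = u + 1 by rewrite /u -natr1; lra.
  have u0 : 0 < u by rewrite /u ltr_wpDl// divr_gt0.
  have u1 : 1 < u + 1 by lra.
  have := powR_diff_ge u1 b0; rewrite addrK uS (_ : 1 + b = a); last by rewrite /b; lra.
  move=> H; rewrite -addrA lerD2l -(ler_pM2l b0) mulrDr !mulrA divff ?gt_eqF// !mul1r; lra.
by rewrite lerD2l ler_wpM2l ?invr_ge0 ?(ltW b0)// gerBl powR_ge0.
Qed.

Lemma sq_powR (x s : R) : 0 <= x -> (x `^ s) ^+ 2 = x `^ (2 * s).
Proof. by move=> x0; rewrite mulrC powRrM powR_mulrn// powR_ge0. Qed.

(** Sobolev regularity above 1/2 makes the coefficients absolutely summable: with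
    [w = (l + 1/2)^s], [|f_l|] is at most [(w f_l)^2 + w^(- 2)], and both are
    summable. *)
Lemma sobolev_abs_sum s : 1 / 2 < s -> exists2 Z : R, 0 <= Z &
  forall M f, 0 <= M -> sobolev_ball s M f ->
  forall N, \sum_(0 <= l < N) `|lcoef f l| <= M ^+ 2 + Z.
Proof.
move=> s12; have [|Z Z0 HZ] := @powR_sum_bounded (2 * s); first by lra.
exists Z => // M f M0 Hf N; apply: le_trans (lerD (sobolev_sum_le M0 Hf N) (HZ N)).
rewrite -big_split/=; apply: ler_sum => l _.
have x0 : 0 < l%:R + 1 / 2 :> R by rewrite ltr_wpDl// divr_gt0.
set x := _ + _ in x0 *; rewrite powRN -sq_powR ?(ltW x0)//.
have w0 : 0 < x `^ s by rewrite powR_gt0.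
have -> : lcoef f l = (x `^ s * lcoef f l) * (x `^ s)^-1.
  by rewrite mulrAC divff ?mul1r// gt_eqF.
rewrite [in leRHS]mulrAC divff ?gt_eqF// mul1r -exprVn normrM.
rewrite [`|(x `^ s)^-1|]gtr0_norm ?invr_gt0// -(@real_normK _ (_ * lcoef f l)) ?num_real//.
have : 0 <= (x `^ s)^-1 by rewrite invr_ge0 ltW.
have : 0 <= `|x `^ s * lcoef f l| by [].
nra.
Qed.

(** Each weight is at least [N^(2 s)]. *)
Lemma sobolev_block s M f N N' : 0 <= M -> 0 <= s -> sobolev_ball s M f -> (0 < N)%N ->
  \sum_(N <= l < N') lcoef f l ^+ 2 <= N%:R `^ (- (2 * s)) * M ^+ 2.
Proof.
move=> M0 s0 Hf N0.
have [NN|/ltnW NN] := leqP N N'; last first.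
  by rewrite big_geq// mulr_ge0 ?powR_ge0 ?sqr_ge0.
have n0 : 0 < N%:R :> R by rewrite ltr0n.
apply: le_trans (ler_wpM2l (powR_ge0 _ _) (sobolev_sum_le M0 Hf N')).
rewrite mulr_sumr [leRHS](@big_cat_nat _ _ _ N)//= -[leLHS]add0r lerD//.
  by apply: sumr_ge0 => l _; rewrite mulr_ge0 ?powR_ge0 ?sqr_ge0.
rewrite big_nat_cond [leRHS]big_nat_cond; apply: ler_sum => l /andP[/andP[Nl _] _].
rewrite exprMn mulrA -[leLHS]mul1r ler_wpM2r ?sqr_ge0//.
rewrite powRN sq_powR ?addr_ge0// ler_pdivlMl ?powR_gt0// mulr1.
apply: ge0_ler_powR; rewrite ?nnegrE ?addr_ge0//; first by rewrite mulr_ge0.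
by rewrite -[leLHS]addr0 lerD ?ler_nat.
Qed.

End sobolev_functions.

(** * Linear forms of independent Gaussian variables *)

Section density_integral.
Context d d' (T : measurableType d) (S : measurableType d') (R : realType).
Variables (mu : {measure set T -> \bar R}) (nu : {measure set S -> \bar R}).
Variables (X : T -> S) (Z : T -> R) (c : R).
Hypotheses (mX : measurable_fun setT X) (mZ : measurable_fun setT Z).
Hypothesis Z0 : forall x, 0 <= Z x.
Hypothesis ZX : forall A, measurable A ->
  (\int[mu]_(x in X @^-1` A) (Z x)%:E = c%:E * nu A)%E.

Import HBNNSimple.

Let integral_density_nnsfun (s : {nnsfun S >-> R}) :
  (\int[mu]_x (Z x * s (X x))%:E = c%:E * \int[nu]_y (s y)%:E)%E.
Proof.
pose r := finmap.enum_fset (fset_set (range s)).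
have sE y : s y = \sum_(k <- r) k * \1_(s @^-1` [set k]) y.
  by rewrite (fimfunE s) fsbig_finite.
have s0 k y : 0 <= k * \1_(s @^-1` [set k]) y by exact: nnfun_muleindic_ge0.
have ms k : measurable (s @^-1` [set k]) by exact: measurable_funPTI.
have mi k : measurable_fun setT (fun y => k * \1_(s @^-1` [set k]) y).
  by apply: measurable_funM => //; exact: measurable_indic.
have miX k : measurable_fun setT (fun x => Z x * (k * \1_(s @^-1` [set k]) (X x))).
  by apply: measurable_funM => //; exact: (measurableT_comp (mi k) mX).
under eq_integral do rewrite sE mulr_sumr -sumEFin.
under [in RHS]eq_integral do rewrite sE -sumEFin.
rewrite ge0_integral_sum//; last 2 first.
- by move=> k; apply/measurable_EFinP; exact: miX.
- by move=> k x _; rewrite lee_fin mulr_ge0.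
rewrite ge0_integral_sum//; last 2 first.
- by move=> k; apply/measurable_EFinP; exact: mi.
- by move=> k y _; rewrite lee_fin.
rewrite ge0_sume_distrr//; last by move=> k _; apply: integral_ge0 => y _; rewrite lee_fin.
apply: eq_bigr => k _.
have [k0|k0] := leP 0 k; last first.
  have n0 y : \1_(s @^-1` [set k]) y = 0 :> R.
    rewrite indicE memNset// => sy; have E : s y = k by exact: sy.
    by have : 0 <= s y by []; rewrite E leNgt k0.
  rewrite (eq_integral (cst 0%E)); last by move=> x _; rewrite n0 !mulr0.
  rewrite integral0 (eq_integral (cst 0%E)); last by move=> x _; rewrite n0 mulr0.
  by rewrite integral0 mule0.
under [in RHS]eq_integral do rewrite EFinM.
rewrite ge0_integralZl//; last by apply/measurable_EFinP; exact: measurable_indic.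
rewrite integral_indic// setIT muleCA -ZX//.
rewrite (integral_mkcond (X @^-1` _)) -ge0_integralZl//; last 2 first.
- apply/(measurable_restrictT _ _).1; first by rewrite -[X in measurable X]setTI; exact: mX.
  by apply: measurable_funTS; exact/measurable_EFinP.
- by move=> x _; apply: erestrict_ge0 => y _; rewrite lee_fin.
apply: eq_integral => x _; rewrite /patch indicE.
have -> : (X x \in s @^-1` [set k]) = (x \in X @^-1` (s @^-1` [set k])) by [].
by case: ifPn => _; rewrite ?mulr1 ?mulr0 ?mule0// -EFinM mulrC.
Qed.

(** The standard machine: if [Z mu] is pushed forward by [X] to [c nu] on sets,
    it is on nonnegative functions. *)
Lemma integral_density (F : S -> R) : measurable_fun setT F -> (forall y, 0 <= F y) ->
  (\int[mu]_x (Z x * F (X x))%:E = c%:E * \int[nu]_y (F y)%:E)%E.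
Proof.
move=> mF F0.
have mE : measurable_fun setT (EFin \o F) by exact/measurable_EFinP.
pose s := nnsfun_approx measurableT mE.
have sF y : EFin \o (fun n => s n y) @ \oo --> (F y)%:E.
  by apply: cvg_nnsfun_approx => // x _; rewrite lee_fin.
have snd y : nondecreasing_seq (fun n => s n y).
  by move=> m n mn; exact/lefP/nd_nnsfun_approx.
have H1 : (\int[nu]_y (s n y)%:E)%E @[n --> \oo] --> (\int[nu]_y (F y)%:E)%E.
  have -> : (\int[nu]_y (F y)%:E)%E = (\int[nu]_y (limn (fun n => (s n y)%:E)))%E.
    by apply: eq_integral => y _; apply/esym/cvg_lim => //; exact: sF.
  apply: cvg_monotone_convergence => //.
  - by move=> n; exact/measurable_EFinP.
  - by move=> n y _; rewrite lee_fin.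
  - by move=> y _ m n mn; rewrite lee_fin; exact: snd.
have H2 : (\int[mu]_x (Z x * s n (X x))%:E)%E @[n --> \oo] -->
    (\int[mu]_x (Z x * F (X x))%:E)%E.
  have -> : (\int[mu]_x (Z x * F (X x))%:E)%E =
     (\int[mu]_x (limn (fun n => (Z x * s n (X x))%:E)))%E.
    apply: eq_integral => x _; apply/esym/cvg_lim => //.
    under eq_fun do rewrite EFinM; rewrite EFinM.
    by apply: cvgeZl => //; exact: sF.
  apply: cvg_monotone_convergence => //.
  - move=> n; apply/measurable_EFinP; apply: measurable_funM => //.
    by apply: measurableT_comp.
  - by move=> n x _; rewrite lee_fin mulr_ge0.
  - by move=> y _ m n mn; rewrite lee_fin ler_wpM2l//; exact: snd.
have H3 : (c%:E * \int[nu]_y (s n y)%:E)%E @[n --> \oo] --> (c%:E * \int[nu]_y (F y)%:E)%E.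
  exact: cvgeZl.
have E : (fun n => \int[mu]_x (Z x * s n (X x))%:E)%E =
    (fun n => c%:E * \int[nu]_y (s n y)%:E)%E.
  by apply/funext => n; exact: integral_density_nnsfun.
by rewrite E in H2; apply: (cvg_unique _ H2 H3).
Qed.

End density_integral.

Section gaussian.
Context d (Om : measurableType d) (R : realType) (P : probability Om R).
Local Notation leb := (@lebesgue_measure R).

(** Completing the square: [exp (a y)] times the density of [N(0, 1)] is
    [exp (a^2 / 2)] times that of [N(a, 1)]. *)
Lemma normal_mgf (X : {RV P >-> R}) (a : R) :
  (forall A : set R, measurable A -> distribution P X A = normal_prob 0 1 A) ->
  (\int[P]_w (expR (a * X w))%:E = (expR (a ^+ 2 / 2))%:E)%E.
Proof.
move=> HX.
have mF : measurable_fun setT (fun y : R => expR (a * y)).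
  by apply: measurableT_comp => //; exact: measurable_funM.
have -> : (\int[P]_w (expR (a * X w))%:E = \int[distribution P X]_y (expR (a * y))%:E)%E.
  by rewrite ge0_integral_distribution//; exact/measurable_EFinP.
have := @integral_density _ _ (measurableTypeR R) R R leb (distribution P X) id
  (normal_pdf 0 1) 1 _ _ _ _ _ mF (fun y => expR_ge0 _).
rewrite mul1e => <- //; last 3 first.
- exact: measurable_normal_pdf.
- exact: normal_pdf_ge0.
- by move=> A mA; rewrite mul1e; exact/esym/HX.
have E y : normal_pdf 0 1 y * expR (a * y) = expR (a ^+ 2 / 2) * normal_pdf a 1 y :> R.
  rewrite !normal_pdfE ?oner_eq0// mulrCA -mulrA; congr (_ * _).
  rewrite /normal_fun -!expRD; congr expR.
  by rewrite subr0 expr1n; field.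
under eq_integral do rewrite E EFinM.
rewrite ge0_integralZl//.
- by rewrite integral_normal_pdf ?mule1// oner_eq0.
- by apply/measurable_EFinP; exact: measurable_normal_pdf.
- by move=> y _; rewrite lee_fin normal_pdf_ge0.
Qed.

(** The functions are introduced one at a time, the indices of [q] being those which
    still carry an event. An index [j] passes from [q] to [r], from events on [X j] to
    functions of [X j], by the standard machine with the product of the other factors
    as [Z]. *)
Lemma integral_independent_prod (I : choiceType) (X : I -> {RV P >-> R})
    (F : I -> R -> R) (m : I -> R) :
  mutually_independent X ->
  (forall i, measurable_fun setT (F i)) -> (forall i y, 0 <= F i y) ->
  (forall i, \int[P]_w (F i (X i w))%:E = (m i)%:E)%E -> (forall i, 0 <= m i) ->
  forall (r q : seq I) (A : I -> set R), uniq (r ++ q) ->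
  (forall i, measurable (A i)) ->
  (\int[P]_w (\prod_(i <- r) F i (X i w) * \prod_(i <- q) \1_(A i) (X i w))%:E =
   (\prod_(i <- r) m i)%:E * \prod_(i <- q) P (X i @^-1` A i))%E.
Proof.
move=> indep mF F0 Fm m0; elim=> [|j r IH] q A.
  move=> uq mA; rewrite big_nil mul1e -indep//.
  rewrite -[X in P X]setIT -integral_indic//; last first.
    by apply: fin_bigcap_measurable => // i _; rewrite -[X in measurable X]setTI; exact: measurable_funP.
  apply: eq_integral => w _; rewrite big_nil mul1r; congr EFin.
  rewrite indicE; have [|wn] := boolP (w \in _).
    rewrite inE => H; rewrite big_seq big1// => i iq.
    by rewrite indicE mem_set//; exact: H.
  apply/eqP; rewrite mulr0n; apply/negPn/negP; rewrite prodf_seq_neq0 => /allP H.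
  move: wn; rewrite notin_setE; apply=> i /= iq.
  by have := H i iq; rewrite indicE; case: (boolP (_ \in _)) => [/set_mem//|]; rewrite eqxx.
rewrite cat_cons cons_uniq => /andP[jrq urq] mA.
have jq : j \notin q by apply: contra jrq; rewrite mem_cat orbC => ->.
pose Z w := \prod_(i <- r) F i (X i w) * \prod_(i <- q) \1_(A i) (X i w).
have mXi i : measurable_fun setT (X i) by [].
have mZ : measurable_fun setT Z.
  apply: measurable_funM; apply: measurable_prod => i _.
    exact: measurableT_comp.
  by apply: measurableT_comp => //; exact: measurable_indic.
have Z0 w : 0 <= Z w by rewrite mulr_ge0// prodr_ge0.
pose c := \prod_(i <- r) m i * \prod_(i <- q) fine (P (X i @^-1` A i)).
have cE : (c%:E = (\prod_(i <- r) m i)%:E * \prod_(i <- q) P (X i @^-1` A i))%E.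
  rewrite EFinM; congr (_ * _)%E; rewrite -prodEFin; apply: eq_bigr => i _.
  rewrite fineK// fin_num_measure//.
  by rewrite -[X in measurable X]setTI; exact: mXi.
have ZX B : measurable B -> (\int[P]_(w in X j @^-1` B) (Z w)%:E = c%:E * distribution P (X j) B)%E.
  move=> mB; pose A' i := if i == j then B else A i.
  have := IH (j :: q) A'; rewrite big_cons => H.
  rewrite integral_mkcond cE -muleA [X in (_ * X)%E]muleC.
  have -> : (\prod_(i <- q) P (X i @^-1` A i) = \prod_(i <- q) P (X i @^-1` A' i))%E.
    apply: eq_big_seq => i iq; rewrite /A' ifN//.
    by apply: contra jq => /eqP <-.
  have -> : distribution P (X j) B = P (X j @^-1` A' j) by rewrite /A' eqxx.
  rewrite -H; last 2 first.
  - by rewrite -[j :: q]cat1s uniq_catCA /= jrq.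
  - by move=> i; rewrite /A'; case: ifP.
  apply: eq_integral => w _; rewrite big_cons /A' eqxx /patch.
  have -> : \prod_(i <- q) \1_(if i == j then B else A i) (X i w) = \prod_(i <- q) \1_(A i) (X i w) :> R.
    apply: eq_big_seq => i iq; rewrite ifN//; by apply: contra jq => /eqP <-.
  rewrite indicE /Z; have -> : (X j w \in B) = (w \in X j @^-1` B) by [].
  by case: ifPn => _; rewrite ?mul1r// mul0r mulr0.
have := @integral_density _ _ _ _ R P (distribution P (X j)) (X j) Z c _ mZ Z0 ZX (F j).
rewrite ge0_integral_distribution//; last 2 first.
- exact/measurable_EFinP.
- by move=> y; rewrite lee_fin.
rewrite Fm => H.
under eq_integral => w _.
  rewrite big_cons -mulrA mulrC -/(Z w).
  over.
rewrite H// big_cons cE EFinM muleC muleA//.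
Qed.

Lemma iid_normal_mgf (I : choiceType) (X : I -> {RV P >-> R}) (r : seq I) (a : I -> R) :
  iid_std_normal X -> uniq r ->
  (\int[P]_w (expR (\sum_(i <- r) a i * X i w))%:E =
   (expR ((\sum_(i <- r) a i ^+ 2) / 2))%:E)%E.
Proof.
move=> [indep norm] ur.
have := @integral_independent_prod I X (fun i y => expR (a i * y))
  (fun i => expR (a i ^+ 2 / 2)) indep _ _ _ _ r [::] (fun=> setT).
rewrite cats0 big_nil mule1 mulr_suml expR_sum => <- //.
- by apply: eq_integral => w _; rewrite big_nil mulr1 expR_sum.
- by move=> i; apply: measurableT_comp => //; exact: measurable_funM.
- by move=> i; apply: normal_mgf => A mA; exact: norm.
Qed.

End gaussian.

(** * Spectral norms and small perturbations *)

Section euclid_theory.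
Context {R : realType}.

Lemma cauchy_schwarz_sum (I : finType) (a b : I -> R) :
  (\sum_i a i * b i) ^+ 2 <= (\sum_i a i ^+ 2) * (\sum_i b i ^+ 2).
Proof.
set S := \sum_i a i * b i; set A := \sum_i a i ^+ 2; set B := \sum_i b i ^+ 2.
have B0 : 0 <= B by apply: sumr_ge0 => i _; exact: sqr_ge0.
have H : 0 <= B * (A * B - S ^+ 2).
  rewrite [leRHS](_ : _ = \sum_i (B * a i - S * b i) ^+ 2).
    by apply: sumr_ge0 => i _; exact: sqr_ge0.
  transitivity (\sum_i (B ^+ 2 * a i ^+ 2 + - (2 * B * S) * (a i * b i) + S ^+ 2 * b i ^+ 2)).
    by rewrite !big_split/= -!mulr_sumr -/S -/A -/B; ring.
  by apply: eq_bigr => i _; ring.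
have [B00|Bn0] := eqVneq B 0; last first.
  by move: H; rewrite pmulr_rge0 ?subr_ge0// lt_def Bn0.
rewrite /S big1 ?expr0n ?B00 ?mulr0// => i _.
have : b i ^+ 2 <= B by rewrite /B (bigD1 i)//= lerDl sumr_ge0// => j _; exact: sqr_ge0.
by rewrite B00 => b0; have /eqP := le_anti (introT andP (conj b0 (sqr_ge0 (b i)))); rewrite sqrf_eq0 => /eqP ->; rewrite mulr0.
Qed.

Definition dot (m : nat) (x y : 'cV[R]_m) : R := \sum_i x i ord0 * y i ord0.

Lemma dotE m (x y : 'cV[R]_m) : dot x y = (x^T *m y) ord0 ord0.
Proof. by rewrite mxE; apply: eq_bigr => i _; rewrite mxE. Qed.

Lemma dot_mulmx m p (A : 'M[R]_(m, p)) x y : dot x (A *m y) = dot (A^T *m x) y.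
Proof. by rewrite !dotE trmx_mul trmxK mulmxA. Qed.

Lemma dotC m (x y : 'cV[R]_m) : dot x y = dot y x.
Proof. by apply: eq_bigr => i _; rewrite mulrC. Qed.

Lemma dotDl m (x y z : 'cV[R]_m) : dot (x + y) z = dot x z + dot y z.
Proof. by rewrite -big_split/=; apply: eq_bigr => i _; rewrite mxE mulrDl. Qed.

Lemma dotZl m (c : R) (x z : 'cV[R]_m) : dot (c *: x) z = c * dot x z.
Proof. by rewrite mulr_sumr; apply: eq_bigr => i _; rewrite mxE mulrA. Qed.

Lemma euclid_ge0 m (x : 'cV[R]_m) : 0 <= euclid x. Proof. exact: sqrtr_ge0. Qed.

Lemma sqr_euclid m (x : 'cV[R]_m) : euclid x ^+ 2 = dot x x.
Proof.
rewrite /euclid sqr_sqrtr; first by apply: eq_bigr => i _; rewrite expr2.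
by apply: sumr_ge0 => i _; exact: sqr_ge0.
Qed.

Lemma le_euclid m (x : 'cV[R]_m) (c : R) : 0 <= c -> dot x x <= c ^+ 2 -> euclid x <= c.
Proof. by move=> c0; rewrite -sqr_euclid ler_sqr ?nnegrE ?euclid_ge0. Qed.

Lemma dot_le m (x y : 'cV[R]_m) : dot x y <= euclid x * euclid y.
Proof.
apply: le_trans (ler_norm _) _.
rewrite -ler_sqr ?nnegrE ?mulr_ge0 ?euclid_ge0// real_normK ?num_real//.
rewrite exprMn !sqr_euclid; apply: le_trans (cauchy_schwarz_sum _ _) _.
by rewrite /dot; under eq_bigr do rewrite expr2; under [X in _ * X <= _]eq_bigr do rewrite expr2.
Qed.

Lemma euclidD m (x y : 'cV[R]_m) : euclid (x + y) <= euclid x + euclid y.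
Proof.
apply: le_euclid; first by rewrite addr_ge0 ?euclid_ge0.
rewrite dotDl dotC dotDl (dotC y (x + y)) dotDl sqrrD !sqr_euclid (dotC y x).
have := dot_le x y; lra.
Qed.

Lemma euclidZ m (c : R) (x : 'cV[R]_m) : euclid (c *: x) = `|c| * euclid x.
Proof.
apply/eqP; rewrite -(@eqrXn2 _ 2)// ?euclid_ge0 ?mulr_ge0 ?euclid_ge0//.
by rewrite exprMn !sqr_euclid dotZl dotC dotZl real_normK ?num_real// expr2 mulrA.
Qed.

Lemma abs_le_euclid m (x : 'cV[R]_m) i : `|x i ord0| <= euclid x.
Proof.
rewrite -ler_sqr ?nnegrE ?euclid_ge0// real_normK ?num_real// sqr_euclid.
by rewrite /dot (bigD1 i)//= expr2 lerDl sumr_ge0// => j _; rewrite -expr2 sqr_ge0.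
Qed.

Lemma euclid_le_sum m (x : 'cV[R]_m) : euclid x <= \sum_i `|x i ord0|.
Proof.
apply: le_euclid; first exact: sumr_ge0.
rewrite expr2 {1}/dot mulr_suml; apply: ler_sum => i _.
apply: le_trans (ler_norm _) _; rewrite normrM ler_wpM2l//.
by rewrite (bigD1 i)//= lerDl sumr_ge0.
Qed.

Lemma euclid_eq0 m (x : 'cV[R]_m) : euclid x = 0 -> x = 0.
Proof.
move=> x0; apply/matrixP => i j; rewrite ord1 !mxE; apply/eqP.
by rewrite -normr_le0 -x0 abs_le_euclid.
Qed.

Lemma euclid0 m : euclid (0 : 'cV[R]_m) = 0.
Proof. by have := euclidZ 0 (0 : 'cV[R]_m); rewrite scale0r normr0 mul0r. Qed.

Lemma euclid_mulmx_frob m p (A : 'M[R]_(m, p)) x (c : R) : 0 <= c ->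
  \sum_i \sum_j A i j ^+ 2 <= c ^+ 2 -> euclid (A *m x) <= c * euclid x.
Proof.
move=> c0 H; apply: le_euclid; first by rewrite mulr_ge0 ?euclid_ge0.
rewrite exprMn; apply: le_trans (ler_wpM2r (sqr_ge0 _) H).
rewrite mulr_suml; apply: ler_sum => i _; rewrite -expr2 mxE.
apply: le_trans (cauchy_schwarz_sum _ _) _; rewrite ler_wpM2l//.
  by apply: sumr_ge0 => j _; exact: sqr_ge0.
by rewrite sqr_euclid /dot; under eq_bigr do rewrite expr2.
Qed.

Lemma euclid_mulmx_opnorm m p (A : 'M[R]_(m, p)) x : euclid (A *m x) <= opnorm A * euclid x.
Proof.
have hs : has_sup [set euclid (A *m x) | x in [set x : 'cV[R]_p | euclid x <= 1]].
  split; first by exists (euclid (A *m 0)), 0 => //=; rewrite euclid0.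
  exists (Num.sqrt (\sum_i \sum_j A i j ^+ 2)) => _ [y /= y1 <-].
  apply: le_trans (euclid_mulmx_frob (c := Num.sqrt (\sum_i \sum_j A i j ^+ 2)) _ _ _) _.
  - exact: sqrtr_ge0.
  - rewrite sqr_sqrtr//; apply: sumr_ge0 => i _; apply: sumr_ge0 => j _; exact: sqr_ge0.
  - by rewrite ler_piMr// sqrtr_ge0.
have [x0|xn0] := eqVneq (euclid x) 0.
  by rewrite (euclid_eq0 x0) mulmx0 !euclid0 mulr0.
have xp : 0 < euclid x by rewrite lt_def xn0 euclid_ge0.
rewrite -ler_pdivrMr// mulrC -[(euclid x)^-1]gtr0_norm ?invr_gt0// -euclidZ scalemxAr.
apply: sup_upper_bound => //; exists ((euclid x)^-1 *: x) => //=.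
by rewrite euclidZ gtr0_norm ?invr_gt0// mulVf.
Qed.

Lemma opnorm_ge0 m p (A : 'M[R]_(m, p.+1)) : 0 <= opnorm A.
Proof.
have := euclid_mulmx_opnorm A (delta_mx ord0 ord0).
have -> : euclid (delta_mx ord0 ord0 : 'cV[R]_p.+1) = 1.
  rewrite /euclid (bigD1 ord0)//= mxE eqxx expr1n big1 ?addr0 ?sqrtr1// => i /negbTE i0.
  by rewrite mxE i0 expr0n.
by rewrite mulr1; apply: le_trans; exact: euclid_ge0.
Qed.

Lemma opnorm_le m p (A : 'M[R]_(m, p)) (c : R) : 0 <= c ->
  (forall x, euclid (A *m x) <= c * euclid x) -> opnorm A <= c.
Proof.
move=> c0 H; apply: ge_sup.
  by exists (euclid (A *m 0)), 0 => //=; rewrite euclid0.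
move=> _ [x /= x1 <-]; apply: le_trans (H x) _; by rewrite ler_piMr.
Qed.

(** Apply the matrix to its own row. *)
Lemma row_le_opnorm m p (A : 'M[R]_(m, p.+1)) i (c : R) : opnorm A <= c ->
  \sum_k A i k ^+ 2 <= c ^+ 2.
Proof.
move=> Ac; pose x : 'cV[R]_p.+1 := \col_k A i k.
have xE : \sum_k A i k ^+ 2 = euclid x ^+ 2.
  by rewrite sqr_euclid; apply: eq_bigr => k _; rewrite mxE expr2.
rewrite xE ler_sqr ?nnegrE ?euclid_ge0//; last exact: le_trans (opnorm_ge0 A) Ac.
apply: le_trans Ac.
have [->|xn0] := eqVneq (euclid x) 0; first exact: opnorm_ge0.
have xp : 0 < euclid x by rewrite lt_def xn0 euclid_ge0.
rewrite -(ler_pM2r xp); apply: le_trans (euclid_mulmx_opnorm A x).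
apply: le_trans (abs_le_euclid _ i); rewrite -expr2 -xE mxE.
by apply: le_trans (ler_norm _); apply: ler_sum => k _; rewrite mxE expr2.
Qed.

Lemma unitmx_inj p (A : 'M[R]_p) : (forall x : 'cV[R]_p, A *m x = 0 -> x = 0) ->
  A \in unitmx.
Proof.
move=> H; rewrite -unitmx_tr -row_free_unit -kermx_eq0; apply/rowV0P => v /sub_kermxP vA.
apply: trmx_inj; rewrite trmx0; apply: H; apply: trmx_inj.
by rewrite trmx_mul trmxK vA trmx0.
Qed.

Section small_perturbation.
Variables (p : nat) (E : 'M[R]_p) (m : R).
Hypotheses (Em : forall i j, `|E i j| <= m) (pm : p%:R * m <= 1 / 2).

(** At the coordinate [j] where [|y|] is largest, [E y] is at most half of [y j]. *)
Lemma sup_add_mulmx (y : 'cV[R]_p) (B : R) :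
  (forall i, `|(y + E *m y) i ord0| <= B) -> forall i, `|y i ord0| <= 2 * B.
Proof.
move=> HB i; have [j _ Hj] := @arg_maxP _ _ _ i xpredT (fun i => `|y i ord0|) isT.
apply: le_trans (Hj i isT) _.
have := HB j; rewrite mxE => H1.
have H2 : `|(E *m y) j ord0| <= 1 / 2 * `|y j ord0|.
  rewrite mxE; apply: le_trans (ler_norm_sum _ _ _) _.
  apply: le_trans (_ : _ <= \sum_(k < p) m * `|y j ord0|) _.
    by apply: ler_sum => k _; rewrite normrM ler_pM//; exact: Hj.
  by rewrite sumr_const card_ord -[leLHS]mulr_natl mulrA ler_wpM2r.
have := ler_normB (y j ord0 + (E *m y) j ord0) ((E *m y) j ord0).
rewrite addrK; lra.
Qed.

Lemma euclid_mulmx_small (x : 'cV[R]_p) : euclid (E *m x) <= 1 / 2 * euclid x.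
Proof.
apply: euclid_mulmx_frob => //.
case: p E Em pm => [|q] E' Em' pm'; first by rewrite big_ord0 sqr_ge0.
have m0 : 0 <= m by apply: le_trans (Em' ord0 ord0).
apply: le_trans (_ : (q.+1%:R * m) ^+ 2 <= _); last first.
  by rewrite ler_sqr// nnegrE ?mulr_ge0.
apply: le_trans (_ : \sum_(i < q.+1) \sum_(j < q.+1) m ^+ 2 <= _).
  apply: ler_sum => i _; apply: ler_sum => j _.
  by rewrite -(@real_normK _ (E' i j)) ?num_real// ler_sqr ?nnegrE.
by rewrite !sumr_const !card_ord -mulrnA -[leLHS]mulr_natl natrM exprMn expr2.
Qed.

Lemma euclid_add_mulmx (y : 'cV[R]_p) : euclid y <= 2 * euclid (y + E *m y).
Proof.
have := euclidD (y + E *m y) (- 1 *: (E *m y)); rewrite scaleN1r addrK.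
rewrite -scaleN1r euclidZ normrN normr1 mul1r.
have := euclid_mulmx_small y; lra.
Qed.

Lemma unitmx_perturbation : 1%:M + E \in unitmx.
Proof.
apply: unitmx_inj => x; rewrite mulmxDl mul1mx => H.
have := euclid_add_mulmx x; rewrite H euclid0 mulr0 => x0.
by apply: euclid_eq0; apply/le_anti; rewrite x0 euclid_ge0.
Qed.

End small_perturbation.

(** A nonnegative quadratic polynomial has a nonpositive discriminant; the values
    of [t] are the minimiser if [c > 0], and a point where the value is [-1] if
    [c = 0] and [b] is nonzero. *)
Lemma discriminant_le (a b c : R) : 0 <= c ->
  (forall t, 0 <= a + 2 * t * b + t ^+ 2 * c) -> b ^+ 2 <= a * c.
Proof.
rewrite le_eqVlt => /predU1P[<-|c0] H; last first.
  have := H (- b / c); rewrite -(pmulr_rge0 _ c0).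
  rewrite [X in 0 <= X](_ : _ = a * c - b ^+ 2); last by field; rewrite gt_eqF.
  by rewrite subr_ge0.
have [->|b0] := eqVneq b 0; first by rewrite expr0n mulr0.
have := H (- (a + 1) / (2 * b)).
rewrite [X in 0 <= X](_ : _ = -1); last by field.
by rewrite oppr_ge0 ler10.
Qed.

(** If the eigenvalues of [W W^T] are at most [C], so is the square of the norm of
    [W^T]: otherwise, for [s] this square, [s I - W W^T] is invertible and
    semidefinite, hence bounded below, and [s] is not optimal. *)
Lemma eigenvalue_bound p k (W : 'M[R]_(p.+1, k)) (C : R) :
  (forall a, eigenvalue (W *m W^T) a -> a <= C) ->
  forall x : 'cV[R]_p.+1, euclid (W^T *m x) ^+ 2 <= C * euclid x ^+ 2.
Proof.
move=> HC; pose s := opnorm W^T ^+ 2.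
have Hs x : euclid (W^T *m x) ^+ 2 <= s * euclid x ^+ 2.
  by rewrite -exprMn ler_sqr ?nnegrE ?mulr_ge0 ?euclid_ge0 ?opnorm_ge0// euclid_mulmx_opnorm.
suff sC : s <= C by move=> x; apply: le_trans (Hs x) _; rewrite ler_wpM2r ?sqr_ge0.
pose N := s%:M - W *m W^T.
have [Nu|Nu] := boolP (N \in unitmx); last first.
  apply: HC; move: Nu; rewrite -row_free_unit -kermx_eq0 => /rowV0Pn[v /sub_kermxP vN vn0].
  apply/eigenvalueP; exists v => //; apply/eqP; rewrite -subr_eq0 -oppr_eq0 opprB.
  by rewrite -mul_mx_scalar -mulmxBr; apply/eqP.
exfalso.
have NT : N^T = N by rewrite /N linearB/= tr_scalar_mx trmx_mul trmxK.
have NE x y : dot x (N *m y) = s * dot x y - dot (W^T *m x) (W^T *m y).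
  rewrite dotC mulmxBl mul_scalar_mx -[- _]scaleN1r dotDl !dotZl mulN1r (dotC y x).
  by rewrite -mulmxA (dotC _ x) [X in _ - X = _]dot_mulmx.
have N0 x : 0 <= dot x (N *m x).
  by rewrite NE subr_ge0 -!sqr_euclid.
have NCS x y : dot x (N *m y) ^+ 2 <= dot x (N *m x) * dot y (N *m y).
  apply: discriminant_le => // t.
  have := N0 (x + t *: y).
  rewrite !NE !mulmxDr -!scalemxAr !dotDl !(dotC _ (_ + _)) !dotDl !dotZl.
  rewrite !(dotC _ (t *: _)) !dotZl (dotC y x) (dotC (W^T *m y)).
  by congr (0 <= _); ring.
pose K := opnorm (invmx N) + 1.
have K0 : 0 < K by rewrite ltr_wpDl ?opnorm_ge0.
have lb x : euclid x ^+ 2 / K <= dot x (N *m x).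
  have [->|xn0] := eqVneq (euclid x) 0; first by rewrite expr0n mul0r.
  have xp : 0 < euclid x ^+ 2 by rewrite exprn_gt0// lt_def xn0 euclid_ge0.
  have := NCS x (invmx N *m x); rewrite mulKVmx// -sqr_euclid => H.
  have H2 : dot (invmx N *m x) x <= K * euclid x ^+ 2.
    apply: le_trans (dot_le _ _) _; rewrite expr2 mulrA ler_wpM2r ?euclid_ge0//.
    apply: le_trans (euclid_mulmx_opnorm _ _) _; rewrite ler_wpM2r ?euclid_ge0//.
    by rewrite /K lerDl.
  rewrite ler_pdivrMr//.
  have {H H2} := le_trans H (ler_wpM2l (N0 x) H2).
  move: xp; set e := euclid x ^+ 2 => e0.
  by rewrite [e ^+ 2]expr2 [X in _ <= X]mulrA ler_pM2r.
have H x : euclid (W^T *m x) ^+ 2 <= (s - K^-1) * euclid x ^+ 2.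
  by have := lb x; rewrite NE -!sqr_euclid mulrBl [K^-1 * _]mulrC; lra.
have sK : 0 <= s - K^-1.
  have := H (delta_mx ord0 ord0).
  have -> : euclid (delta_mx ord0 ord0 : 'cV[R]_p.+1) = 1.
    rewrite /euclid (bigD1 ord0)//= mxE eqxx expr1n big1 ?addr0 ?sqrtr1// => i /negbTE i0.
    by rewrite mxE i0 expr0n.
  by rewrite expr1n mulr1; apply: le_trans; exact: sqr_ge0.
have : opnorm W^T <= Num.sqrt (s - K^-1).
  apply: opnorm_le; first exact: sqrtr_ge0.
  move=> x; rewrite -ler_sqr ?nnegrE ?mulr_ge0 ?euclid_ge0 ?sqrtr_ge0//.
  by rewrite exprMn (sqr_sqrtr sK); exact: H.
rewrite -ler_sqr ?nnegrE ?opnorm_ge0 ?sqrtr_ge0// sqr_sqrtr// -/s.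
have : 0 < K^-1 by rewrite invr_gt0.
lra.
Qed.

End euclid_theory.

(** * One level for given noises, thresholding, trade-off *)

Section one_level.
Context {R : realType}.
Variables (p : nat) (K B : 'M[R]_p.+1) (F xi : 'cV[R]_p.+1) (delta eps F1 : R).
Hypotheses (Ku : K \in unitmx) (delta_gt0 : 0 < delta) (eps_ge0 : 0 <= eps).
Hypothesis F1P : \sum_i `|F i ord0| <= F1.
Let Kd := K + delta *: B.
Let y := K *m F + eps *: xi.
Let H := invmx K *m B.
Let X := invmx K *m xi.

Lemma abs_mulmx_le (A : 'M[R]_p.+1) (m : R) : (forall i j, `|A i j| <= m) ->
  forall i, `|(A *m F) i ord0| <= m * F1.
Proof.
move=> Am i; rewrite mxE; apply: le_trans (ler_norm_sum _ _ _) _.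
have m0 : 0 <= m by apply: le_trans (Am ord0 ord0).
apply: le_trans (ler_wpM2l m0 F1P); rewrite mulr_sumr; apply: ler_sum => j _.
by rewrite normrM ler_wpM2r.
Qed.

Section small.
Variable m : R.
Hypotheses (Hm : forall i j, `|H i j| <= m) (dm : p.+1%:R * (delta * m) <= 1 / 2).
Let E := delta *: H.

Let Em i j : `|E i j| <= delta * m.
Proof. by rewrite mxE normrM gtr0_norm// ler_pM2l. Qed.

Let KdE : Kd = K *m (1%:M + E).
Proof. by rewrite mulmxDr mulmx1 -scalemxAr /H mulKVmx. Qed.

Lemma perturbed_unit : Kd \in unitmx.
Proof. by rewrite KdE unitmx_mul Ku (unitmx_perturbation Em dm). Qed.

(** With [v = Kd^-1 x], [v + E v = K^-1 x], so that [v] is at most twice as long as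
    [K^-1 x]. *)
Lemma perturbed_opnorm : opnorm (invmx Kd) <= 2 * opnorm (invmx K).
Proof.
have Eu := unitmx_perturbation Em dm.
apply: opnorm_le => [|x]; first by rewrite mulr_ge0 ?opnorm_ge0.
rewrite -mulrA; apply: le_trans (_ : _ <= 2 * euclid (invmx K *m x)) _; last first.
  by rewrite ler_pM2l// euclid_mulmx_opnorm.
apply: le_trans (euclid_add_mulmx Em dm _) _; rewrite ler_pM2l//.
have -> : invmx Kd *m x + E *m (invmx Kd *m x) = (1%:M + E) *m (invmx Kd *m x).
  by rewrite mulmxDl mul1mx.
by rewrite -{1}(mulKmx Ku ((1%:M + E) *m _)) [K *m _]mulmxA -KdE mulKVmx// perturbed_unit.
Qed.

(** The error [w = Kd^-1 y - F] solves [w + E w = eps X - delta H F], where [E] has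
    small row sums. At the largest coordinate this gives [|w| <= 2 |w + E w|]. *)
Lemma perturbed_error (n : R) : (forall i, `|X i ord0| <= n) ->
  forall i, `|(invmx Kd *m y) i ord0 - F i ord0| <= 2 * (delta * (m * F1) + eps * n).
Proof.
move=> Xn i; pose w := invmx Kd *m y - F.
have wE : w + E *m w = eps *: X - delta *: (H *m F).
  have -> : w + E *m w = (1%:M + E) *m w by rewrite mulmxDl mul1mx.
  rewrite /w mulmxBr.
  rewrite -{1}(mulKmx Ku ((1%:M + E) *m _)) [K *m _]mulmxA -KdE mulKVmx ?perturbed_unit//.
  rewrite /y mulmxDr mulKmx// -scalemxAr mulmxDl mul1mx -scalemxAl.
  by rewrite opprD addrACA subrr add0r.
have HB j : `|(w + E *m w) j ord0| <= delta * (m * F1) + eps * n.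
  rewrite wE [X in `|X|]mxE [X in `|X + _|]mxE [X in `|_ + X|]mxE [X in `|_ - X|]mxE.
  apply: le_trans (ler_normB _ _) _; rewrite [leLHS]addrC.
  rewrite lerD// normrM ger0_norm// ?(ltW delta_gt0)// ler_wpM2l// ?(ltW delta_gt0)//.
  exact: abs_mulmx_le.
have := sup_add_mulmx Em dm HB i.
by rewrite /w [X in `|X|]mxE [X in `|_ + X|]mxE.
Qed.

End small.

(** When [H] is large, the cut-off on the norm of [Kd^-1] takes over. The error is
    expressed by means of [Kd], as [Kd^-1 (eps xi - delta B F)]: [K] itself, whose
    norm is not controlled, does not appear. *)
Lemma crude_error (kappa : R) : 
  (forall i, `|F i ord0| <= F1) ->
  let z := coef_estimator kappa delta Kd y in
  forall beta O1 : R, (forall i j, `|B i j| <= beta) ->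
  0 <= O1 -> (op_threshold kappa delta p)^-1 <= O1 ->
  `|z - F ord_max ord0| <= F1 + O1 * (delta * (p.+1%:R * (beta * F1)) + eps * \sum_i `|xi i ord0|).
Proof.
move=> FF1 z beta O1 Bb O10 OO.
have F10 : 0 <= F1 by apply: le_trans (FF1 ord0).
have b0 : 0 <= beta by apply: le_trans (Bb ord0 ord0).
have T0 : 0 <= O1 * (delta * (p.+1%:R * (beta * F1)) + eps * \sum_i `|xi i ord0|).
  rewrite mulr_ge0// addr_ge0// mulr_ge0 ?(ltW delta_gt0) ?sumr_ge0//.
  by rewrite !mulr_ge0.
rewrite /z /coef_estimator; case: ifPn => [/andP[Kdu opK]|_]; last first.
  by rewrite sub0r normrN -[leLHS]addr0 lerD.
rewrite -[leLHS]add0r lerD//.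
have yE : invmx Kd *m y - F = invmx Kd *m (eps *: xi - delta *: (B *m F)).
  rewrite -[X in _ - X](mulKmx Kdu) -mulmxBr; congr (_ *m _).
  by rewrite /y /Kd mulmxDl -scalemxAl opprD addrACA subrr add0r.
have := abs_le_euclid (invmx Kd *m y - F) ord_max; rewrite !mxE => /le_trans; apply.
rewrite yE; apply: le_trans (euclid_mulmx_opnorm _ _) _.
apply: ler_pM; rewrite ?opnorm_ge0 ?euclid_ge0//; first exact: le_trans (ltW opK) OO.
apply: le_trans (euclidD _ _) _; rewrite addrC lerD//.
  rewrite -scaleNr euclidZ normrN gtr0_norm// ler_pM2l//.
  apply: le_trans (euclid_le_sum _) _.
  apply: le_trans (_ : \sum_(i < p.+1) beta * F1 <= _).
    by apply: ler_sum => i _; exact: abs_mulmx_le.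
  by rewrite sumr_const card_ord -[leLHS]mulr_natl.
by rewrite euclidZ ger0_norm// ler_wpM2l// euclid_le_sum.
Qed.

End one_level.

Section thresholding.
Context {R : realType}.
Implicit Types z f S : R.

Definition thresholded S z : R := if S < `|z| then z else 0.

(** An error of half a threshold costs no more than an oracle which would keep or
    kill the coefficient knowing which is better. *)
Lemma thresholded_close S z f : `|z - f| <= S / 2 ->
  `|thresholded S z - f| <= Num.min `|f| (3 / 2 * S).
Proof.
move=> H; rewrite le_min /thresholded.
have h1 := ler_normD (z - f) f; rewrite subrK in h1.
have h2 : `|f| <= `|z - f| + `|z|.
  have := ler_normB z (z - f); rewrite opprB addrCA subrr addr0; lra.
have S0 : 0 <= S / 2 by apply: le_trans H.
case: ltP => Sz; last by rewrite sub0r normrN lexx/=; lra.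
by apply/andP; split; lra.
Qed.

Lemma thresholded_le S z f : `|thresholded S z - f| <= `|z - f| + `|f|.
Proof.
rewrite /thresholded; case: ifP => _; first by rewrite lerDl.
by rewrite sub0r normrN lerDr.
Qed.

(** Minkowski's inequality and the comparison of the Euclidean norm with the sum of
    the absolute values, for the improbable part [x] of the error. *)
Lemma sqrt_sum_sqr_le (N : nat) (t : R) (a x e : nat -> R) : 0 <= t ->
  (forall l, 0 <= a l) -> (forall l, 0 <= x l) ->
  (forall l, (l < N)%N -> `|e l| <= a l + x l) ->
  Num.sqrt (t + \sum_(0 <= l < N) e l ^+ 2) <=
  Num.sqrt (t + \sum_(0 <= l < N) a l ^+ 2) + \sum_(0 <= l < N) x l.
Proof.
move=> t0 a0 x0 ea; rewrite !big_mkord.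
set A := Num.sqrt (_ + \sum_(l < N) a l ^+ 2); set S := \sum_(l < N) x l.
have sa : 0 <= \sum_(l < N) a l ^+ 2 by apply: sumr_ge0 => l _; exact: sqr_ge0.
have A0 : 0 <= A by exact: sqrtr_ge0.
have S0 : 0 <= S by apply: sumr_ge0.
have A2 : A ^+ 2 = t + \sum_(l < N) a l ^+ 2 by rewrite sqr_sqrtr// addr_ge0.
rewrite -(ler_sqr _ _) ?nnegrE ?sqrtr_ge0 ?addr_ge0// sqr_sqrtr; last first.
  by rewrite addr_ge0// sumr_ge0// => l _; exact: sqr_ge0.
rewrite sqrrD A2 -[A * S *+ 2]mulr_natl -!addrA lerD2l.
apply: le_trans (_ : \sum_(l < N) (a l ^+ 2 + (2 * (A * x l) + S * x l)) <= _).
  apply: ler_sum => l _.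
  have al : a l <= A.
    rewrite -ler_sqr ?nnegrE// A2 (bigD1 l)//= addrCA lerDl addr_ge0//.
    by apply: sumr_ge0 => k _; exact: sqr_ge0.
  have xl : x l <= S by rewrite /S (bigD1 l)//= lerDl sumr_ge0.
  have := ea l (ltn_ord l); rewrite -(@real_normK _ (e l)) ?num_real// => el.
  have : `|e l| ^+ 2 <= (a l + x l) ^+ 2 by rewrite ler_sqr ?nnegrE ?addr_ge0.
  have := a0 l; have := x0 l; nra.
by rewrite !big_split/= -!mulr_sumr -/S -expr2.
Qed.

End thresholding.

Section rate.
Context {R : realType}.

Lemma powR_expR (u x : R) : 0 < u -> u `^ x = expR (x * ln u).
Proof. by move=> u0; rewrite /powR gt_eqF. Qed.

(** Bias-variance trade-off: the crossover level is [u^(-2/D)], with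
    [D = 2(s+nu)+1]. Below it, the squares of the thresholds [l^nu u] add up to the
    square of the rate; above it, so do the squares of the coefficients. The maximal
    level is [lambda u^(-1/(nu+1))], where [1/(nu+1) >= 2/D] as [s > 1/2], so that
    the truncation costs at most a multiple of the rate. *)
Lemma tradeoff (s nu lambda M tau u : R) (f : R -> R) (a : nat -> R) (N : nat) :
  0 <= M -> 1 / 2 < s -> 0 <= nu -> 0 < lambda -> 0 < u <= 1 -> 0 <= tau ->
  sobolev_ball s M f ->
  1 <= lambda * u `^ (- (nu + 1)^-1) < N%:R ->
  (forall l, 0 <= a l) -> (forall l, a l <= `|lcoef f l|) ->
  (forall l, a l <= tau * ((maxn l 1)%:R `^ nu * u)) ->
  Num.sqrt (tail_sq f N + \sum_(0 <= l < N) a l ^+ 2) <=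
  Num.sqrt (lambda `^ (- (2 * s)) * M ^+ 2 + (2 * tau ^+ 2 + M ^+ 2)) *
    u `^ (2 * s / (2 * (s + nu) + 1)).
Proof.
move=> M0 s12 nu0 l0 /andP[u0 u1] tau0 Hf /andP[L1 LN] a0 af au.
have [[fL2 _] _] := Hf.
pose D := 2 * (s + nu) + 1; have D0 : 0 < D by rewrite /D; lra.
have s0 : 0 <= s by lra.
have lnu : ln u <= 0 by exact: ln_le0.
set L := lambda * _ in L1 LN.
have Lpos : 0 < L by lra.
have Npos : (0 < N)%N by rewrite -(ltr0n R); lra.
pose R0 := u `^ (- 2 / D).
have R00 : 0 < R0 by exact: powR_gt0.
have R01 : 1 <= R0.
  rewrite /R0 powR_expR// -expR0 ler_expR mulr_le0//.
  by rewrite mulNr oppr_le0 divr_ge0// ltW.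
pose U := u `^ (4 * s / D).
have U0 : 0 <= U by exact: powR_ge0.
have URs : R0 `^ (- (2 * s)) = U.
  rewrite /R0 /U -powRrM; congr (_ `^ _); field; lra.
have -> : u `^ (2 * s / (2 * (s + nu) + 1)) = Num.sqrt U.
  rewrite -[LHS]ger0_norm ?powR_ge0// -sqrtr_sqr; congr Num.sqrt.
  rewrite -/D sq_powR ?(ltW u0)// /U; congr (_ `^ _); field; lra.
have c1 : 0 <= lambda `^ (- (2 * s)) * M ^+ 2 by rewrite mulr_ge0 ?powR_ge0 ?sqr_ge0.
have c2 : 0 <= 2 * tau ^+ 2 + M ^+ 2 by rewrite addr_ge0 ?mulr_ge0 ?sqr_ge0.
rewrite -sqrtrM; last exact: addr_ge0.
apply: ler_wsqrtr; rewrite mulrDl lerD//.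
  apply: tail_sq_le => // N' _; apply: le_trans (sobolev_block _ M0 s0 Hf Npos) _.
  rewrite mulrAC ler_wpM2r ?sqr_ge0//.
  apply: le_trans (_ : L `^ (- (2 * s)) <= _).
    rewrite !powRN lef_pV2 ?posrE ?powR_gt0 ?ltr0n//.
    apply: ge0_ler_powR; rewrite ?nnegrE//; [lra|exact: ltW|exact: ltW].
  rewrite /L powRM ?powR_ge0 ?(ltW l0)// ler_wpM2l ?powR_ge0// /U -powRrM.
  apply: ger_powR; first by rewrite u0 u1.
  rewrite mulrNN; have n1 : 0 < nu + 1 by lra.
  rewrite [_^-1 * _]mulrC ler_pdivrMr// mulrAC ler_pdivlMr//.
  rewrite /D; nra.
pose N0 := (Num.truncn R0).+1.
have /andP[RN0 RN] := truncn_itv (ltW R00).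
pose N' := maxn N N0.
apply: le_trans (_ : \sum_(0 <= l < N') a l ^+ 2 <= _).
  rewrite (@big_cat_nat _ _ _ N 0 N')//=; last exact: leq_maxl.
  by rewrite lerDl; apply: sumr_ge0 => l _; exact: sqr_ge0.
rewrite (@big_cat_nat _ _ _ N0 0 N')//=; last exact: leq_maxr.
rewrite mulrDl lerD//; last first.
  apply: le_trans (_ : \sum_(N0 <= l < N') lcoef f l ^+ 2 <= _).
    apply: ler_sum => l _; rewrite -(@real_normK _ (lcoef f l)) ?num_real//.
    by rewrite ler_sqr ?nnegrE.
  apply: le_trans (sobolev_block _ M0 s0 Hf _) _ => //.
  rewrite mulrC ler_wpM2l ?sqr_ge0// -URs.
  rewrite !powRN lef_pV2 ?posrE ?powR_gt0// ?ltr0n//.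
  by apply: ge0_ler_powR; rewrite ?nnegrE//; [lra|exact: ltW|exact: ltW].
apply: le_trans (_ : \sum_(0 <= l < N0) tau ^+ 2 * (R0 `^ (2 * nu) * u ^+ 2) <= _).
  rewrite !big_mkord; apply: ler_sum => l _.
  apply: le_trans (_ : (tau * (R0 `^ nu * u)) ^+ 2 <= _); last first.
    by rewrite !exprMn sq_powR// ltW.
  rewrite ler_sqr ?nnegrE ?mulr_ge0 ?powR_ge0 ?(ltW u0)//.
  apply: le_trans (au l) _; rewrite ler_wpM2l// ler_wpM2r ?(ltW u0)//.
  apply: ge0_ler_powR; rewrite ?nnegrE ?ler0n ?(ltW R00)//.
  rewrite /maxn; case: ifP => // _.
  by apply: le_trans RN0; rewrite ler_nat -ltnS ltn_ord.
rewrite sumr_const_nat subn0 -[leLHS]mulr_natl.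
have UE : R0 * (R0 `^ (2 * nu) * u ^+ 2) = U.
  rewrite -[R0 in R0 * _]powRr1 ?(ltW R00)// mulrA -powRD; last by apply/implyP => _; rewrite gt_eqF.
  rewrite /R0 -powRrM -powR_mulrn ?(ltW u0)// -powRD; last by apply/implyP => _; rewrite gt_eqF.
  by rewrite /U; congr (_ `^ _); rewrite /D; field; lra.
rewrite -UE; set P := R0 `^ (2 * nu) * u ^+ 2.
have P0 : 0 <= P by rewrite mulr_ge0 ?powR_ge0 ?sqr_ge0.
rewrite [leRHS](_ : _ = 2 * R0 * (tau ^+ 2 * P)); last by ring.
apply: ler_wpM2r; first by rewrite mulr_ge0 ?sqr_ge0.
by rewrite /N0 -natr1; lra.
Qed.

End rate.

(** * Subgaussian variables and the cost of improbable events *)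

Section subgaussian.
Context d (Om : measurableType d) (R : realType) (P : probability Om R).
Implicit Types (Z Y : Om -> R) (v : R).

(** [v] is a bound on the variance, as the covariance of the signal noise is only
    known through a bound on its eigenvalues. *)
Definition subgaussian Z v := measurable_fun setT Z /\ forall theta : R,
  (\int[P]_w (expR (theta * Z w))%:E <= (expR (theta ^+ 2 * v / 2))%:E)%E.

Lemma subgaussian_lincomb (I : choiceType) (X : I -> {RV P >-> R}) (r : seq I)
    (a : I -> R) v : iid_std_normal X -> uniq r -> \sum_(i <- r) a i ^+ 2 <= v ->
  subgaussian (fun w => \sum_(i <- r) a i * X i w) v.
Proof.
move=> iX ur av; split; first by apply: measurable_sum => i; exact: measurable_funM.
move=> theta; under eq_integral do rewrite mulr_sumr.
under eq_integral do (under eq_bigr do rewrite mulrA).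
rewrite (@iid_normal_mgf _ _ _ _ _ X r (fun i => theta * a i))//.
rewrite lee_fin ler_expR ler_pM2r//; under eq_bigr do rewrite exprMn.
by rewrite -mulr_sumr ler_wpM2l// sqr_ge0.
Qed.

(** A smooth majorant of [exp |z|] whose expectation is computed from the moment
    generating function. *)
Definition cosh2 (z : R) : R := expR z + expR (- z).

Lemma cosh2_ge0 z : 0 <= cosh2 z. Proof. by rewrite addr_ge0 ?expR_ge0. Qed.

Lemma expR_norm_le_cosh2 z : expR `|z| <= cosh2 z.
Proof.
rewrite /cosh2; have [z0|z0] := leP 0 z.
  by rewrite ger0_norm// lerDl expR_ge0.
by rewrite ltr0_norm// lerDr expR_ge0.
Qed.

Lemma sqr_le_cosh2 z : z ^+ 2 / 2 <= cosh2 z.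
Proof.
apply: le_trans (expR_norm_le_cosh2 z).
by apply: le_trans (expR_ge1Dxn 1 (normr_ge0 z)); rewrite real_normK ?num_real// lerDr.
Qed.

(** Bundles an expectation bound with the measurability and the sign which make
    such bounds stable by sum and by scaling. *)
Definition mean_le Z (A : R) := [/\ measurable_fun setT Z, (forall w, 0 <= Z w) &
  (\int[P]_w (Z w)%:E <= A%:E)%E].

Lemma mean_leD Z Y (A B : R) : mean_le Z A -> mean_le Y B ->
  mean_le (fun w => Z w + Y w) (A + B).
Proof.
move=> [mZ Z0 ZA] [mY Y0 YB]; split; first exact: measurable_funD.
  by move=> w; rewrite addr_ge0.
under eq_integral do rewrite EFinD.
have Z0' w : [set: Om] w -> (0 <= (Z w)%:E)%E by rewrite lee_fin.
have Y0' w : [set: Om] w -> (0 <= (Y w)%:E)%E by rewrite lee_fin.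
rewrite (ge0_integralD _ _ Z0' _ Y0')//; [|exact/measurable_EFinP..].
by rewrite EFinD leeD.
Qed.

Lemma mean_leZ Z (c A : R) : 0 <= c -> mean_le Z A -> mean_le (fun w => c * Z w) (c * A).
Proof.
move=> c0 [mZ Z0 ZA]; split; first exact: measurable_funM.
  by move=> w; rewrite mulr_ge0.
under eq_integral do rewrite EFinM.
have Z0' w : [set: Om] w -> (0 <= (Z w)%:E)%E by rewrite lee_fin.
have mZ' : measurable_fun setT (EFin \o Z) by exact/measurable_EFinP.
by rewrite ge0_integralZl// EFinM lee_wpmul2l// lee_fin.
Qed.

Lemma mean_le_sum (J : Type) (s : seq J) (Z : J -> Om -> R) (A : J -> R) :
  (forall j, mean_le (Z j) (A j)) ->
  mean_le (fun w => \sum_(j <- s) Z j w) (\sum_(j <- s) A j).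
Proof.
move=> H; elim: s => [|j s IH].
  rewrite big_nil; under eq_fun do rewrite big_nil.
  by split => //; rewrite integral0.
by rewrite big_cons; under eq_fun do rewrite big_cons; exact: mean_leD.
Qed.

Lemma mean_le_sum_const (J : finType) (Z : J -> Om -> R) (A : R) :
  (forall j, mean_le (Z j) A) -> mean_le (fun w => \sum_j Z j w) (#|J|%:R * A).
Proof. by move=> H; rewrite mulr_natl -sumr_const; exact: mean_le_sum. Qed.

Lemma subgaussian_cosh2 Z v (theta : R) : subgaussian Z v ->
  mean_le (fun w => cosh2 (theta * Z w)) (2 * expR (theta ^+ 2 * v / 2)).
Proof.
move=> [mZ HZ]; rewrite mulr_natl mulr2n.
have H t : mean_le (fun w => expR (t * Z w)) (expR (t ^+ 2 * v / 2)).
  split; [|by move=> w; exact: expR_ge0|exact: HZ].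
  by apply: measurableT_comp => //; exact: measurable_funM.
have := mean_leD (H theta) (H (- theta)); rewrite sqrrN.
by under eq_fun do rewrite mulNr.
Qed.

(** Bound on the expectation of an affine function of the [|Y k|] over the event
    that some [|Z j|] exceeds [r] standard deviations. The indicator of this event
    is majorised by a sum [I] of Chernoff weights of expectation [exp (- r^2 / 2)];
    on it, [|Y|] is at most [a I + Y^2 / a], which decouples [Y] from the event
    for any joint law of [Z] and [Y]. The parameter [a] is to be taken between 1 and
    [exp (r^2 / 2)]. *)
Lemma excess (J J2 : finType) (Z : J -> Om -> R) (Y : J2 -> Om -> R)
    (sigma sigma' r a c0 c1 : R) :
  0 < sigma -> 0 < sigma' -> 0 <= r -> 0 < a -> 0 <= c0 -> 0 <= c1 ->
  (forall j, subgaussian (Z j) (sigma ^+ 2)) ->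
  (forall k, subgaussian (Y k) (sigma' ^+ 2)) ->
  exists2 X : Om -> R,
    mean_le X (c0 * (#|J|%:R * (2 * expR (- r ^+ 2 / 2))) +
        c1 * (#|J2|%:R * (sigma' * (a * (#|J|%:R * (2 * expR (- r ^+ 2 / 2))) +
           a^-1 * (2 * expR 2^-1))))) &
    forall w, (forall j, `|Z j w| <= r * sigma) \/
              c0 + c1 * \sum_k `|Y k w| <= X w.
Proof.
move=> s0 s0' r0 a0 c00 c10 HZ HY.
pose I w := \sum_j expR (- r ^+ 2) * cosh2 (r / sigma * Z j w).
have mI : mean_le I (#|J|%:R * (2 * expR (- r ^+ 2 / 2))).
  apply: mean_le_sum_const => j.
  have := mean_leZ (expR_ge0 (- r ^+ 2)) (subgaussian_cosh2 (r / sigma) (HZ j)).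
  rewrite mulrCA -expRD; congr (mean_le _ (_ * expR _)).
  by field; rewrite gt_eqF.
have [_ I0 _] := mI.
exists (fun w => c0 * I w +
    c1 * \sum_k (sigma' * (a * I w + a^-1 * cosh2 (sigma'^-1 * Y k w)))).
  apply: mean_leD; apply: mean_leZ => //; apply: mean_le_sum_const => k.
  apply: mean_leZ; first exact: ltW.
  apply: mean_leD; apply: mean_leZ; rewrite ?invr_ge0 ?(ltW a0)//.
  have := subgaussian_cosh2 sigma'^-1 (HY k).
  by rewrite -exprMn mulVf ?gt_eqF// expr1n div1r.
move=> w; have [I1|I1] := leP 1 (I w).
  right; rewrite lerD//; first by rewrite ler_peMr.
  rewrite ler_wpM2l//; apply: ler_sum => k _.
  have -> : `|Y k w| = sigma' * `|sigma'^-1 * Y k w|.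
    by rewrite normrM gtr0_norm ?invr_gt0// mulrA divff ?mul1r// gt_eqF.
  rewrite ler_pM2l//; set t := sigma'^-1 * _.
  have := sqr_le_cosh2 t; rewrite -(@real_normK _ t) ?num_real// => H.
  apply: le_trans (_ : a + a^-1 * (`|t| ^+ 2 / 2) <= _); last first.
    by rewrite lerD// ?ler_wpM2l ?invr_ge0 ?(ltW a0)// ler_peMr// ltW.
  rewrite -subr_ge0 [X in 0 <= X](_ : _ =
     a^-1 / 2 * ((`|t| - a) ^+ 2 + a ^+ 2)); last by field; rewrite gt_eqF.
  by rewrite mulr_ge0 ?divr_ge0 ?invr_ge0 ?(ltW a0)// addr_ge0 ?sqr_ge0.
(* A single excess makes its own Chernoff weight at least 1. *)
left=> j; rewrite leNgt; apply/negP => Zj; move: I1; rewrite ltNge => /negP; apply.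
rewrite /I (bigD1 j)//= -[leLHS]addr0 lerD//; last first.
  by apply: sumr_ge0 => k _; rewrite mulr_ge0 ?expR_ge0 ?cosh2_ge0.
apply: le_trans (_ : expR (- r ^+ 2) * expR (r ^+ 2) <= _).
  by rewrite -expRD addNr expR0.
rewrite ler_wpM2l ?expR_ge0//; apply: le_trans (expR_norm_le_cosh2 _).
rewrite ler_expR normrM ger0_norm ?divr_ge0 ?(ltW s0)// expr2 -mulrA ler_wpM2l//.
by rewrite ler_pdivlMl// mulrC ltW.
Qed.

End subgaussian.

(** * The observation model *)

Section observation_model.
Context {R : realType}.
Implicit Types (f g : R -> R) (l n : nat).

Lemma Kmat_unit g l : lcoef g 0 != 0 -> Kmat g l \in unitmx.
Proof.
move=> g0; rewrite unitmxE det_trig.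
  by rewrite unitfE; apply/prodf_neq0 => i _; rewrite mxE leqnn subnn.
by apply/is_trig_mxP => i j ij; rewrite mxE leqNgt ij.
Qed.

Lemma lvec_abs_sum f l :
  \sum_i `|lvec f l i ord0| = \sum_(0 <= k < l.+1) `|lcoef f k|.
Proof. by rewrite big_mkord; apply: eq_bigr => i _; rewrite mxE. Qed.

Lemma toeplitz_le l (b : nat -> R) i j :
  `|toeplitz l b i j| <= \sum_(k < l.+1) `|b k|.
Proof.
rewrite mxE; case: ifP => ij; last by rewrite normr0 sumr_ge0.
have il : (i - j < l.+1)%N by apply: leq_ltn_trans (leq_subr _ _) (ltn_ord i).
by rewrite (bigD1 (Ordinal il))//= lerDl sumr_ge0.
Qed.

(** Each [b m] is met at most once, with coefficients read off a shifted row of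
    [A]: hence the variance of an entry is at most the square of the length of a
    row, with no loss due to the dimension. *)
Lemma mulmx_toeplitz_lincomb l (A : 'M[R]_l.+1) (b : nat -> R) i j :
  (A *m toeplitz l b) i j =
  \sum_(m <- index_iota 0 (l.+1 - j)) A i (inord (m + j)) * b m.
Proof.
rewrite mxE; transitivity (\sum_(0 <= k < l.+1)
    (if (j <= k)%N then A i (inord k) * b (k - j)%N else 0)).
  rewrite big_mkord; apply: eq_bigr => k _; rewrite mxE inord_val.
  by case: ifP => _; rewrite ?mulr0.
rewrite (@big_cat_nat _ _ _ j)//=; last exact: ltnW.
rewrite big_nat_cond big1 ?add0r; last first.
  by move=> k /andP[/andP[_ kj] _]; rewrite leqNgt kj.
rewrite -{1}[j : nat]add0n big_addn; apply: eq_bigr => k _.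
by rewrite leq_addl addnK.
Qed.

Lemma shifted_row_le l (A : 'M[R]_l.+1) i (j : 'I_l.+1) :
  \sum_(m <- index_iota 0 (l.+1 - j)) A i (inord (m + j)) ^+ 2 <= \sum_k A i k ^+ 2.
Proof.
have -> : \sum_k A i k ^+ 2 = \sum_(0 <= k < l.+1) A i (inord k) ^+ 2.
  by rewrite big_mkord; apply: eq_bigr => k _; rewrite inord_val.
rewrite [leRHS](@big_cat_nat _ _ _ j)//=; last exact: ltnW.
rewrite [X in _ <= _ + X](_ : _ =
    \sum_(0 <= m < l.+1 - j) A i (inord (m + j)) ^+ 2); last first.
  by rewrite -{1}[j : nat]add0n big_addn.
rewrite lerDr.
by apply: sumr_ge0 => k _; exact: sqr_ge0.
Qed.

(** A square root of [Omega], in the sense of [noise_mx_cov]. *)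
Definition noise_mx n (T : R) (t : 'I_n -> R) l : 'M[R]_(l.+1, n) :=
  Num.sqrt (n%:R / T) *: (invmx (gram t l) *m (Phi t l)^T).

Lemma signal_noiseE n (T : R) (t : 'I_n -> R) e l :
  signal_noise T t e l = noise_mx T t l *m e.
Proof. by rewrite /signal_noise /noise_mx -scalemxAl. Qed.

Lemma noise_mx_cov n (T : R) (t : 'I_n -> R) l : 0 <= n%:R / T ->
  gram t l \in unitmx -> noise_mx T t l *m (noise_mx T t l)^T = Omega T t l.
Proof.
move=> nT Gu; rewrite /noise_mx /Omega linearZ/= -scalemxAl -scalemxAr scalerA.
rewrite -expr2 sqr_sqrtr//; congr (_ *: _).
have GT : (gram t l)^T = gram t l by rewrite /gram trmx_mul trmxK.
by rewrite trmx_mul trmxK trmx_inv GT -mulmxA (mulmxA (Phi t l)^T) -/(gram t l) mulmxV// mulmx1.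
Qed.

(** The eigenvalues of [Omega] bound the variance of every linear form of the
    signal noise. *)
Lemma noise_form_le n (T : R) (t : 'I_n -> R) l (C : R) : 0 <= n%:R / T ->
  gram t l \in unitmx -> (forall a, eigenvalue (Omega T t l) a -> a <= C) ->
  forall m (A : 'M[R]_(m, l.+1)) i,
  \sum_j (A *m noise_mx T t l) i j ^+ 2 <= C * \sum_k A i k ^+ 2.
Proof.
move=> nT Gu HC m A i.
have := @eigenvalue_bound _ _ _ (noise_mx T t l) C _ (\col_k A i k).
rewrite noise_mx_cov// => /(_ HC); rewrite !sqr_euclid.
have -> : dot (\col_k A i k) (\col_k A i k) = \sum_k A i k ^+ 2.
  by apply: eq_bigr => k _; rewrite !mxE expr2.
suff -> : (noise_mx T t l)^T *m (\col_k A i k) = \col_j (A *m noise_mx T t l) i j.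
  rewrite /dot; under eq_bigr do rewrite mxE -expr2.
  by [].
apply/matrixP => j k; rewrite !mxE; apply: eq_bigr => q _.
by rewrite [X in X * _]mxE [X in _ * X]mxE mulrC.
Qed.

Section cases.
Variables (f g : R -> R) (l n : nat) (T : R) (t : 'I_n -> R).
Variables (kappa S delta eps F1 m ne : R) (b : nat -> R) (e : 'cV[R]_n).
Hypotheses (Ku : Kmat g l \in unitmx) (delta0 : 0 < delta <= 1) (eps0 : 0 < eps <= 1).
Hypothesis F1P : \sum_(0 <= k < l.+1) `|lcoef f k| <= F1.
Let z := coef_estimator kappa delta (obs_operator g delta b l)
  (obs_signal f g eps T t e l).
Let H := invmx (Kmat g l) *m toeplitz l b.
Let X := invmx (Kmat g l) *m signal_noise T t e l.
Hypothesis S_ge0 : 0 <= S.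
Hypothesis stable : l.+1%:R * (delta * m) <= 1 / 2.
Hypothesis opnorm_lt : 2 * opnorm (invmx (Kmat g l)) < (op_threshold kappa delta l)^-1.
Hypothesis drift_le : 2 * (delta * (m * F1)) <= S / 4.
Hypothesis noise_le : 2 * (eps * ne) <= S / 4.
Hypothesis op_threshold_ge : (op_threshold kappa delta l)^-1 <= delta^-1.

Let F1P' : \sum_i `|lvec f l i ord0| <= F1.
Proof. by rewrite lvec_abs_sum. Qed.

Let F1F i : `|lvec f l i ord0| <= F1.
Proof.
by apply: le_trans F1P'; rewrite (bigD1 i)//= lerDl sumr_ge0.
Qed.

Let d0 : 0 < delta. Proof. by case/andP: delta0. Qed.
Let e0 : 0 <= eps. Proof. by case/andP: eps0 => /ltW. Qed.

Let lvec_max : lvec f l ord_max ord0 = lcoef f l.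
Proof. by rewrite mxE. Qed.

Let good_error (c : R) : (forall i j, `|H i j| <= m) -> (forall i, `|X i ord0| <= c) ->
  `|z - lcoef f l| <= 2 * (delta * (m * F1) + eps * c).
Proof.
move=> Hm Xc; rewrite /z /coef_estimator.
have Kdu := perturbed_unit Ku d0 Hm stable.
have opK := perturbed_opnorm Ku d0 Hm stable.
rewrite ifT; last by apply/andP; split; [exact: Kdu|exact: le_lt_trans opK opnorm_lt].
rewrite -lvec_max.
exact: (perturbed_error Ku d0 e0 F1P' Hm stable Xc).
Qed.

Let min0 : 0 <= Num.min `|lcoef f l| (3 / 2 * S).
Proof. by rewrite le_min normr_ge0 mulr_ge0. Qed.

(** Both noises are moderate: the error is at most half a threshold, a quarter
    from the operator noise and a quarter from the signal noise. *)
Lemma level_good : (forall i j, `|H i j| <= m) -> (forall i, `|X i ord0| <= ne) ->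
  `|thresholded S z - lcoef f l| <= Num.min `|lcoef f l| (3 / 2 * S).
Proof.
move=> Hm Xn; apply: thresholded_close; apply: le_trans (good_error Hm Xn) _.
apply: le_trans (_ : S / 4 + S / 4 <= _); last by lra.
by rewrite mulrDr lerD.
Qed.

(** The operator noise alone is moderate, so that inversion is still stable and the
    error is linear in [X]. *)
Lemma level_bad_signal : (forall i j, `|H i j| <= m) ->
  `|thresholded S z - lcoef f l| <= Num.min `|lcoef f l| (3 / 2 * S) +
     ((F1 + S) + 2 * \sum_i `|X i ord0|).
Proof.
move=> Hm; apply: le_trans (thresholded_le _ _ _) _; rewrite -[leLHS]add0r lerD//.
have Xc i : `|X i ord0| <= \sum_i `|X i ord0|.
  by rewrite (bigD1 i)//= lerDl sumr_ge0.
have := good_error Hm Xc; rewrite mulrDr; have := F1F ord_max; rewrite lvec_max.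
move: drift_le; set D := 2 * (delta * (m * F1)).
have : eps * \sum_i `|X i ord0| <= \sum_i `|X i ord0|.
  by rewrite ler_piMl ?sumr_ge0//; case/andP: eps0.
set Y := \sum_i `|X i ord0|; set W := eps * Y; have := S_ge0; lra.
Qed.

(** Nothing is known of [H]: the cut-off on the norm of the inverse gives a factor
    [delta^-1], to be absorbed by the probability of this case. *)
Lemma level_bad_operator :
  `|thresholded S z - lcoef f l| <= Num.min `|lcoef f l| (3 / 2 * S) +
     ((2 * F1 + l.+1%:R * F1 * \sum_(k < l.+1) `|b k|) +
      delta^-1 * \sum_i `|signal_noise T t e l i ord0|).
Proof.
apply: le_trans (thresholded_le _ _ _) _; rewrite -[leLHS]add0r lerD//.
have := @crude_error _ _ (Kmat g l) (toeplitz l b) (lvec f l) (signal_noise T t e l)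
  delta eps F1 d0 e0 F1P' kappa F1F (\sum_(k < l.+1) `|b k|) delta^-1
  (fun i j => toeplitz_le b i j) _ op_threshold_ge.
rewrite invr_ge0 (ltW d0) lvec_max => /(_ isT).
rewrite -/z mulrDr mulrA mulVf ?gt_eqF// mul1r.
have := F1F ord_max; rewrite lvec_max.
set xs := \sum_i `|signal_noise T t e l i ord0|; set bs := \sum_(k < l.+1) _.
have : delta^-1 * (eps * xs) <= delta^-1 * xs.
  rewrite ler_wpM2l ?invr_ge0 ?(ltW d0)// ler_piMl ?sumr_ge0//; by case/andP: eps0.
have -> : l.+1%:R * (bs * F1) = l.+1%:R * F1 * bs by ring.
lra.
Qed.

End cases.
End observation_model.

Section level_excess.
Context d (Om : measurableType d) (R : realType) (P : probability Om R).

(** A random majorant of the loss at one level: besides the oracle loss, it only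
    charges the improbable events. [rd] and [re] are the numbers of standard
    deviations allowed to the operator and to the signal noise, [kd] and [ke] the
    resulting bounds on the probabilities of an excess, [ad] and [ae] the free
    parameters of [excess]. *)
Lemma level_excess (b : nat -> {RV P >-> R}) (n : nat) (eta : 'I_n -> {RV P >-> R})
    (f g : R -> R) (l : nat) (T : R) (t : 'I_n -> R)
    (kappa S delta eps F1 A1 C1 rd re ad ae : R) :
  iid_std_normal b -> iid_std_normal eta ->
  Kmat g l \in unitmx -> 0 < delta <= 1 -> 0 < eps <= 1 ->
  \sum_(0 <= k < l.+1) `|lcoef f k| <= F1 -> 0 <= S ->
  opnorm (invmx (Kmat g l)) <= A1 -> 0 < A1 -> 0 < C1 ->
  0 <= n%:R / T -> gram t l \in unitmx ->
  (forall a, eigenvalue (Omega T t l) a -> a <= C1 ^+ 2) ->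
  0 <= rd -> 0 <= re -> 0 < ad -> 0 < ae ->
  l.+1%:R * (delta * (rd * A1)) <= 1 / 2 ->
  2 * opnorm (invmx (Kmat g l)) < (op_threshold kappa delta l)^-1 ->
  2 * (delta * (rd * A1 * F1)) <= S / 4 ->
  2 * (eps * (re * (A1 * C1))) <= S / 4 ->
  (op_threshold kappa delta l)^-1 <= delta^-1 ->
  let N1 : R := l.+1%:R in
  let kd := N1 * N1 * (2 * expR (- rd ^+ 2 / 2)) in
  let ke := N1 * (2 * expR (- re ^+ 2 / 2)) in
  exists2 X : Om -> R,
    mean_le P X
     (2 * F1 * kd + N1 * F1 * (N1 * (ad * kd + ad^-1 * (2 * expR 2^-1))) +
      delta^-1 * (N1 * (C1 * (ad * kd + ad^-1 * (2 * expR 2^-1)))) +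
      ((F1 + S) * ke + 2 * (N1 * (A1 * C1 * (ae * ke + ae^-1 * (2 * expR 2^-1)))))) &
    forall w, `|thresholded S (coef_estimator kappa delta
        (obs_operator g delta (fun k => b k w) l)
        (obs_signal f g eps T t (\col_i eta i w) l)) - lcoef f l| <=
      Num.min `|lcoef f l| (3 / 2 * S) + X w.
Proof.
move=> ib ie Ku delta0 eps0 F1P S0 opA A10 C10 nT Gu HC rd0 re0 ad0 ae0
  stable op_lt drift noise opth N1 kd ke.
have d0 : 0 < delta by case/andP: delta0.
have F10 : 0 <= F1 by apply: le_trans F1P; exact: sumr_ge0.
pose A := invmx (Kmat g l).
have rowA i : \sum_k A i k ^+ 2 <= A1 ^+ 2 by exact: row_le_opnorm.
pose H (ij : 'I_l.+1 * 'I_l.+1) w := (A *m toeplitz l (fun k => b k w)) ij.1 ij.2.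
have sH ij : subgaussian P (H ij) (A1 ^+ 2).
  rewrite /H; under eq_fun do rewrite mulmx_toeplitz_lincomb.
  apply: subgaussian_lincomb => //; first exact: iota_uniq.
  exact: le_trans (shifted_row_le _ _ _) (rowA _).
have sb (k : 'I_l.+1) : subgaussian P (b k) (1 ^+ 2).
  have := @subgaussian_lincomb _ _ _ P _ b [:: k : nat] (fun=> 1) (1 ^+ 2) ib isT.
  rewrite big_seq1 lexx => /(_ isT).
  by under eq_fun do rewrite big_seq1 mul1r.
pose W := noise_mx T t l.
have formE m (B : 'M[R]_(m, l.+1)) i w :
    (B *m signal_noise T t (\col_i eta i w) l) i ord0 =
    \sum_(j <- index_enum 'I_n) (B *m W) i j * eta j w.
  rewrite signal_noiseE mulmxA mxE; apply: eq_bigr => j _; rewrite [X in _ * X = _]mxE. done.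
pose X i w := (A *m signal_noise T t (\col_i eta i w) l) i ord0.
have sX i : subgaussian P (X i) ((A1 * C1) ^+ 2).
  rewrite /X; under eq_fun do rewrite formE.
  apply: subgaussian_lincomb => //; first exact: index_enum_uniq.
  apply: le_trans (noise_form_le nT Gu HC _ _) _.
  by rewrite exprMn mulrC ler_wpM2r// sqr_ge0.
pose xi i w := (1%:M *m signal_noise T t (\col_i eta i w) l) i ord0.
have sxi i : subgaussian P (xi i) (C1 ^+ 2).
  rewrite /xi; under eq_fun do rewrite formE.
  apply: subgaussian_lincomb => //; first exact: index_enum_uniq.
  apply: le_trans (noise_form_le nT Gu HC _ _) _.
  rewrite -[leRHS]mulr1 ler_wpM2l ?sqr_ge0// (bigD1 i)//= mxE eqxx expr1n big1 ?addr0//.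
  by move=> k /negbTE ki; rewrite mxE eq_sym ki expr0n.
have AC0 : 0 < A1 * C1 by exact: mulr_gt0.
have c20 : 0 <= 2 * F1 by rewrite mulr_ge0.
have cN0 : 0 <= N1 * F1 by rewrite mulr_ge0.
have cd0 : 0 <= delta^-1 by rewrite invr_ge0 ltW.
have cS0 : 0 <= F1 + S by rewrite addr_ge0.
have [X1 mX1 HX1] := excess A10 ltr01 rd0 ad0 c20 cN0 sH sb.
have [X2 mX2 HX2] := excess A10 C10 rd0 ad0 (lexx 0) cd0 sH sxi.
have [X3 mX3 HX3] := excess AC0 AC0 re0 ae0 cS0 (ler0n R 2) sX sX.
rewrite card_prod !card_ord natrM -/N1 in mX1 mX2 mX3.
rewrite !mul1r mul0r add0r -/kd -/ke in mX1 mX2 mX3.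
exists (fun w => X1 w + X2 w + X3 w).
  by apply: mean_leD => //; apply: mean_leD.
move=> w.
have [_ X10 _] := mX1; have [_ X20 _] := mX2; have [_ X30 _] := mX3.
have xiE : \sum_i `|xi i w| = \sum_i `|signal_noise T t (\col_i eta i w) l i ord0|.
  by apply: eq_bigr => i _; rewrite /xi mul1mx.
have good_case : (forall ij, `|H ij w| <= rd * A1) ->
    `|thresholded S (coef_estimator kappa delta
        (obs_operator g delta (fun k => b k w) l)
        (obs_signal f g eps T t (\col_i eta i w) l)) - lcoef f l| <=
      Num.min `|lcoef f l| (3 / 2 * S) + (X1 w + X2 w + X3 w).
  move=> Hgood; have Hm i j : `|(invmx (Kmat g l) *m toeplitz l (fun k => b k w)) i j| <= rd * A1.
    exact: (Hgood (i, j)).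
  have [Hx|H3] := HX3 w.
    apply: le_trans (level_good Ku delta0 eps0 F1P stable op_lt drift noise Hm Hx) _.
    by rewrite lerDl !addr_ge0.
  apply: le_trans (level_bad_signal T t _ Ku delta0 eps0 F1P S0 stable op_lt drift Hm) _.
  by rewrite lerD2l; apply: le_trans H3 _; rewrite lerDr addr_ge0.
have [/good_case//|H1] := HX1 w; have [/good_case//|H2] := HX2 w.
apply: le_trans (level_bad_operator g T t (fun k => b k w) _ delta0 eps0 F1P S0 opth) _.
rewrite lerD2l -[leLHS]addr0 lerD// lerD//.
by rewrite -xiE; move: H2; rewrite add0r.
Qed.

End level_excess.

(** * Numerical estimates *)

Section assembly.
Context {R : realType}.

(** The integral of a nonnegative function is the supremum of those of the simple
    functions below it, hence it is monotone. So the measurable majorant [G] bounds the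
    expectation of the loss [F] without a study of the measurability of the
    estimator. *)
Lemma integral_le_mean d (Om : measurableType d) (P : probability Om R)
    (F : Om -> \bar R) (G : Om -> R) (A : R) : (forall w, 0 <= F w)%E ->
  (forall w, F w <= (G w)%:E)%E -> mean_le P G A -> (\int[P]_w F w <= A%:E)%E.
Proof.
move=> F0 FG [mG G0]; apply: le_trans.
have G0' w : (0 <= (G w)%:E)%E by rewrite lee_fin.
rewrite !ge0_integralTE//; apply: ereal_sup_le => _ [h /= hF <-].
by exists h => // w; exact: le_trans (hF w) (FG w).
Qed.

Lemma mean_le_cst d (Om : measurableType d) (P : probability Om R) (c : R) :
  0 <= c -> mean_le P (fun=> c) c.
Proof.
move=> c0; split=> //; rewrite integral_cst//.
by rewrite [X in (_ * X)%E](_ : _ = 1%E) ?mule1//; exact: probability_setT.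
Qed.

(** At [6 sqrt |ln x|] standard deviations an excess has a probability of order
    [x^18], enough to pay for the norm of the inverse and for the dimensions, which
    are powers of [1 / x]. *)
Lemma expR_pow_log (x : R) : 0 < x < 1 ->
  expR (- (6 * Num.sqrt `|ln x|) ^+ 2 / 2) = x ^+ 18.
Proof.
move=> /andP[x0 x1]; rewrite exprMn sqr_sqrtr// ltr0_norm; last by rewrite ln_lt0 ?x0.
rewrite -[in RHS](lnK x0) -expRM_natl; congr expR; field.
by [].
Qed.

Lemma mul_log_le (x : R) : 0 < x < 1 -> x * `|ln x| <= 2 * Num.sqrt x.
Proof.
move=> /andP[x0 x1]; rewrite ltr0_norm ?ln_lt0 ?x0//.
have s0 : 0 < Num.sqrt x by rewrite sqrtr_gt0.
have xE : x = Num.sqrt x * Num.sqrt x by rewrite -expr2 sqr_sqrtr// ltW.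
have := ln_sublinear (_ : 0 < (Num.sqrt x)^-1); rewrite invr_gt0 => /(_ s0).
rewrite lnV ?posrE// => /ltW H.
have h : Num.sqrt x * - ln (Num.sqrt x) <= 1.
  by rewrite -(@divff _ (Num.sqrt x)) ?gt_eqF// ler_wpM2l// ltW.
have -> : x * - ln x = 2 * Num.sqrt x * (Num.sqrt x * - ln (Num.sqrt x)).
  by rewrite {1 2}xE lnM ?posrE//; ring.
by rewrite ler_piMr// mulr_ge0// ltW.
Qed.

Lemma sqrt_log_ge (x G0 : R) : 0 <= G0 -> 0 < x -> x <= expR (- G0 ^+ 2) ->
  G0 <= Num.sqrt `|ln x|.
Proof.
move=> G00 x0 xG; rewrite -[leLHS]ger0_norm// -sqrtr_sqr; apply: ler_wsqrtr.
have : ln x <= - G0 ^+ 2 by rewrite -[leRHS]expRK ler_ln// posrE expR_gt0.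
have := ler_norm (- ln x); rewrite normrN; lra.
Qed.

Lemma ln_nat_le (l : nat) : ln (maxn l 2)%:R <= (maxn l 1)%:R :> R.
Proof.
have [l2|l2] := leqP 2 l.
  rewrite (maxn_idPl (ltnW l2)).
  by apply: ltW; apply: ln_sublinear; rewrite ltr0n; apply: leq_trans l2.
rewrite (_ : maxn l 1 = 1)%N; last by apply/maxn_idPr.
rewrite (_ : 2%:R = 1 + 1 :> R)//; apply: le_ln1Dx; lra.
Qed.

(** The exponent of the maximal level is chosen for this: up to it, the thresholds
    stay bounded even after multiplication by the dimension. *)
Lemma level_power (x nu lambda u : R) : 0 <= nu -> 0 < lambda -> 0 < u -> 0 < x ->
  x <= lambda * u `^ (- (nu + 1)^-1) -> x `^ nu * x * u <= lambda `^ (nu + 1).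
Proof.
move=> nu0 l0 u0 x0 xL.
have n1 : 0 < nu + 1 by lra.
have -> : x `^ nu * x = x `^ (nu + 1).
  by rewrite -{2}(powRr1 (ltW x0)) -powRD//; apply/implyP => _; rewrite gt_eqF.
have : x `^ (nu + 1) <= (lambda * u `^ (- (nu + 1)^-1)) `^ (nu + 1).
  apply: ge0_ler_powR; rewrite ?nnegrE ?(ltW n1) ?(ltW x0)//.
  by rewrite mulr_ge0 ?powR_ge0 ?(ltW l0).
rewrite powRM ?powR_ge0 ?(ltW l0)// -powRrM mulNr mulVf ?gt_eqF// powR_inv1 ?(ltW u0)//.
by rewrite -ler_pdivlMr.
Qed.

Lemma max_level_mul_le (lambda nu u : R) : 0 < lambda -> 0 <= nu -> 0 < u <= 1 ->
  lambda * u `^ (- (nu + 1)^-1) * u <= lambda.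
Proof.
move=> l0 nu0 /andP[u0 u1]; rewrite -[leRHS]mulr1 -mulrA ler_pM2l//.
rewrite -{2}(powRr1 (ltW u0)) -powRD; last by apply/implyP => _; rewrite gt_eqF.
rewrite -[leRHS](powRr0 u); apply: ger_powR; first by rewrite u0 u1.
have : (nu + 1)^-1 <= 1 by rewrite invf_le1; lra.
lra.
Qed.

Lemma max_level_ge1 (lambda nu u : R) : 0 < lambda -> 0 <= nu -> 0 < u ->
  u <= lambda `^ (nu + 1) -> 1 <= lambda * u `^ (- (nu + 1)^-1).
Proof.
move=> l0 nu0 u0 uL; have n1 : 0 < nu + 1 by lra.
rewrite powRN -ler_pdivrMr ?invr_gt0 ?powR_gt0// invrK mul1r.
have -> : lambda = (lambda `^ (nu + 1)) `^ ((nu + 1)^-1).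
  by rewrite -powRrM divff ?gt_eqF// powRr1// ltW.
apply: ge0_ler_powR; rewrite ?nnegrE ?powR_ge0 ?(ltW u0)//.
by rewrite invr_ge0 ltW.
Qed.

(** With [ad = delta^-9], the two terms of [excess] have order [delta^9] up to
    powers of the dimension [N1], which are then paired with powers of [delta] as
    [N1 delta] is bounded up to the maximal level. *)
Lemma excess_operator_le (N1 F1 C1 delta e0 : R) :
  1 <= N1 -> 0 <= F1 -> 0 <= C1 -> 0 < delta <= 1 -> 0 <= e0 ->
  forall kd ad, kd = N1 * N1 * (2 * delta ^+ 18) -> ad = (delta ^+ 9)^-1 ->
  2 * F1 * kd + N1 * F1 * (N1 * (ad * kd + ad^-1 * e0)) +
  delta^-1 * (N1 * (C1 * (ad * kd + ad^-1 * e0))) <=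
  (N1 * delta) ^+ 4 * delta ^+ 4 * (4 * F1 + (F1 + C1) * (2 + e0)).
Proof.
move=> N11 F10 C10 /andP[d0 d1] e00 kd ad kdE adE.
have dn0 : delta != 0 by rewrite gt_eqF.
have -> : ad * kd + ad^-1 * e0 = delta ^+ 9 * (N1 * N1 * 2 + e0).
  by rewrite adE kdE; field.
have q1 : N1 * N1 * 2 + e0 <= N1 * N1 * (2 + e0).
  have NN : 1 <= N1 * N1 by nra.
  have : e0 <= N1 * N1 * e0 by rewrite ler_peMl.
  lra.
have N0 : 0 <= N1 by lra.
set E := 2 + e0 in q1 *; have E0 : 0 <= E by rewrite addr_ge0.
have d8 n : 0 <= delta ^+ n by rewrite exprn_ge0// ltW.
have d98 : delta ^+ 9 <= delta ^+ 8 by rewrite exprSr ler_piMr.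
have d188 : delta ^+ 18 <= delta ^+ 8.
  by rewrite (_ : 18 = 8 + 10)%N// exprD ler_piMr// exprn_ile1// ltW.
have N24 : N1 * N1 <= N1 ^+ 4.
  rewrite (_ : 4 = 2 + 2)%N// exprD -expr2 ler_peMr ?exprn_ge0// expr2.
  by rewrite -[leLHS]mulr1 ler_pM.
have N34 : N1 * (N1 * N1) <= N1 ^+ 4.
  by rewrite (_ : N1 * (N1 * N1) = N1 ^+ 3)// [leRHS]exprS ler_peMl// exprn_ge0.
have -> : (N1 * delta) ^+ 4 * delta ^+ 4 * (4 * F1 + (F1 + C1) * E) =
  4 * F1 * (N1 ^+ 4 * delta ^+ 8) + F1 * E * (N1 ^+ 4 * delta ^+ 8) +
  C1 * E * (N1 ^+ 4 * delta ^+ 8) by rewrite exprMn; ring.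
apply: lerD; first apply: lerD.
- rewrite (_ : 2 * F1 * kd = 4 * F1 * (N1 * N1 * delta ^+ 18)); last by rewrite kdE; ring.
  by rewrite ler_wpM2l ?mulr_ge0// ler_pM// mulr_ge0.
- apply: le_trans (_ : F1 * (N1 * N1) * (delta ^+ 9 * (N1 * N1 * E)) <= _).
    rewrite [leLHS](_ : _ = F1 * (N1 * N1) * (delta ^+ 9 * (N1 * N1 * 2 + e0))); last by ring.
    by rewrite ler_wpM2l ?mulr_ge0// ler_wpM2l.
  rewrite [leLHS](_ : _ = F1 * E * (N1 ^+ 4 * delta ^+ 9)); last by ring.
  by rewrite ler_wpM2l ?mulr_ge0// ler_wpM2l// exprn_ge0.
- apply: le_trans (_ : delta^-1 * (N1 * (C1 * (delta ^+ 9 * (N1 * N1 * E)))) <= _).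
    rewrite ler_wpM2l ?invr_ge0 ?(ltW d0)// ler_wpM2l// ler_wpM2l// ler_wpM2l//.
  rewrite [leLHS](_ : _ = C1 * E * (N1 * (N1 * N1) * delta ^+ 8)); last by field.
  by rewrite ler_wpM2l ?mulr_ge0// ler_wpM2r.
Qed.

(** The same for the signal noise, where [A1 C1] may grow with the level but only
    in such a way that [A1 C1 eps] stays bounded. *)
Lemma excess_signal_le (N1 F1 S A1 C1 eps e0 B : R) :
  1 <= N1 -> 0 <= F1 -> 0 <= S -> 0 <= A1 -> 0 <= C1 -> 0 < eps <= 1 -> 0 <= e0 ->
  A1 * C1 * eps <= B ->
  forall ke ae, ke = N1 * (2 * eps ^+ 18) -> ae = (eps ^+ 9)^-1 ->
  (F1 + S) * ke + 2 * (N1 * (A1 * C1 * (ae * ke + ae^-1 * e0))) <=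
  (N1 * eps) ^+ 2 * eps ^+ 6 * (2 * (F1 + S) + 2 * B * (2 + e0)).
Proof.
move=> N11 F10 S0 A10 C10 /andP[d0 d1] e00 AB ke ae keE aeE.
have dn0 : eps != 0 by rewrite gt_eqF.
have -> : ae * ke + ae^-1 * e0 = eps ^+ 9 * (N1 * 2 + e0).
  by rewrite aeE keE; field.
have q1 : N1 * 2 + e0 <= N1 * (2 + e0).
  have : e0 <= N1 * e0 by rewrite ler_peMl.
  lra.
have N0 : 0 <= N1 by lra.
set E := 2 + e0 in q1 *; have E0 : 0 <= E by rewrite addr_ge0.
have d8 n : 0 <= eps ^+ n by rewrite exprn_ge0// ltW.
have d188 : eps ^+ 18 <= eps ^+ 8.
  by rewrite (_ : 18 = 8 + 10)%N// exprD ler_piMr// exprn_ile1// ltW.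
have N12 : N1 <= N1 ^+ 2 by rewrite expr2 ler_peMl.
have -> : (N1 * eps) ^+ 2 * eps ^+ 6 * (2 * (F1 + S) + 2 * B * E) =
  2 * (F1 + S) * (N1 ^+ 2 * eps ^+ 8) + 2 * N1 ^+ 2 * E * eps ^+ 8 * B by rewrite exprMn; ring.
apply: lerD.
  rewrite (_ : (F1 + S) * ke = 2 * (F1 + S) * (N1 * eps ^+ 18)); last by rewrite keE; ring.
  by rewrite ler_wpM2l ?mulr_ge0 ?addr_ge0// ler_pM.
apply: le_trans (_ : 2 * (N1 * (A1 * C1 * (eps ^+ 9 * (N1 * E)))) <= _).
  by rewrite ler_wpM2l// ler_wpM2l// ler_wpM2l ?mulr_ge0// ler_wpM2l.
rewrite [leLHS](_ : _ = 2 * N1 ^+ 2 * E * eps ^+ 8 * (A1 * C1 * eps)); last by ring.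
by rewrite ler_wpM2l// mulr_ge0// mulr_ge0// mulr_ge0// exprn_ge0.
Qed.

End assembly.

(** * The risk bound *)

Lemma succ_le_double l : (l.+1 <= 2 * maxn l 1)%N.
Proof. by case: l => [|l]; rewrite // (maxn_idPl _)// mul2n -addnn addnS ltnS leq_addr. Qed.

Section risk_bound.
Context {R : realType}.
Variables (s nu lambda M Q1 F1 C1 kappa ts to : R).
Hypotheses (M0 : 0 <= M) (s12 : 1 / 2 < s) (nu0 : 0 <= nu) (lambda0 : 0 < lambda).
Hypotheses (Q10 : 0 < Q1) (C10 : 0 < C1) (F10 : 0 <= F1).
Hypothesis F1P : forall f, sobolev_ball s M f ->
  forall N, \sum_(0 <= l < N) `|lcoef f l| <= F1.
Hypotheses (kappa1 : 1 <= kappa) (ts1 : 0 <= ts) (to1 : 1 <= to).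
Hypothesis ts_ge : 48 * Q1 * C1 <= ts.

(* [La] bounds the thresholds up to the maximal level, and [e0] the expectation of
   [cosh2] of a standard Gaussian variable. [G0] collects what
   [sqrt |ln delta|] has to exceed: in this order, it makes the perturbed operator
   invertible with room to spare, lets it pass the test on the norm of its inverse,
   brings the drift due to the operator noise below a quarter of the threshold, and
   makes [op_threshold] at least [delta]. [B1] and [B2] are the constants of
   [excess_operator_le] and [excess_signal_le]. *)
Let La := lambda `^ (nu + 1).
Let e0 : R := 2 * expR 2^-1.
Let G0 := 1 + 24 * Q1 * La + 4 * Q1 * kappa * La + 48 * Q1 * F1 + (Num.sqrt (ln 2))^-1.
Let B1 := 4 * F1 + (F1 + C1) * (2 + e0).
Let B2 := 2 * (F1 + (ts + to) * La) + 2 * (Q1 * C1 * La) * (2 + e0).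

Lemma La_gt0 : 0 < La. Proof. exact: powR_gt0. Qed.

Section noise_levels.
Variables (delta eps : R).
Hypotheses (delta0 : 0 < delta < 1) (eps0 : 0 < eps < 1).
Hypothesis Gd : G0 <= Num.sqrt `|ln delta|.
Hypothesis Ge : 1 <= Num.sqrt `|ln eps|.
Let ud := delta * `|ln delta|.
Let ue := eps * Num.sqrt `|ln eps|.
Let u := Num.max ue ud.
Hypotheses (u1 : u <= 1) (uL : u <= La).
Let L := max_level lambda nu eps delta.

Let d0 : 0 < delta. Proof. by case/andP: delta0. Qed.
Let ep0 : 0 < eps. Proof. by case/andP: eps0. Qed.

(** [level_excess] at the level [l], with [6 sqrt |ln delta|] and [6 sqrt |ln eps|]
    standard deviations: its conditions are drawn from [level_power]. The
    constant [ts] has to be large because the deviations of the signal noise are of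
    the very order [eps sqrt |ln eps|] of its threshold, whereas the operator noise
    has a factor [sqrt |ln delta|] to spare, which exceeds [G0]. *)
Lemma one_level_bound d (Om : measurableType d) (P : probability Om R)
    (b : nat -> {RV P >-> R}) n (eta : 'I_n -> {RV P >-> R}) (f g : R -> R) T t l :
  iid_std_normal b -> iid_std_normal eta -> sobolev_ball s M f ->
  lcoef g 0 != 0 -> opnorm (invmx (Kmat g l)) <= Q1 * (maxn l 1)%:R `^ nu ->
  0 <= n%:R / T -> gram t l \in unitmx ->
  (forall a, eigenvalue (Omega T t l) a -> a <= C1 ^+ 2) ->
  l%:R <= L ->
  exists2 X : Om -> R,
    mean_le P X ((2 * lambda) ^+ 4 * B1 * delta ^+ 4 + (2 * lambda) ^+ 2 * B2 * eps ^+ 6) &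
    forall w, `|thresholded (sig_threshold nu ts to eps delta l)
        (coef_estimator kappa delta
        (obs_operator g delta (fun k => b k w) l)
        (obs_signal f g eps T t (\col_i eta i w) l)) - lcoef f l| <=
      Num.min `|lcoef f l| (3 / 2 * sig_threshold nu ts to eps delta l) + X w.
Proof.
move=> ib ie Hf g0 opA nT Gu HC lL.
pose S := sig_threshold nu ts to eps delta l.
pose x : R := (maxn l 1)%:R.
have x1 : 1 <= x by rewrite ler1n leq_max orbT.
have x0 : 0 < x by lra.
have La0 := La_gt0.
pose G := Num.sqrt `|ln delta|; pose H := Num.sqrt `|ln eps|.
have GdG : G0 <= G := Gd; have GeH : 1 <= H := Ge; have kap1 := kappa1; have tto := to1.
have Ga : `|ln delta| = G ^+ 2 by rewrite /G sqr_sqrtr.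
have s2 : 0 < Num.sqrt (ln 2 : R) by rewrite sqrtr_gt0 ln_gt0// ltr1n.
have G0parts : [/\ 1 <= G, 24 * Q1 * La <= G, 4 * Q1 * kappa * La <= G,
    48 * Q1 * F1 <= G & (Num.sqrt (ln 2))^-1 <= G].
  have h1 : 0 <= 24 * Q1 * La by rewrite !mulr_ge0 ?(ltW Q10) ?(ltW La0).
  have h2 : 0 <= 4 * Q1 * kappa * La.
    by rewrite !mulr_ge0 ?(ltW Q10) ?(ltW La0)//; exact: le_trans kap1.
  have h3 : 0 <= 48 * Q1 * F1 by rewrite !mulr_ge0 ?(ltW Q10).
  have h4 : 0 <= (Num.sqrt (ln 2 : R))^-1 by rewrite invr_ge0 ltW.
  by move: GdG; rewrite /G0; split; lra.
have [G1 GLa Gk GF Gl] := G0parts.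
have Gp : 0 < G by lra.
have Hp : 0 < H by lra.
have udE : ud = delta * G ^+ 2 by rewrite /ud Ga.
have udd : delta <= ud by rewrite udE ler_peMr ?(ltW d0)// exprn_ege1.
have uee : eps <= ue by rewrite /ue ler_peMr ?(ltW ep0).
have uu : (ue <= u) * (ud <= u).
  by split; rewrite /u le_max lexx ?orbT.
have u0 : 0 < u by apply: lt_le_trans (uu.1); apply: lt_le_trans uee.
have u01 : 0 < u <= 1 by rewrite u0 u1.
have LE : L = lambda * u `^ (- (nu + 1)^-1) by [].
have L1 : 1 <= L by rewrite LE; exact: max_level_ge1.
have Lu : L * u <= lambda by rewrite LE; exact: max_level_mul_le.
have xL : x <= L by rewrite /x /maxn; case: ifP.
pose p := x `^ nu.
have p0 : 0 < p by exact: powR_gt0.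
have key : p * x * u <= La by apply: level_power => //; rewrite -LE.
have p0' := ltW p0; have x0' := ltW x0; have d0' := ltW d0; have ep0' := ltW ep0.
have G0' := ltW Gp; have H0' := ltW Hp; have Q10' := ltW Q10; have C10' := ltW C10.
have px0 : 0 <= p * x by rewrite mulr_ge0.
have key2 v : v <= u -> p * x * v <= La.
  by move=> vu; apply: le_trans key; rewrite ler_wpM2l.
(* The typical row sums of [delta H] are of order [tt]: [level_power] bounds
   [delta |ln delta|] times [p x], and one factor [G] is left to make [tt] small. *)
pose tt := p * x * (delta * G).
have tt0 : 0 <= tt by rewrite !mulr_ge0.
have ttG : tt * G <= La.
  by have := key2 _ uu.2; rewrite udE; congr (_ <= _); rewrite /tt; ring.
have small (c : R) : 0 <= c -> c * La <= G -> c * tt <= 1.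
  move=> c0 cG; rewrite -(ler_pM2r La0) mul1r; apply: le_trans ttG.
  by rewrite mulrAC [tt * G]mulrC ler_wpM2r.
have S0 : 0 <= S.
  by rewrite /S /sig_threshold mulr_ge0// le_max mulr_ge0// mulr_ge0.
have Sd : p * (to * ud) <= S.
  by rewrite /S /sig_threshold ler_wpM2l// le_max lexx orbT.
have Se : p * (ts * ue) <= S.
  by rewrite /S /sig_threshold ler_wpM2l// le_max lexx.
have SLa : S <= (ts + to) * La.
  have to0 : 0 <= to by lra.
  have ud0 : 0 <= ud by apply: le_trans udd.
  have ue0 : 0 <= ue by apply: le_trans uee.
  apply: le_trans (_ : p * ((ts + to) * u) <= _).
    rewrite /S /sig_threshold ler_wpM2l// ge_max; apply/andP; split.
      by apply: ler_pM => //; [rewrite lerDl|exact: uu.1].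
    by apply: ler_pM => //; [rewrite lerDr|exact: uu.2].
  rewrite mulrCA ler_wpM2l ?addr_ge0//; apply: le_trans key.
  by rewrite ler_wpM2r ?(ltW u0)// ler_peMr.
have N1x : l.+1%:R <= 2 * x :> R.
  by rewrite /x -(natrM R 2) ler_nat succ_le_double.
have N1u : l.+1%:R * u <= 2 * lambda.
  apply: le_trans (ler_wpM2r (ltW u0) N1x) _; rewrite -mulrA ler_pM2l//.
  by apply: le_trans Lu; rewrite ler_wpM2r// ltW.
have N1d : l.+1%:R * delta <= 2 * lambda.
  by apply: le_trans N1u; rewrite ler_wpM2l// (le_trans udd)// uu.2.
have N1e : l.+1%:R * eps <= 2 * lambda.
  by apply: le_trans N1u; rewrite ler_wpM2l// (le_trans uee)// uu.1.
have opth : 0 < op_threshold kappa delta l /\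
    delta <= op_threshold kappa delta l <= kappa * x * (delta * G).
  have k0 : 0 <= kappa by lra.
  have lnm : ln 2 <= ln (maxn l 2)%:R :> R.
    by rewrite ler_ln ?posrE ?ltr0n ?leq_max ?orbT// ler_nat leq_max leqnn orbT.
  have ln20 : 0 < ln 2 :> R by rewrite ln_gt0// ltr1n.
  have lo : 1 <= Num.sqrt (x * ln (maxn l 2)%:R) * G.
    rewrite mulrC -ler_pdivrMr; last first.
      by rewrite sqrtr_gt0 mulr_gt0//; exact: lt_le_trans lnm.
    rewrite mul1r; apply: le_trans Gl; rewrite lef_pV2 ?posrE//; last first.
      by rewrite sqrtr_gt0 mulr_gt0//; exact: lt_le_trans lnm.
    apply: ler_wsqrtr; apply: (le_trans lnm); rewrite ler_peMl//.
    by apply: ltW; exact: lt_le_trans lnm.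
  have dle : delta <= op_threshold kappa delta l.
    rewrite /op_threshold -/x -/G.
    rewrite [leRHS](_ : _ = delta * (kappa * (Num.sqrt (x * ln (maxn l 2)%:R) * G))); last by ring.
    by rewrite ler_peMr// -[leLHS]mulr1 ler_pM.
  split; first exact: lt_le_trans dle.
  rewrite dle/= /op_threshold -/x -/G ler_wpM2r ?mulr_ge0// ler_wpM2l//.
  rewrite -[leRHS]ger0_norm// -sqrtr_sqr; apply: ler_wsqrtr.
  by rewrite expr2 ler_wpM2l// ln_nat_le.
have [th0 /andP[thd thk]] := opth.
have delta01 : 0 < delta <= 1 by rewrite d0/=; case/andP: delta0 => _ /ltW.
have eps01 : 0 < eps <= 1 by rewrite ep0/=; case/andP: eps0 => _ /ltW.
have stable : l.+1%:R * (delta * (6 * G * (Q1 * p))) <= 1 / 2.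
  have h : 0 <= delta * (6 * G * (Q1 * p)) by rewrite !mulr_ge0.
  apply: le_trans (ler_wpM2r h N1x) _.
  have := small (24 * Q1) (mulr_ge0 (ler0n _ 24) Q10') GLa.
  rewrite (_ : 24 * Q1 * tt = 2 * (2 * x * (delta * (6 * G * (Q1 * p))))); last by rewrite /tt; ring.
  lra.
have op_lt : 2 * opnorm (invmx (Kmat g l)) < (op_threshold kappa delta l)^-1.
  rewrite -[ltRHS]mul1r ltr_pdivlMr//.
  apply: le_lt_trans (_ : 2 * (Q1 * p) * (kappa * x * (delta * G)) < _).
    apply: ler_pM => //; [by rewrite mulr_ge0 ?opnorm_ge0|exact: ltW|].
    by rewrite ler_pM2l.
  have kQ : 0 <= 4 * Q1 * kappa by rewrite !mulr_ge0//; exact: le_trans kap1.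
  have := small _ kQ Gk.
  rewrite (_ : 4 * Q1 * kappa * tt = 2 * (2 * (Q1 * p) * (kappa * x * (delta * G)))); last by rewrite /tt; ring.
  lra.
have drift : 2 * (delta * (6 * G * (Q1 * p) * F1)) <= S / 4.
  have := ler_wpM2l (_ : 0 <= p * (delta * G)) GF; rewrite !mulr_ge0// => /(_ isT).
  have -> : p * (delta * G) * G = p * (1 * ud) by rewrite udE; ring.
  have ud0 : 0 <= ud by apply: le_trans udd.
  have : p * (1 * ud) <= S by apply: le_trans Sd; rewrite ler_wpM2l// ler_wpM2r.
  have -> : p * (delta * G) * (48 * Q1 * F1) = 4 * (2 * (delta * (6 * G * (Q1 * p) * F1))) by ring.
  lra.
have noise : 2 * (eps * (6 * H * (Q1 * p * C1))) <= S / 4.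
  have pe : 0 <= p * (eps * H) by rewrite !mulr_ge0.
  have := ler_wpM2l pe ts_ge.
  have -> : p * (eps * H) * ts = p * (ts * ue) by rewrite /ue -/H; ring.
  have -> : p * (eps * H) * (48 * Q1 * C1) = 4 * (2 * (eps * (6 * H * (Q1 * p * C1)))) by ring.
  move: Se; lra.
have opth' : (op_threshold kappa delta l)^-1 <= delta^-1 by rewrite lef_pV2 ?posrE.
have G60 : 0 <= 6 * G by rewrite mulr_ge0.
have H60 : 0 <= 6 * H by rewrite mulr_ge0.
have ad0 : 0 < (delta ^+ 9)^-1 by rewrite invr_gt0 exprn_gt0.
have ae0 : 0 < (eps ^+ 9)^-1 by rewrite invr_gt0 exprn_gt0.
have [X mX HX] := level_excess ib ie (Kmat_unit l g0) delta01 eps01 (F1P Hf _) S0 opA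
  (mulr_gt0 Q10 p0) C10 nT Gu HC G60 H60 ad0 ae0 stable op_lt drift noise opth'.
exists X => //.
case: mX => mX X0 XB; split=> //; apply: (le_trans XB); rewrite lee_fin.
have N11 : 1 <= l.+1%:R :> R by rewrite ler1n.
have e00 : 0 <= e0 by rewrite mulr_ge0 ?expR_ge0.
have A10 : 0 <= Q1 * p by rewrite mulr_ge0.
have AB : Q1 * p * C1 * eps <= Q1 * C1 * La.
  rewrite (_ : Q1 * p * C1 * eps = Q1 * C1 * (p * eps)); last by ring.
  rewrite ler_wpM2l ?mulr_ge0//; apply: le_trans (key2 _ uu.1).
  by rewrite -mulrA ler_wpM2l// -[leLHS]mul1r ler_pM.
apply: lerD.
  apply: le_trans (excess_operator_le N11 F10 C10' delta01 e00 _ _) _.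
  - by rewrite expR_pow_log.
  - by [].
  rewrite -/B1 mulrAC ler_wpM2r ?exprn_ge0// ler_wpM2r//; last first.
    by rewrite lerXn2r ?nnegrE ?mulr_ge0 ?(ltW lambda0).
  by rewrite /B1 addr_ge0 ?mulr_ge0 ?addr_ge0.
apply: le_trans (excess_signal_le N11 F10 S0 A10 C10' eps01 e00 AB _ _) _.
- by rewrite expR_pow_log.
- by [].
rewrite mulrAC ler_wpM2r ?exprn_ge0//; apply: ler_pM.
- by rewrite exprn_ge0// mulr_ge0.
- by rewrite !addr_ge0 ?mulr_ge0 ?addr_ge0 ?(ltW La0).
- by rewrite lerXn2r ?nnegrE ?mulr_ge0 ?(ltW lambda0).
- by rewrite /B2 lerD2r ler_wpM2l// lerD2l.
Qed.

Let rate := 2 * s / (2 * (s + nu) + 1).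

Lemma estimatorE (Kd : forall l, 'M[R]_l.+1) (y : forall l, 'cV[R]_l.+1) x :
  estimator lambda nu kappa ts to eps delta Kd y x =
  \sum_(0 <= l < (Num.truncn L).+1)
    thresholded (sig_threshold nu ts to eps delta l)
      (coef_estimator kappa delta (Kd l) (y l)) * laguerre l x.
Proof.
apply: eq_bigr => l _; rewrite /thresholded.
by case: ifP => _; rewrite ?mul0r.
Qed.

(** Pointwise, the loss is at most the oracle loss, which is deterministic, plus the
    sum over the levels of the majorants of [one_level_bound]; the trade-off bounds
    the former by the rate, and the expectation of the latter, at most [2 u], is
    negligible. *)
Lemma risk_le (Q C : R) n (T : R) (t : 'I_n -> R) d (Om : measurableType d)
    (P : probability Om R) (b : nat -> {RV P >-> R}) (eta : 'I_n -> {RV P >-> R})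
    (f g : R -> R) :
  Q <= Q1 -> C <= C1 ^+ 2 -> 0 <= n%:R / T -> regular_design T t L C ->
  (2 * lambda) ^+ 5 * B1 * delta <= 1 -> (2 * lambda) ^+ 3 * B2 * eps <= 1 ->
  iid_std_normal b -> iid_std_normal eta ->
  sobolev_ball s M f -> kernel_class nu Q g ->
  (risk lambda nu kappa ts to eps delta T t b eta f g <=
   ((Num.sqrt (lambda `^ (- (2 * s)) * M ^+ 2 +
      (2 * (3 / 2 * (ts + to)) ^+ 2 + M ^+ 2)) + 2) *
    Num.max (ud `^ rate) (ue `^ rate))%:E)%E.
Proof.
move=> QQ CC nT reg B1d B2e ib ie Hf [gL2 g0 Kop].
have La0 := La_gt0; have tto := to1; have tts := ts1; have s12' := s12; have nu0' := nu0.
have d0' := ltW d0; have ep0' := ltW ep0; have l0' := ltW lambda0.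
have Q10' := ltW Q10; have C10' := ltW C10.
have /andP[_ d1] := delta0; have /andP[_ e1] := eps0.
have lnd1 : 1 <= `|ln delta|.
  have h1 : 1 <= Num.sqrt `|ln delta|.
    apply: le_trans Gd; rewrite /G0 -!addrA lerDl !addr_ge0 ?invr_ge0 ?sqrtr_ge0//.
    - by rewrite !mulr_ge0 ?(ltW La0).
    - by rewrite !mulr_ge0 ?(ltW La0)//; exact: le_trans kappa1.
    - by rewrite !mulr_ge0.
  by rewrite -[leRHS]sqr_sqrtr// exprn_ege1.
have udd : delta <= ud by rewrite /ud ler_peMr.
have uee : eps <= ue by rewrite /ue ler_peMr.
have ueu : ue <= u by rewrite /u le_max lexx.
have udu : ud <= u by rewrite /u le_max lexx orbT.
have du : delta <= u by exact: le_trans udu.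
have eu : eps <= u by exact: le_trans ueu.
have u0 : 0 < u by apply: lt_le_trans du.
have u01 : 0 < u <= 1 by rewrite u0 u1.
have LE : L = lambda * u `^ (- (nu + 1)^-1) by [].
have L1 : 1 <= L by rewrite LE; exact: max_level_ge1.
have Lu : L * u <= lambda by rewrite LE; exact: max_level_mul_le.
pose N := (Num.truncn L).+1.
have /andP[NL LN] := truncn_itv (le_trans ler01 L1).
have N2L : N%:R <= 2 * L by rewrite /N -natr1; lra.
have Nu : N%:R * u <= 2 * lambda.
  apply: le_trans (ler_wpM2r (ltW u0) N2L) _; by rewrite -mulrA ler_pM2l.
have Nd : N%:R * delta <= 2 * lambda by apply: le_trans Nu; rewrite ler_wpM2l.
have Ne : N%:R * eps <= 2 * lambda by apply: le_trans Nu; rewrite ler_wpM2l.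
have e00 : 0 <= e0 by rewrite mulr_ge0 ?expR_ge0.
have to0 : 0 <= to by lra.
have B10 : 0 <= B1 by rewrite /B1 addr_ge0 ?mulr_ge0 ?addr_ge0.
have B20 : 0 <= B2 by rewrite /B2 !addr_ge0 ?mulr_ge0 ?addr_ge0 ?mulr_ge0 ?addr_ge0 ?(ltW La0).
pose D := (2 * lambda) ^+ 4 * B1 * delta ^+ 4 + (2 * lambda) ^+ 2 * B2 * eps ^+ 6.
have D0 : 0 <= D.
  by rewrite addr_ge0 ?mulr_ge0 ?exprn_ge0 ?mulr_ge0.
pose S l := sig_threshold nu ts to eps delta l.
pose z l w := coef_estimator kappa delta (obs_operator g delta (fun k => b k w) l)
  (obs_signal f g eps T t (\col_i eta i w) l).
pose a l := Num.min `|lcoef f l| (3 / 2 * S l).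
have S0 l : 0 <= S l.
  by rewrite mulr_ge0 ?powR_ge0// le_max mulr_ge0// mulr_ge0 ?sqrtr_ge0.
have SU l : S l <= (ts + to) * ((maxn l 1)%:R `^ nu * u).
  rewrite mulrCA /S /sig_threshold ler_wpM2l ?powR_ge0// ge_max; apply/andP; split.
    apply: ler_pM => //; [exact: le_trans uee|by rewrite lerDl].
  apply: ler_pM => //; [exact: le_trans udd|by rewrite lerDr].
have a0 l : 0 <= a l by rewrite le_min normr_ge0 mulr_ge0.
have af l : a l <= `|lcoef f l| by rewrite ge_min lexx.
have au l : a l <= 3 / 2 * (ts + to) * ((maxn l 1)%:R `^ nu * u).
  by rewrite -mulrA ge_min; apply/orP; right; rewrite ler_pM2l.
have HX l : exists X : Om -> R, mean_le P X D /\ ((l < N)%N ->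
    forall w, `|thresholded (S l) (z l w) - lcoef f l| <= a l + X w).
  have [lN|lN] := ltnP l N; last first.
    exists (fun=> 0); split=> //; have [? ? H] := @mean_le_cst _ _ _ P 0 (lexx 0).
    by split=> //; apply: le_trans H _; rewrite lee_fin.
  have lL : l%:R <= L by apply: le_trans NL; rewrite ler_nat -ltnS.
  have [Gu eig] := reg l lL.
  have opQ : opnorm (invmx (Kmat g l)) <= Q1 * (maxn l 1)%:R `^ nu.
    by apply: le_trans (Kop l) _; rewrite ler_wpM2r ?powR_ge0.
  have [X mX XP] := one_level_bound ib ie Hf g0 opQ nT Gu
    (fun x ex => le_trans (eig x ex) CC) lL.
  by exists X.
have [X XP] := choice HX.
have fL2 : inL2 f by case: Hf => -[].
pose det := Num.sqrt (tail_sq f N + \sum_(0 <= l < N) a l ^+ 2).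
have detle : det <= Num.sqrt (lambda `^ (- (2 * s)) * M ^+ 2 +
      (2 * (3 / 2 * (ts + to)) ^+ 2 + M ^+ 2)) * u `^ rate.
  apply: (tradeoff M0 s12 nu0 lambda0 u01 _ Hf _ a0 af au).
    by rewrite mulr_ge0 ?addr_ge0.
  by rewrite -LE L1 LN.
have ND : N%:R * D <= 2 * u.
  have dd k : 0 <= delta ^+ k by rewrite exprn_ge0.
  have ee k : 0 <= eps ^+ k by rewrite exprn_ge0.
  have h1 : N%:R * ((2 * lambda) ^+ 4 * B1 * delta ^+ 4) <= u.
    apply: le_trans du.
    rewrite [leLHS](_ : _ = N%:R * delta * ((2 * lambda) ^+ 4 * B1 * delta ^+ 3)); last by ring.
    apply: le_trans (ler_wpM2r _ Nd) _; first by rewrite !mulr_ge0 ?exprn_ge0 ?mulr_ge0.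
    rewrite [leLHS](_ : _ = (2 * lambda) ^+ 5 * B1 * delta * (delta * delta)); last by ring.
    rewrite -[leRHS]mul1r ler_pM ?mulr_ge0 ?exprn_ge0 ?mulr_ge0//.
    by rewrite ler_piMr// ltW.
  have h2 : N%:R * ((2 * lambda) ^+ 2 * B2 * eps ^+ 6) <= u.
    apply: le_trans eu.
    rewrite [leLHS](_ : _ = N%:R * eps * ((2 * lambda) ^+ 2 * B2 * eps ^+ 5)); last by ring.
    apply: le_trans (ler_wpM2r _ Ne) _; first by rewrite !mulr_ge0 ?exprn_ge0 ?mulr_ge0.
    rewrite [leLHS](_ : _ = (2 * lambda) ^+ 3 * B2 * eps * (eps ^+ 3 * eps)); last by ring.
    rewrite -[leRHS]mul1r ler_pM ?mulr_ge0 ?exprn_ge0 ?mulr_ge0//.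
    by rewrite ler_piMl// exprn_ile1// ltW.
  by rewrite /D mulrDr; lra.
have urate : u <= u `^ rate.
  apply: ger1_powR => //; rewrite /rate ler_pdivrMr; lra.
have umax : u `^ rate <= Num.max (ud `^ rate) (ue `^ rate).
  by rewrite /u /Num.max; case: ifP => _; rewrite le_max lexx ?orbT.
apply: (@le_trans _ _ (det + \sum_(0 <= l < N) D)%:E); last first.
  rewrite lee_fin sumr_const_nat subn0 -[D *+ _]mulr_natl mulrDl.
  apply: lerD; last by apply: le_trans ND _; rewrite ler_pM2l// (le_trans urate).
  by apply: le_trans detle _; rewrite ler_wpM2l// sqrtr_ge0.
apply: (integral_le_mean (G := fun w => det + \sum_(0 <= l < N) X l w)).
- by move=> w; exact: Lnorm_ge0.
- move=> w.
  have -> : (fun x => estimator lambda nu kappa ts to eps delta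
       (obs_operator g delta (fun k => b k w))
       (obs_signal f g eps T t (\col_i eta i w)) x - f x) =
     (fun x => \sum_(0 <= l < N) thresholded (S l) (z l w) * laguerre l x - f x).
    by apply/funext => x; rewrite estimatorE.
  rewrite (normL2_lincomb_sub (fun l => thresholded (S l) (z l w)))// lee_fin.
  apply: (@sqrt_sum_sqr_le _ N _ a (fun l => X l w)
    (fun l => thresholded (S l) (z l w) - lcoef f l)) => //.
  + exact: tail_sq_ge0.
  + by move=> l; have [[_ X0 _] _] := XP l.
  + by move=> l lN; have [_ /(_ lN)] := XP l.
- apply: mean_leD; first by apply: mean_le_cst; exact: sqrtr_ge0.
  by apply: mean_le_sum => l; case: (XP l).
Qed.

End noise_levels.
End risk_bound.

(** * Uniform bound over the classes *)

Lemma small_log_bound (R : realType) (x c : R) : 0 < c -> 0 < x < 1 ->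
  x <= c ^+ 2 / 4 -> x * `|ln x| <= c.
Proof.
move=> c0 x01 xc; apply: le_trans (mul_log_le x01) _.
have : Num.sqrt x <= c / 2.
  have -> : c / 2 = Num.sqrt ((c / 2) ^+ 2) by rewrite sqrtr_sqr ger0_norm// divr_ge0// ltW.
  by apply: ler_wsqrtr; apply: le_trans xc _; rewrite exprMn exprVn -natrX.
lra.
Qed.

Theorem theorem3p3 (R : realType) (M s nu Q lambda : R)
    (M_ge0 : 0 <= M) (s_gt : 1 / 2 < s) (nu_ge0 : 0 <= nu) (Q_ge0 : 0 <= Q)
    (lambda_gt0 : 0 < lambda) :
  exists c : R -> R -> R -> R,
  forall C : R, 0 <= C ->
  exists2 threshold : R, 0 < threshold &
  forall kappa tau_sig tau_op : R,
    threshold < kappa -> threshold < tau_sig -> threshold < tau_op ->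
  forall (sigma : R) (T : nat -> R) (t : forall n : nat, 'I_n -> R),
    0 < sigma -> is_design sigma T t ->
  exists eps0 delta0 : R, [/\ 0 < eps0, 0 < delta0 &
  forall (n : nat) (delta : R),
    let eps := noise_level sigma T n in
    0 < eps < eps0 -> 0 < delta < delta0 ->
    regular_design (T n) (t n) (max_level lambda nu eps delta) C ->
  forall (d : measure_display) (Om : measurableType d) (P : probability Om R)
    (b : nat -> {RV P >-> R}) (eta : 'I_n -> {RV P >-> R}),
    iid_std_normal b -> iid_std_normal eta -> independent_families b eta ->
    let rate := 2 * s / (2 * (s + nu) + 1) in
    (ereal_sup
       [set risk lambda nu kappa tau_sig tau_op eps delta (T n) (t n) b eta
              fg.1 fg.2
       | fg in sobolev_ball s M `*` kernel_class nu Q]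
     <= (c kappa tau_sig tau_op *
         Num.max ((delta * `|ln delta|) `^ rate)
                 ((eps * Num.sqrt `|ln eps|) `^ rate))%:E)%E].
Proof.
exists (fun _ ts to => Num.sqrt (lambda `^ (- (2 * s)) * M ^+ 2 +
  (2 * (3 / 2 * (ts + to)) ^+ 2 + M ^+ 2)) + 2).
move=> C C0.
have [Z Z0 HZ] := sobolev_abs_sum s_gt.
pose F1 := M ^+ 2 + Z; pose Q1 := Q + 1; pose C1 := Num.sqrt (C + 1).
have F10 : 0 <= F1 by rewrite addr_ge0 ?sqr_ge0.
have Q10 : 0 < Q1 by rewrite ltr_wpDl.
have C10 : 0 < C1 by rewrite sqrtr_gt0 ltr_wpDl.
have Q10' := ltW Q10; have C10' := ltW C10.
(* 48 = 2 * 4 * 6: the error is at most twice the noise, which is to be a quarter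
   of the threshold, and is allowed 6 standard deviations. *)
exists (1 + 48 * Q1 * C1); first by rewrite ltr_pwDl// !mulr_ge0.
move=> kappa ts to hk hts hto sigma T t sigma0 _.
have QC : 0 <= 48 * Q1 * C1 by rewrite !mulr_ge0.
have kappa1 : 1 <= kappa by lra.
have ts0 : 0 <= ts by lra.
have to1 : 1 <= to by lra.
have ts_ge : 48 * Q1 * C1 <= ts by lra.
pose La := lambda `^ (nu + 1); have La0 : 0 < La by exact: powR_gt0.
pose e0 : R := 2 * expR 2^-1.
have e00 : 0 <= e0 by rewrite mulr_ge0 ?expR_ge0.
pose G0 := 1 + 24 * Q1 * La + 4 * Q1 * kappa * La + 48 * Q1 * F1 + (Num.sqrt (ln 2))^-1.
pose B1 := 4 * F1 + (F1 + C1) * (2 + e0).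
pose B2 := 2 * (F1 + (ts + to) * La) + 2 * (Q1 * C1 * La) * (2 + e0).
have G01 : 1 <= G0.
  rewrite /G0 -!addrA lerDl !addr_ge0 ?invr_ge0 ?sqrtr_ge0//.
  - by rewrite !mulr_ge0 ?(ltW La0).
  - by rewrite !mulr_ge0 ?(ltW La0)//; exact: le_trans kappa1.
  - by rewrite !mulr_ge0.
have to0 : 0 <= to by lra.
have l20 : 0 <= 2 * lambda by rewrite mulr_ge0 ?(ltW lambda_gt0).
have B10 : 0 <= (2 * lambda) ^+ 5 * B1.
  apply: mulr_ge0; first exact: exprn_ge0.
  apply: addr_ge0; apply: mulr_ge0 => //; exact: addr_ge0.
have B20 : 0 <= (2 * lambda) ^+ 3 * B2.
  apply: mulr_ge0; first exact: exprn_ge0.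
  have La0' := ltW La0; have tto : 0 <= ts + to by exact: addr_ge0.
  have e02 : 0 <= 2 + e0 by exact: addr_ge0.
  apply: addr_ge0; apply: mulr_ge0 => //.
    by apply: addr_ge0 => //; exact: mulr_ge0.
  by do 3![apply: mulr_ge0 => //].
(* Both noise levels are taken so small that their maximum [u] in the rate is at
   most 1 and at most [La], the latter making the maximal level at least 1. *)
pose c := Num.min 1 La.
have c0 : 0 < c by rewrite lt_min ltr01.
have c24 : 0 < c ^+ 2 / 4 by rewrite divr_gt0 ?exprn_gt0.
(* The first terms bound [sqrt |ln eps|] and [sqrt |ln delta|] from below by 1 and
   [G0], the last ones absorb the constants of the improbable events. *)
exists (Num.min (expR (- 1 ^+ 2)) (Num.min (c ^+ 2 / 4) ((2 * lambda) ^+ 3 * B2 + 1)^-1)).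
exists (Num.min (expR (- G0 ^+ 2)) (Num.min (c ^+ 2 / 4) ((2 * lambda) ^+ 5 * B1 + 1)^-1)).
split; [by rewrite !lt_min expR_gt0 c24 invr_gt0 ltr_wpDl..|].
move=> n delta eps /andP[ep0]; rewrite !lt_min => /and3P[ep1 ep2 ep3].
move=> /andP[d0 /and3P[d1 d2 d3]] reg d Om P b eta ib ie _; cbv zeta.
have expN1 (x : R) : 1 <= x -> expR (- x ^+ 2) < 1.
  by move=> x1; rewrite expR_lt1 oppr_lt0 exprn_gt0//; lra.
have delta01 : 0 < delta < 1 by rewrite d0 (lt_trans d1)// expN1.
have eps01 : 0 < eps < 1 by rewrite ep0 (lt_trans ep1)// expN1.
have Gd := sqrt_log_ge (le_trans ler01 G01) d0 (ltW d1).
have Ge := sqrt_log_ge ler01 ep0 (ltW ep1).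
have ue : eps * Num.sqrt `|ln eps| <= c.
  apply: le_trans (small_log_bound c0 eps01 (ltW ep2)).
  rewrite ler_pM2l// -{2}(@sqr_sqrtr _ `|ln eps|)// expr2 ler_peMl//.
have ud := small_log_bound c0 delta01 (ltW d2).
have uc : Num.max (eps * Num.sqrt `|ln eps|) (delta * `|ln delta|) <= c.
  by rewrite ge_max ue ud.
have small (x B : R) : 0 < x -> 0 <= B -> x < (B + 1)^-1 -> B * x <= 1.
  move=> x0 B0; rewrite -[ltRHS]mul1r ltr_pdivlMr; last by rewrite ltr_wpDl.
  by rewrite mulrDr mulr1 mulrC => /ltW; lra.
(* The sign of the horizon is implied by [eps > 0]. *)
have nT : 0 <= n%:R / T n.
  have : 0 < Num.sqrt (T n / n%:R) by move: ep0; rewrite /eps /noise_level pmulr_rgt0.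
  by rewrite sqrtr_gt0 -invr_gt0 invf_div => /ltW.
apply: ge_ereal_sup => _ [[f g] [/= Hf Hg] <-].
apply: (@risk_le R s nu lambda M Q1 F1 C1 kappa ts to _ _ _ _ _ _ _ _ _ _ _ _
  delta eps _ _ _ _ _ _ Q C n (T n) (t n) d Om P b eta f g) => //.
- by move=> h Hh N; exact: HZ.
- by apply: le_trans uc _; rewrite ge_min lexx.
- by apply: le_trans uc _; rewrite ge_min lexx orbT.
- by rewrite /Q1 lerDl.
- by rewrite /C1 sqr_sqrtr ?lerDl// addr_ge0.
- exact: small.
- exact: small.
Qed.
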